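(* Let $(G,H)$ be a correlated inhomogeneous graph system with constant subsampling parameter $s\in(0,1]$ and planted matching $\pi^*$, where the mother graph $G^\uparrow$ follows the stochastic block model with communities $V_1,\dots,V_m$. Denote by $\alpha_i=\frac{|V_i|}{n}$ the (normalised) size of community $i$ and by $\frac{q_{ij}}{n}$ the edge probability from $V_i$ to $V_j$, and define $\lambda=\lambda_n$ to be the Perron–Frobenius eigenvalue of the matrix $$QD=(q_{ij})_{1\leq i,j\leq m}\cdot\operatorname{diag}(\alpha_1,\dots,\alpha_m).$$ Assume that for any $i,j$, $q_{ij}>0$ is a constant, independent of $n$. Then: 1. If $\operatorname{pliminf}_{n\to+\infty}(s^2\lambda_n)>1$, then there is $\delta>0$ such that the maximal-dense-set estimator $\hat\pi=\hat\pi_\delta$ satisfies $\operatorname{pliminf}_{n\to+\infty}ov(\hat\pi,\pi^* )>0$ (partial alignment is feasible). 2. If $\operatorname{plimsup}_{n\to+\infty}(s^2\lambda_n)<1$, then for any estimator $\hat\pi'$ of $\pi^*$, $\operatorname{plimsup}_{n\to+\infty}ov(\hat\pi',\pi^* )=0$ (partial alignment is intractable).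
   Context: **Graphs.** $n\to+\infty$, $V=[n]$, $E=\{\{u,v\}:u\neq v\in V\}$, $\mathcal S_n$ is the group of permutations of $[n]$. A graph over $V$ is identified with its edge set. For $\sigma\in\mathcal S_n$, $\sigma(\{u,v\})=\{\sigma(u),\sigma(v)\}$, $\sigma(K)=\{\sigma(e):e\in K\}$, $K\land_\sigma K'=\sigma(K)\cap K'$, $K\lor_\sigma K'=\sigma(K)\cup K'$. $\operatorname{Der}\sigma=\{v\in V:\sigma(v)\neq v\}$. $ov(\sigma,\sigma')=\frac1n\#\{v\in[n]:\sigma(v)=\sigma'(v)\}$. **Balanced load.** Let $\vec E(K)$ be the set of directed edges $(u\to v)$ with $\{u,v\}\in K$. An allocation on $K$ is a map $\theta:\vec E(K)\to[0,1]$ with $\theta(u\to v)+\theta(v\to u)=1$; its load is $\partial\theta(v)=\sum_{u:\{u,v\}\in K}\theta(u\to v)$. It is balanced if for every edge $\{u,v\}$, $\partial\theta(u)<\partial\theta(v)$ implies $\theta(u\to v)=0$. Balanced allocations exist and all have the same load function, denoted $w_K:V\to\mathbb R_+$. **Probabilistic notation.** $\operatorname{plimsup}_nX_n=\sup\{x\in\mathbb R:\limsup_n\mathbb P(X_n\geq x)>0\}$ and $\operatorname{pliminf}_nX_n=-\operatorname{plimsup}_n(-X_n)$. **Self-overlap.** For a sequence of random graphs $K=K_n$ over $[n]$, $$SOV(K)=\lim_{\varepsilon\to0}\operatorname*{plimsup}_{n\to+\infty}\max_{\sigma\in\mathcal S_n}\ \max_{\mathcal A\subseteq\operatorname{Der}\sigma,\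 |\mathcal A|\geq\varepsilon n}\ \min_{v\in\mathcal A}w_{(K\land_\sigma K)}(v).$$ **Stochastic block model.** The vertex set $[n]$ is partitioned into $m$ unknown (possibly random) communities $V_1,\dots,V_m$, for a fixed $m\geq1$, and $(q_{ij})_{1\leq i,j\leq m}$ is a symmetric matrix. Set $p_{\{u,v\}}=q_{ij}/n$ for $u\in V_i$, $v\in V_j$, $v\neq u$ ($n$ large enough that these are in $[0,1]$). Conditionally on $(p_e)_{e\in E}$, $G^\uparrow$ has independent edges, $e$ being present with probability $p_e$. **Correlated inhomogeneous graph system.** $K_1,K_2$ are obtained from $G^\uparrow$ by keeping each edge of $G^\uparrow$ with probability $s$, independently for each edge and for each of $K_1,K_2$. $\pi^*\in\mathcal S_n$ is uniformly random, independent of everything else, and $G=(\pi^* )^{-1}(K_1)$, $H=K_2$. An estimator of $\pi^*$ is an $\mathcal S_n$-valued function of $(G,H)$. $U=G\lor_{\pi^*}H$ is the true union graph. **Estimator.** Let $\rho=SOV(U)$. For $\delta>0$, the maximal-dense-set estimator $\hat\pi_\delta$ is a permutation $\sigma\in\mathcal S_n$ (function of $(G,H)$) maximising $\#\{v\in[n]:w_{G\land_\sigma H}(v)\geq\rho+\delta\}$ over $\mathcal S_n$. *)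

(* Defs.v *)
From HB Require Import structures.
From mathcomp Require Import all_boot all_order all_algebra all_fingroup.
From mathcomp Require Import all_classical all_reals all_analysis.
From mathcomp Require Import complex.

Set Implicit Arguments.
Unset Strict Implicit.
Unset Printing Implicit Defensive.

Import Order.TTheory GRing.Theory Num.Theory.
Import numFieldNormedType.Exports.

Local Open Scope classical_set_scope.
Local Open Scope ring_scope.

(* A graph over [n] is its set of edges. The type does not force the members
   to be pairs: a graph is simple when K \subset edges n. *)
Definition graph (n : nat) := {set {set 'I_n}}.

Definition edges (n : nat) : graph n := finset (fun e : {set 'I_n} => #|e| == 2%N).

Definition graph_image n (sigma : 'S_n) (K : graph n) : graph n :=
  [set sigma @: e | e : {set 'I_n} in K]%SET.

Definition graph_meet n (sigma : 'S_n) (K K' : graph n) : graph n :=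
  graph_image sigma K :&: K'.

Definition graph_join n (sigma : 'S_n) (K K' : graph n) : graph n :=
  graph_image sigma K :|: K'.

Definition Der n (sigma : 'S_n) : {set 'I_n} :=
  finset (fun v => sigma v != v).

Section BalancedLoad.
Context {R : realType} {n : nat}.
Implicit Types (K : graph n) (theta : 'M[R]_n).

Definition adj K (u v : 'I_n) : bool :=
  (u != v) && ([set u; v]%SET \in K).

(* [theta u v] is the value at the directed edge u -> v; the entries at
   pairs that are not edges of K are irrelevant. *)
Definition allocation K theta : Prop :=
  forall u v, adj K u v ->
    0 <= theta u v <= 1 /\ theta u v + theta v u = 1.

Definition load K theta (v : 'I_n) : R := \sum_(u | adj K u v) theta u v.

Definition balanced K theta : Prop :=
  allocation K theta /\
  forall u v, adj K u v -> load K theta u < load K theta v -> theta u v = 0.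

(* Balanced allocations exist and all have the same load: the choice made by
   [xget] is immaterial. *)
Definition balanced_load K : 'I_n -> R :=
  load K (xget 0 [set theta : 'M[R]_n | balanced K theta]).

Definition ov (sigma sigma' : 'S_n) : R :=
  #|finset (fun v => sigma v == sigma' v)|%:R / n%:R.

End BalancedLoad.

Section ProbabilisticLimits.
Context {R : realType} {d : nat -> measure_display}.
Context {T : forall n, measurableType (d n)}.
Variable P : forall n, probability (T n) R.
Local Open Scope ereal_scope.

Definition plimsup (X : forall n, T n -> \bar R) : \bar R :=
  ereal_sup (EFin @` [set x : R |
    0 < limn_esup (fun n => P n [set w | x%:E <= X n w])]).

Definition pliminf (X : forall n, T n -> \bar R) : \bar R :=
  - plimsup (fun n w => - X n w).

(* The maximum over an empty family is -oo, the minimum +oo; for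
   0 < eps <= 1 and n >= 2 all the families below are nonempty. *)
Definition self_overlap_at n (eps : R) (K : graph n) : \bar R :=
  \big[Order.max/-oo]_(sigma : 'S_n)
    \big[Order.max/-oo]_(A : {set 'I_n} |
        (A \subset Der sigma) && (eps * n%:R <= #|A|%:R)%R)
      \big[Order.min/+oo]_(v in A)
        (balanced_load (graph_meet sigma K K) v)%:E.

Definition SOV (K : forall n, T n -> graph n) : \bar R :=
  lim ((fun eps : R => plimsup (fun n w => self_overlap_at eps (K n w)))
         @ 0^'+).

End ProbabilisticLimits.

Section Model.
Context {R : realType} {n m : nat}.

(* Law of a random graph with independent edges, {u, v} having probability
   p u v; each unordered pair is enumerated once, as u < v. *)
Definition indep_edges_pmf (p : 'I_n -> 'I_n -> R) (g : graph n) : R :=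
  if g \subset edges n then
    \prod_(u : 'I_n) \prod_(v : 'I_n | (u < v)%N)
      (if [set u; v]%SET \in g then p u v else 1 - p u v)
  else 0.

(* Communities are given by the map sending a vertex to the index of its
   community. *)
Definition edge_prob (Q : 'M[R]_m) (c : {ffun 'I_n -> 'I_m}) (u v : 'I_n) : R :=
  Q (c u) (c v) / n%:R.

Definition community_sizes (c : {ffun 'I_n -> 'I_m}) : 'rV[R]_m :=
  \row_i (#|finset (fun v => c v == i)|%:R / n%:R).

Context {d : measure_display} {T : measurableType d}.
Variable P : probability T R.

Definition discrete_rv (X : Type) (f : T -> X) : Prop :=
  forall x, measurable (f @^-1` [set x]).

Definition same_edge_probs (Q : 'M[R]_m) (com : T -> {ffun 'I_n -> 'I_m})
    (c : {ffun 'I_n -> 'I_m}) : set T :=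
  [set w | forall u v, u != v ->
     edge_prob Q (com w) u v = edge_prob Q c u v].

(* Conditioning is on the edge probabilities (p_e)_e only, not on the
   communities themselves. *)
Definition stochastic_block_model (Q : 'M[R]_m)
    (com : T -> {ffun 'I_n -> 'I_m}) (Gup : T -> graph n) : Prop :=
  [/\ discrete_rv com, discrete_rv Gup &
    forall c g,
      (P (same_edge_probs Q com c `&` Gup @^-1` [set g]) =
       P (same_edge_probs Q com c) *
         (indep_edges_pmf (edge_prob Q c) g)%:E)%E].

(* Given Gup = g, a subsampled graph has independent edges, of probability s
   on g and 0 elsewhere. *)
Definition subsampled (s : R) (com : T -> {ffun 'I_n -> 'I_m})
    (Gup K1 K2 : T -> graph n) : Prop :=
  [/\ discrete_rv K1, discrete_rv K2 &
    forall c (g k1 k2 : graph n),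
      let keep := fun u v : 'I_n => if [set u; v]%SET \in g then s else 0 in
      (P (com @^-1` [set c] `&` Gup @^-1` [set g]
            `&` K1 @^-1` [set k1] `&` K2 @^-1` [set k2]) =
       P (com @^-1` [set c] `&` Gup @^-1` [set g])
         * (indep_edges_pmf keep k1)%:E * (indep_edges_pmf keep k2)%:E)%E].

Definition uniform_independent_perm (com : T -> {ffun 'I_n -> 'I_m})
    (Gup K1 K2 : T -> graph n) (pistar : T -> 'S_n) : Prop :=
  discrete_rv pistar /\
  forall c g k1 k2 sigma,
    let A := com @^-1` [set c] `&` Gup @^-1` [set g]
               `&` K1 @^-1` [set k1] `&` K2 @^-1` [set k2] in
    (P (A `&` pistar @^-1` [set sigma]) = P A * ((n`!)%:R^-1)%:E)%E.

Definition correlated_sbm_system (Q : 'M[R]_m) (s : R)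
    (com : T -> {ffun 'I_n -> 'I_m}) (Gup K1 K2 : T -> graph n)
    (pistar : T -> 'S_n) : Prop :=
  [/\ stochastic_block_model Q com Gup,
      subsampled s com Gup K1 K2 &
      uniform_independent_perm com Gup K1 K2 pistar].

End Model.

Section PerronFrobenius.
Context {R : realType} {m : nat}.
Implicit Type A : 'M[R]_m.

(* The Perron-Frobenius eigenvalue is the real eigenvalue that dominates the
   modulus of every complex eigenvalue; it is unique, and exists when the
   entries of A are nonnegative and m > 0. *)
Definition is_perron_frobenius A (r : R) : Prop :=
  eigenvalue A r /\
  forall z : R[i]%C, eigenvalue (map_mx (real_complex R) A) z ->
    `|z| <= real_complex R r.

Definition perron_frobenius A : R := xget 0 [set r | is_perron_frobenius A r].

End PerronFrobenius.

Definition estimator (n : nat) := graph n -> graph n -> 'S_n.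

Section Estimators.
Context {R : realType} {n : nat}.
Implicit Types (sigma : 'S_n) (G H : graph n).

Definition dense_count (rho : \bar R) (delta : R) G H sigma : nat :=
  #|finset (fun v : 'I_n =>
      (rho + delta%:E <= (balanced_load (graph_meet sigma G H) v)%:E)%E)|.

(* Any choice of a maximiser is allowed. *)
Definition maximal_dense_set_estimator (rho : \bar R) (delta : R)
    (hatpi : estimator n) : Prop :=
  forall G H, G \subset edges n -> H \subset edges n ->
  forall sigma,
    (dense_count rho delta G H sigma <=
     dense_count rho delta G H (hatpi G H))%N.

End Estimators.

(* Main.v *)
(** Let K1, K2 be the two subsampled graphs. Their intersection is a block model
    of mean matrix s^2 Q, and the true union is contained in the mother graph.

    Supercritical case. A first moment bound over permutations, organised by the
    cycles they induce on edges, shows that a sparse graph with independent edges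
    asymptotically has no copy of itself overlapping it in a set of linear size whose
    balanced load exceeds 1 + delta; hence 0 <= SOV <= 1. On the other hand,
    exploring K1 /\ K2 with vertices weighted by the Perron eigenvector, which
    makes the active mass drift upwards, produces in mean a linear number of edges
    in excess of vertices; by concentration K1 /\ K2 has with high probability a
    linear set of load at least 1 + delta. The matching pi* thus has a linear dense
    set, so the estimator has one too, and if it disagreed with pi* on most of this
    set it would exhibit a self-overlap of the union larger than SOV.

    Subcritical case. The same eigenvector makes path counts in K1 /\ K2 decay
    geometrically, so that typical components are bounded. Exchanging a component
    with one of the many others of the same type turns a matching into another of
    comparable likelihood; hence no vertex has a non-negligible posterior
    probability of being matched correctly. *)
Require Import Defs.
From HB Require Import structures.
From mathcomp Require Import all_boot all_order all_algebra all_fingroup.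
From mathcomp Require Import all_classical all_reals all_analysis.
From mathcomp Require Import complex.
From mathcomp Require Import zify ring lra.
(* Last, so that the names of finset prevail over those of classical_sets. *)
From mathcomp Require Import seq bigop fintype finset.

Set Implicit Arguments.
Unset Strict Implicit.
Unset Printing Implicit Defensive.

Import Order.TTheory GRing.Theory Num.Theory.
Import numFieldNormedType.Exports.

Local Open Scope ring_scope.

(** The self-overlap bound takes a union over all n! permutations, so the exact power of n matters.
    Put e^L = n/(2q), where q/n bounds the edge probabilities. A permutation with k cycles is
    charged e^(-L(n-k)), and so charged all permutations together weigh only e^(O(n)). A copied edge
    can afford a reward e^(Lw) with w <= 1, because (q/n) e^L = 1/2. The vertex weights
    [cycle_weight] add up to at least n-k over the dense set, so load 1 is the break-even point, and
    load 1 + delta leaves a factor e^(-cLn), which beats every e^(O(n)). The danger comes from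
    orbits of edges copied entirely, where no additional edge is paid for at the end of a run; the
    deficit 1/length in the weight of a cycle inside the set keeps their contribution to the
    exponent of order n. In the converse direction the swap has to be a function of the intersection
    graph and to preserve it: otherwise the swapped matching would not determine the swap. Estimates
    are finite sums over subsets of a finite type. Measures enter only at the end, where the law of
    the mother graph is known given the edge probabilities but not given the communities. *)

(** * Random subsets with independent coordinates *)

Section RandomSubset.
Context {R : realType} {I : finType}.
Implicit Types (p : I -> R) (f g : {set I} -> R) (X Y J A : {set I}).

Definition wt p X : R := \prod_i (if i \in X then p i else 1 - p i).

Definition EE p f : R := \sum_X wt p X * f X.

Definition Pr p (B : {set I} -> bool) : R := EE p (fun X => (B X)%:R).

Definition prob_weights p := forall i, 0 <= p i <= 1.

Definition depends_on J f := forall X, f X = f (X :&: J).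

Definition mix J X Y : {set I} := (X :&: J) :|: (Y :\: J).

Lemma wt_ge0 p X : prob_weights p -> 0 <= wt p X.
Proof.
move=> hp; apply: prodr_ge0 => i _; have /andP[h0 h1] := hp i.
by case: ifP => // _; rewrite subr_ge0.
Qed.

Lemma sum_set_prod (F G : I -> R) :
  \sum_(X : {set I}) \prod_i (if i \in X then F i else G i) = \prod_i (F i + G i).
Proof.
transitivity (\prod_i \sum_(b : bool) (if b then F i else G i)); last first.
  by apply: eq_bigr => i _; rewrite big_bool.
rewrite (bigA_distr_bigA (fun i (b : bool) => if b then F i else G i)).
rewrite (reindex (fun X : {set I} => [ffun i => i \in X])) /=.
  by apply: eq_bigr => X _; apply: eq_bigr => i _; rewrite ffunE.
exists (fun h : {ffun I -> bool} => [set i | h i]) => [X _|h _].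
  by apply/setP => i; rewrite !inE ffunE.
by apply/ffunP => i; rewrite ffunE inE.
Qed.

Lemma sum_wt p : \sum_X wt p X = 1.
Proof. by rewrite sum_set_prod big1 // => i _; rewrite addrC subrK. Qed.

Lemma EE_cst p a : EE p (fun=> a) = a.
Proof. by rewrite /EE -mulr_suml sum_wt mul1r. Qed.

Lemma eq_EE p f g : f =1 g -> EE p f = EE p g.
Proof. by move=> fg; apply: eq_bigr => X _; rewrite fg. Qed.
Arguments eq_EE {p f g}.

Lemma EE_D p f g : EE p (fun X => f X + g X) = EE p f + EE p g.
Proof. by rewrite /EE -big_split /=; apply: eq_bigr => X _; rewrite mulrDr. Qed.

Lemma EE_Z p a f : EE p (fun X => a * f X) = a * EE p f.
Proof. by rewrite /EE mulr_sumr; apply: eq_bigr => X _; rewrite mulrCA. Qed.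

Lemma EE_B p f g : EE p (fun X => f X - g X) = EE p f - EE p g.
Proof.
rewrite EE_D; congr (_ + _); rewrite -mulN1r -EE_Z.
by apply: eq_EE => X; rewrite mulN1r.
Qed.

Lemma EE_sum (K : Type) (r : seq K) (P : pred K) p (F : K -> {set I} -> R) :
  EE p (fun X => \sum_(k <- r | P k) F k X) = \sum_(k <- r | P k) EE p (F k).
Proof. by rewrite /EE exchange_big /=; apply: eq_bigr => X _; rewrite mulr_sumr. Qed.

Lemma EE_le p f g : prob_weights p -> (forall X, f X <= g X) -> EE p f <= EE p g.
Proof.
by move=> hp fg; apply: ler_sum => X _; apply: ler_wpM2l => //; apply: wt_ge0.
Qed.

Lemma prob_weights_onem p : prob_weights p -> forall i, 0 <= 1 - p i.
Proof. by move=> hp i; rewrite subr_ge0; case/andP: (hp i). Qed.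

Lemma Pr_le p (B C : {set I} -> bool) : prob_weights p ->
  (forall X, B X -> C X) -> Pr p B <= Pr p C.
Proof.
move=> hp BC; apply: EE_le => // X; rewrite ler_nat.
by case BX: (B X) => //; rewrite (BC _ BX).
Qed.

Lemma Pr_subset p A : Pr p (fun X => A \subset X) = \prod_(i in A) p i.
Proof.
have -> : Pr p (fun X => A \subset X) =
    \sum_(X : {set I}) \prod_i (if i \in X then p i else if i \in A then 0 else 1 - p i).
  apply: eq_bigr => X _; case: (boolP (A \subset X)) => [AX|/subsetPn[i iA iX]].
    rewrite mulr1; apply: eq_bigr => i _; case: ifPn => // iX.
    by rewrite (negbTE (contra (fintype.subsetP AX i) iX)).
  by rewrite mulr0 (bigD1 i) //= (negbTE iX) iA mul0r.
rewrite sum_set_prod [RHS]big_mkcond; apply: eq_bigr => i _.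
by case: ifP; rewrite ?addr0 // addrC subrK.
Qed.

(** The two mixes exchange the coordinates outside J between two samples. This involution preserves
    the product weight and is the change of variables behind [EE_mix]. *)
Lemma mixK J X Y : mix J (mix J X Y) (mix J Y X) = X.
Proof. by apply/setP => i; rewrite !inE; case: (i \in J); rewrite ?andbT ?andbF ?orbF. Qed.

Lemma wt_mix p J X Y : wt p (mix J X Y) * wt p (mix J Y X) = wt p X * wt p Y.
Proof.
rewrite -!big_split; apply: eq_bigr => i _ /=; rewrite !inE.
by case: (i \in J); rewrite ?andbT ?andbF ?orbF //= mulrC.
Qed.

(* Resampling the coordinates outside J leaves the law unchanged. *)
Lemma EE_mix p J f : EE p (fun X => EE p (fun Y => f (mix J X Y))) = EE p f.
Proof.
have -> : EE p f = EE p (fun X => EE p (fun Y => f X)).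
  by apply: eq_EE => X; rewrite EE_cst.
have E (h : {set I} -> {set I} -> R) : EE p (fun X => EE p (h X)) =
    \sum_(z : {set I} * {set I}) wt p z.1 * wt p z.2 * h z.1 z.2.
  rewrite -(pair_bigA _ (fun X Y => wt p X * wt p Y * h X Y)) /=.
  apply: eq_bigr => X _; rewrite mulr_sumr.
  by apply: eq_bigr => Y _; rewrite mulrA.
rewrite !E (reindex_inj (h := fun z => (mix J z.1 z.2, mix J z.2 z.1))) /=.
  by apply: eq_bigr => -[X Y] _ /=; rewrite wt_mix mixK.
by apply: (can_inj (g := fun z => (mix J z.1 z.2, mix J z.2 z.1))) => -[X Y] /=; rewrite !mixK.
Qed.

Lemma mixIJ J X Y : mix J X Y :&: J = X :&: J.
Proof. by apply/setP => i; rewrite !inE; case: (i \in J); rewrite ?andbF ?orbF ?andbT. Qed.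

Lemma mixIC J X Y : mix J X Y :&: ~: J = Y :&: ~: J.
Proof. by apply/setP => i; rewrite !inE; case: (i \in J); rewrite ?andbF ?orbF ?andbT. Qed.

Lemma depends_mixl J f X Y : depends_on J f -> f (mix J X Y) = f X.
Proof. by move=> fJ; rewrite fJ mixIJ -fJ. Qed.

Lemma depends_mixr J f X Y : depends_on (~: J) f -> f (mix J X Y) = f Y.
Proof. by move=> fJ; rewrite fJ mixIC -fJ. Qed.

Lemma depends_onS J A f : J \subset A -> depends_on J f -> depends_on A f.
Proof. by move=> JA fJ X; rewrite fJ [RHS]fJ -setIA (setIidPr JA). Qed.

Lemma EE_indep p J f g : depends_on J f -> depends_on (~: J) g ->
  EE p (fun X => f X * g X) = EE p f * EE p g.
Proof.
move=> fJ gJ; rewrite -(EE_mix p J) mulrC -EE_Z; apply: eq_EE => X.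
rewrite mulrC -EE_Z; apply: eq_EE => Y.
by rewrite depends_mixl // depends_mixr.
Qed.

(** This is the Markov property of an exploration: once N has been read off the coordinates in J,
    whatever follows uses only the others and may be evaluated on a fresh sample. *)
Lemma EE_cond p J (A : finType) (N : {set I} -> A) (h : A -> {set I} -> R) :
  (forall X, N X = N (X :&: J)) -> (forall a, depends_on (~: J) (h a)) ->
  EE p (fun X => h (N X) X) = EE p (fun X => EE p (h (N X))).
Proof.
move=> NJ hJ; rewrite -(EE_mix p J); apply: eq_EE => X; apply: eq_EE => Y.
by rewrite depends_mixr // NJ mixIJ -NJ.
Qed.

Lemma Pr_mem p i : Pr p (fun X => i \in X) = p i.
Proof.
rewrite -[RHS](big_set1 *%R i p) -Pr_subset.
by apply: eq_EE => X; rewrite sub1set.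
Qed.

(** This is the conditional expectation of f given all coordinates other than i. *)
Definition avg p i f X : R := p i * f (i |: X) + (1 - p i) * f (X :\ i).

Lemma EE_avg p i f : EE p (avg p i f) = EE p f.
Proof.
rewrite -[RHS](EE_mix p (~: [set i])); apply: eq_EE => X.
have E Y : f (mix (~: [set i]) X Y) = (i \in Y)%:R * (f (i |: X) - f (X :\ i)) + f (X :\ i).
  case: (boolP (i \in Y)) => iY; rewrite ?mul1r ?mul0r ?subrK ?add0r; congr f;
  apply/setP => j; rewrite !inE negbK; case: eqVneq => [->|] //=;
  by rewrite ?iY ?(negbTE iY) ?andbT ?andbF ?orbF //= ?andbF ?orbF.
rewrite (eq_EE E) EE_D EE_cst.
rewrite (eq_EE (fun Y => mulrC (i \in Y)%:R (f (i |: X) - f (X :\ i)))).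
by rewrite EE_Z -/(Pr p _) Pr_mem /avg; ring.
Qed.

Definition lipschitz (L : R) f := forall i X, `|f (i |: X) - f (X :\ i)| <= L.

Lemma avg_lipschitz p i f L : prob_weights p -> lipschitz L f -> lipschitz L (avg p i f).
Proof.
move=> hp fL j X; have /andP[p0 _] := hp i; have q0 := prob_weights_onem hp i.
have L0 : 0 <= L by apply: le_trans (fL j X).
have [->|ij] := eqVneq j i.
  have -> : avg p i f (i |: X) = avg p i f (X :\ i).
    by rewrite /avg; congr (_ * f _ + _ * f _); apply/setP => k; rewrite !inE; case: eqVneq.
  by rewrite subrr normr0.
have -> : avg p i f (j |: X) - avg p i f (X :\ j) =
   p i * (f (j |: (i |: X)) - f ((i |: X) :\ j)) +
   (1 - p i) * (f (j |: (X :\ i)) - f ((X :\ i) :\ j)).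
  rewrite /avg setUCA (_ : (j |: X) :\ i = j |: (X :\ i)); last first.
    by apply/setP => k; rewrite !inE; case: (eqVneq k i) => // ->; rewrite eq_sym (negbTE ij).
  rewrite (_ : i |: X :\ j = (i |: X) :\ j); last first.
    by apply/setP => k; rewrite !inE; case: (eqVneq k j) => // ->; rewrite (negbTE ij).
  rewrite (_ : (X :\ j) :\ i = (X :\ i) :\ j); last first.
    by apply/setP => k; rewrite !inE; case: (k == i); rewrite ?andbF.
  ring.
rewrite (le_trans (ler_normD _ _)) // !normrM (ger0_norm p0) (ger0_norm q0).
have := fL j (i |: X); have := fL j (X :\ i); nra.
Qed.

(** An Efron-Stein bound: the coordinates of J are averaged out one at a time, and averaging
    coordinate i loses a variance p(1-p) times a squared difference, hence at most L^2 p. *)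
Lemma EE_sqr_lipschitz_on p L J f : prob_weights p -> lipschitz L f -> depends_on J f ->
  EE p (fun X => f X ^+ 2) <= EE p f ^+ 2 + L ^+ 2 * \sum_(i in J) p i.
Proof.
move=> hp; move: {2}#|J| (leqnn #|J|) => n; elim: n J f => [|n IH] J f.
  rewrite leqn0 cards_eq0 => /eqP-> _ f0; rewrite big_set0 mulr0 addr0.
  have F X : f X = f set0 by rewrite f0 setI0.
  have -> : EE p f = f set0 by rewrite (eq_EE F) EE_cst.
  by rewrite (eq_EE (fun X => congr1 (fun a => a ^+ 2) (F X))) EE_cst.
move=> Jn fL fJ; have [J0|[i iJ]] := set_0Vmem J.
  by apply: IH => //; rewrite J0 cards0.
have /andP[p0 p1] := hp i; have q0 := prob_weights_onem hp i.
have aL : lipschitz L (avg p i f) := avg_lipschitz i hp fL.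
have aJ : depends_on (J :\ i) (avg p i f).
  move=> X; rewrite /avg fJ [f (X :\ i)]fJ [f (i |: X :&: _)]fJ [f ((_ :&: _) :\ i)]fJ.
  by congr (_ * f _ + _ * f _); apply/setP => k; rewrite !inE; case: eqVneq;
    rewrite ?andbT ?andbF //= => _; case: (k \in J); rewrite ?andbT ?andbF.
have Jn' : (#|J :\ i| <= n)%N by move: Jn; rewrite (cardsD1 i J) iJ.
have := IH _ _ Jn' aL aJ; rewrite EE_avg (big_setD1 i iJ) /= => H.
rewrite -(EE_avg p i (fun X => f X ^+ 2)).
suff: EE p (avg p i (fun X => f X ^+ 2)) <= EE p (fun X => avg p i f X ^+ 2) + L ^+ 2 * p i.
  by move: H; rewrite mulrDr; lra.
rewrite -(EE_cst p (L ^+ 2 * p i)) -EE_D; apply: EE_le => // X.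
(* Second moment of a two-valued variable as squared mean plus variance. *)
have -> : avg p i (fun X => f X ^+ 2) X =
   avg p i f X ^+ 2 + p i * (1 - p i) * (f (i |: X) - f (X :\ i)) ^+ 2.
  by rewrite /avg; ring.
rewrite lerD2l; have : (f (i |: X) - f (X :\ i)) ^+ 2 <= L ^+ 2.
  by rewrite -real_normK ?num_real // lerXn2r ?nnegrE ?normr_ge0 // ?(le_trans _ (fL i X)).
move=> hL; rewrite mulrC; apply: le_trans (_ : (f (i |: X) - f (X :\ i)) ^+ 2 * p i <= _).
  by rewrite ler_wpM2l ?sqr_ge0 // ler_piMr // lerBlDr lerDl.
by rewrite ler_wpM2r.
Qed.

Lemma EE_sqr_lipschitz p L f : prob_weights p -> lipschitz L f ->
  EE p (fun X => f X ^+ 2) <= EE p f ^+ 2 + L ^+ 2 * \sum_i p i.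
Proof.
move=> hp fL; have := EE_sqr_lipschitz_on (J := setT) hp fL.
have -> : \sum_(i in [set: I]) p i = \sum_i p i by apply: eq_bigl => i; rewrite inE.
by apply => X; rewrite setIT.
Qed.

Lemma Pr_markov p f a : prob_weights p -> (forall X, 0 <= f X) -> 0 < a ->
  Pr p (fun X => a <= f X) <= EE p f / a.
Proof.
move=> hp f0 a0; rewrite ler_pdivlMr // mulrC /Pr -EE_Z; apply: EE_le => // X.
by case: (boolP (a <= f X)) => h; rewrite ?mulr1 // mulr0.
Qed.

Lemma Pr_chebyshev p L f t : prob_weights p -> lipschitz L f -> 0 < t ->
  Pr p (fun X => f X <= EE p f - t) <= L ^+ 2 * (\sum_i p i) / t ^+ 2.
Proof.
move=> hp fL t0; set E := EE p f.
have H : EE p (fun X => (f X - E) ^+ 2) <= L ^+ 2 * \sum_i p i.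
  have -> : EE p (fun X => (f X - E) ^+ 2) = EE p (fun X => f X ^+ 2 + (- (2 * E) * f X + E ^+ 2)).
    by apply: eq_EE => X; ring.
  rewrite !EE_D EE_Z EE_cst; have := EE_sqr_lipschitz hp fL; rewrite -/E; lra.
apply: le_trans (_ : EE p (fun X => (f X - E) ^+ 2) / t ^+ 2 <= _); last first.
  by rewrite ler_wpM2r // invr_ge0 exprn_ge0 // ltW.
have h2 : 0 < t ^+ 2 by rewrite exprn_gt0.
apply: le_trans (Pr_markov hp (fun X => sqr_ge0 (f X - E)) h2).
apply: Pr_le => // X h; nra.
Qed.

End RandomSubset.

Arguments eq_EE {R I p f g}.

(** * Edges as unordered pairs *)

Section Edges.
Context {n : nat}.

Lemma edgesE (e : {set 'I_n}) : (e \in edges n) = (#|e| == 2%N).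
Proof. by rewrite inE. Qed.

Lemma set2_edges (u v : 'I_n) : ([set u; v] \in edges n) = (u != v).
Proof. by rewrite edgesE cards2; case: (u != v). Qed.

Lemma ordered_pair_inj :
  {in [set x : 'I_n * 'I_n | (x.1 < x.2)%N] &, injective (fun x => [set x.1; x.2])}.
Proof.
move=> [a b] [c d]; rewrite !inE /= => ab cd /setP E.
have /orP[/eqP ac|/eqP ad] : (a == c) || (a == d) by have := E a; rewrite !inE eqxx => /esym.
  have /orP[/eqP bc|/eqP->] : (b == c) || (b == d); last by rewrite ac.
    by have := E b; rewrite !inE eqxx orbT => /esym.
  by rewrite ac bc ltnn in ab.
have /orP[/eqP ca|/eqP cb] : (c == a) || (c == b) by have := E c; rewrite !inE eqxx => ->.
  by move: cd; rewrite ca ad ltnn.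
by move: cd; rewrite -ad cb ltnNge (ltnW ab).
Qed.

Lemma edges_imset : edges n = [set [set x.1; x.2] | x : 'I_n * 'I_n in [set x : 'I_n * 'I_n | (x.1 < x.2)%N]].
Proof.
apply/setP => e; rewrite edgesE; apply/cards2P/imsetP => [[x [y [xy ->]]]|[[x y] /=]].
  case: (ltngtP x y) => h; last by move/val_inj: h xy => ->; rewrite eqxx.
  - by exists (x, y); rewrite ?inE.
  - by exists (y, x); rewrite ?inE //= setUC.
rewrite inE /= => xy ->; exists x, y; split => //; apply/eqP => E; by rewrite E ltnn in xy.
Qed.

Lemma big_edges (T : Type) (idx : T) (op : Monoid.com_law idx) (F : {set 'I_n} -> T) :
  \big[op/idx]_(e in edges n) F e =
  \big[op/idx]_(u : 'I_n) \big[op/idx]_(v : 'I_n | (u < v)%N) F [set u; v].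
Proof.
rewrite edges_imset big_imset /=; last exact: ordered_pair_inj.
by rewrite pair_big_dep /=; apply: eq_bigl => -[u v]; rewrite inE.
Qed.

Lemma sum_ordered_pairs (V : nmodType) (F : {set 'I_n} -> V) :
  \sum_(u : 'I_n) \sum_(v : 'I_n | u != v) F [set u; v] = (\sum_(e in edges n) F e) *+ 2.
Proof.
rewrite mulr2n {1}big_edges big_edges [X in _ = _ + X](exchange_big_dep predT) //= -big_split /=.
apply: eq_bigr => u _; rewrite (bigID (fun v : 'I_n => (u < v)%N)) /=; congr (_ + _).
  apply: eq_bigl => v; case: (ltngtP u v) => h; rewrite ?andbF // andbT.
  by apply/eqP => E; rewrite E ltnn in h.
apply: eq_big => v; last by rewrite setUC.
by rewrite -leqNgt ltn_neqAle eq_sym.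
Qed.

End Edges.

(** * Balanced loads: existence and monotonicity *)

Lemma continuous_sumr (R : realType) (T : topologicalType) (J : Type) (r : seq J) (P : pred J)
    (F : J -> T -> R) (x : T) : (forall j, {for x, continuous (F j)}) ->
  {for x, continuous (fun y => \sum_(j <- r | P j) F j y)}.
Proof.
move=> h; elim: r => [|j r IH].
  rewrite (_ : (fun y => _) = cst 0); first exact: cvg_cst.
  by apply/funext => y; rewrite big_nil.
case Pj: (P j).
  rewrite (_ : (fun y => _) = F j \+ (fun y => \sum_(j <- r | P j) F j y)).
    exact: (cvgD (h j) IH).
  by apply/funext => y; rewrite big_cons Pj.
rewrite (_ : (fun y => _) = (fun y => \sum_(j <- r | P j) F j y)) //.
by apply/funext => y; rewrite big_cons Pj.
Qed.

Section Load.
Context {R : realType} {n : nat}.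
Implicit Types (K : graph n) (theta : 'M[R]_n) (u v : 'I_n).

Lemma adjC K u v : adj K u v = adj K v u.
Proof. by rewrite /adj eq_sym setUC. Qed.

Lemma adj_neq K u v : adj K u v -> u != v.
Proof. by case/andP. Qed.

Definition sqload theta K : R := \sum_v load K theta v ^+ 2.

(** The map [th] reads only the entries with u < v and completes them by 1 - x, so every point of
    the unit cube yields an allocation. The minimum is then one of a continuous function on a
    compact cube, free of constraints. *)
Lemma min_sqload K : exists theta, allocation K theta /\
  forall theta', allocation K theta' -> sqload theta K <= sqload theta' K.
Proof.
pose box := [set v : 'rV[R]_(n * n) | forall i, `[0, 1]%classic (v ord0 i)]%classic.
pose th (x : 'rV[R]_(n * n)) : 'M[R]_n := \matrix_(u, v)
  if (u < v)%N then vec_mx x u v else 1 - vec_mx x v u.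
have cbox : compact box.
  have := @rV_compact R (n * n) (fun=> `[0, 1]%classic). apply => i; apply: segment_compact.
have box0 : (box !=set0)%classic.
  by exists 0 => i /=; rewrite mxE in_itv /= lexx ler01.
have cont (x : 'rV[R]_(n * n)) : {for x, continuous (fun x => sqload (th x) K)}.
  have coord u v y : {for y, continuous (fun x => th x u v)}.
    have -> : (fun x : 'rV[R]_(n * n) => th x u v) =
        if (u < v)%N then (fun x : 'rV[R]_(n * n) => x ord0 (mxvec_index u v))
        else (fun x : 'rV[R]_(n * n) => 1 - x ord0 (mxvec_index v u)).
      by apply/funext => z; rewrite mxE; case: ifP => _; rewrite mxE.
    case: ifP => _; first exact: coord_continuous.
    have cc := @coord_continuous R 1 (n * n) ord0 (mxvec_index v u) y.
    exact: (@cvgB R R _ _ _ (fun=> 1) _ _ _ (cvg_cst (1 : R)) cc).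
  apply: (@continuous_sumr R _ _ (index_enum 'I_n) predT (fun v x => load K (th x) v ^+ 2)) => v.
  have cl : {for x, continuous (fun x => load K (th x) v)}.
    by apply: (@continuous_sumr R _ _ (index_enum 'I_n) (fun u => adj K u v) (fun u x => th x u v)) => u; exact: coord.
  exact: (cvgM cl cl).
have [c cb cmin] := compact_EVT_min box0 cbox (@continuous_subspaceT _ _ box _ cont).
have cb' : box c by rewrite in_setE in cb.
exists (th c); split.
  move=> u v uv; have nuv := adj_neq uv; rewrite !mxE /=.
  have hb w z : 0 <= c ord0 (mxvec_index w z) <= 1 by have := cb' (mxvec_index w z); rewrite /= in_itv.
  case: (ltngtP u v) => h; last by move: nuv; rewrite -val_eqE /= h eqxx.
    by split; [exact: hb|rewrite addrC subrK].
  by split; [have := hb v u; lra|rewrite subrK].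
move=> theta' at'.
pose x := mxvec (\matrix_(u, v) (if (u < v)%N && adj K u v then theta' u v else 0)).
have xb : x \in box.
  rewrite in_setE => i /=; have [u v] := mxvec_indexP i; rewrite mxvecE mxE in_itv /=.
  by case: ifP => [/andP[_ /at'[]]|_]; rewrite ?lexx ?ler01.
have -> : sqload theta' K = sqload (th x) K; last exact: cmin.
apply: eq_bigr => v _; congr (_ ^+ 2); apply: eq_bigr => u uv.
rewrite mxE /x mxvecK !mxE uv (adjC K v u) uv !andbT.
case: (ltngtP u v) => h //; last by move: (adj_neq uv); rewrite -val_eqE /= h eqxx.
by have [_ <-] := at' _ _ uv; rewrite addrK.
Qed.

(** An allocation minimising the sum of squared loads is balanced, since otherwise moving a little
    weight from the more loaded endpoint to the other would lower that sum. *)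
Lemma balanced_exists K : exists theta, balanced K theta.
Proof.
have [theta [al hmin]] := min_sqload K; exists theta; split => // u v uv luv.
have [/andP[t0 t1] tuv] := al _ _ uv; apply/eqP; rewrite eq_le t0 andbT leNgt; apply/negP => tp.
have nuv := adj_neq uv.
(* At most [theta u v], so that the values stay in [0,1]; at most half the gap, so that the sum of
   squares changes by 2 eps (eps - gap) < 0. *)
pose eps := Num.min (theta u v) ((load K theta v - load K theta u) / 2).
have e0 : 0 < eps by rewrite lt_min tp divr_gt0 // subr_gt0.
have e1 : eps <= theta u v by rewrite ge_min lexx.
have e2 : eps <= (load K theta v - load K theta u) / 2 by rewrite ge_min lexx orbT.
pose theta' := theta + (eps *: delta_mx v u - eps *: delta_mx u v).
have E a b : theta' a b = theta a b + (eps * ((a == v) && (b == u))%:R - eps * ((a == u) && (b == v))%:R).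
  by rewrite !mxE.
have [/andP[s0 s1] _] := al v u (etrans (adjC _ _ _) uv).
have al' : allocation K theta'.
  move=> a b ab; have [hab sab] := al _ _ ab; rewrite !E.
  have nab := adj_neq ab.
  have [/= av|av] := eqVneq a v; have [/= bu|bu] := eqVneq b u;
  have [/= au|au] := eqVneq a u; have [/= bv|bv] := eqVneq b v; subst;
    rewrite ?eqxx // in nuv nab *; rewrite /= ?mulr0 ?mulr1; split; lra.
have := hmin _ al'; apply/negP; rewrite -ltNge.
have L w : load K theta' w = load K theta w + (eps * (w == u)%:R - eps * (w == v)%:R).
  rewrite /load (eq_bigr _ (fun a _ => E a w)) big_split /=; congr (_ + _).
  rewrite sumrB -!mulr_sumr.
  have S (x y : 'I_n) : adj K y x -> \sum_(i | adj K i w) (((i == y) && (w == x))%:R : R) = (w == x)%:R.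
    move=> xy; have [->|wx] := eqVneq w x.
      by rewrite (bigD1 y) //= eqxx big1 ?addr0 // => i /andP[_ /negbTE->].
    by rewrite big1 // => i _; rewrite andbF.
  by rewrite !S // adjC.
rewrite /sqload !(bigD1 (P := predT) u) //= !(bigD1 (P := fun i => i != u) v) 1?eq_sym //=.
rewrite !L !eqxx (negbTE nuv) eq_sym (negbTE nuv).
rewrite [X in _ + (_ + X)](eq_bigr (fun i => load K theta i ^+ 2)); last first.
  by move=> i /andP[/negbTE iu /negbTE iv]; rewrite L iu iv !mulr0 subrr addr0.
rewrite !addrA ltrD2r !mulr0 !mulr1; nra.
Qed.

Lemma balanced_loadP K : exists theta, balanced K theta /\ balanced_load (R := R) K = load K theta.
Proof.
exists (xget 0 [set theta : 'M[R]_n | balanced K theta]%classic); split => //.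
by have [theta bt] := balanced_exists K; exact: (xgetI 0 bt).
Qed.

End Load.

Section LoadTheory.
Context {R : realType} {n : nat}.
Implicit Types (K : graph n) (theta : 'M[R]_n) (u v : 'I_n) (S : {set 'I_n}).

Local Notation bl := (@balanced_load R n).

Definition inner_edges K S : nat := #|[set e in K | e \subset S]|.

Definition degree K v : nat := #|[set u | adj K u v]|.

Lemma balanced_load_ge0 K v : 0 <= bl K v.
Proof.
have [theta [[al _] ->]] := balanced_loadP (R := R) K.
by apply: sumr_ge0 => u /al[/andP[]].
Qed.

Lemma balanced_load_le_degree K v : bl K v <= (degree K v)%:R.
Proof.
have [theta [[al _] ->]] := balanced_loadP (R := R) K.
rewrite /degree -sum1_card natr_sum /load; under [leRHS]eq_bigl do rewrite inE.
by apply: ler_sum => u /al[/andP[]].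
Qed.

Lemma adj_sub K K' u v : K \subset K' -> adj K u v -> adj K' u v.
Proof. by move=> KK' /andP[uv /(fintype.subsetP KK') h]; rewrite /adj uv h. Qed.

Lemma sum_adj_inner K S (G : {set 'I_n} -> R) : K \subset edges n ->
  \sum_(v in S) \sum_(u in S | adj K u v) G [set u; v] =
  (\sum_(e in K | e \subset S) G e) *+ 2.
Proof.
move=> Kn.
have := sum_ordered_pairs (fun e : {set 'I_n} => if (e \in K) && (e \subset S) then G e else 0).
have -> : \sum_(e in edges n) (if (e \in K) && (e \subset S) then G e else 0) =
    \sum_(e in K | e \subset S) G e.
  rewrite -big_mkcondr; apply: eq_bigl => e; rewrite andbA.
  case: (boolP (e \in K)) => eK; rewrite ?andbF //.
  by rewrite (fintype.subsetP Kn).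
move=> <-; rewrite [LHS]big_mkcond; apply: eq_bigr => v _.
case: (boolP (v \in S)) => vS; last first.
  rewrite big1 // => u _; case: ifP => // /andP[_] /fintype.subsetP/(_ v).
  by rewrite !inE eqxx /= => /(_ isT); rewrite (negbTE vS).
rewrite -big_mkcondr; apply: eq_big => [u|u _]; last by rewrite setUC.
rewrite subUset !sub1set vS /adj /= eq_sym setUC.
by case: (u \in S); rewrite ?andbT ?andbF // .
Qed.

(** Exchanging u and v shows that the sum may as well be taken with [theta v u]; adding both
    versions, the two directions of an edge contribute 1 in total, so twice the sum runs over
    ordered pairs. *)
Lemma sum_alloc_inner K theta S (G : {set 'I_n} -> R) : K \subset edges n ->
  allocation K theta ->
  \sum_(v in S) \sum_(u in S | adj K u v) G [set u; v] * theta u v =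
  \sum_(e in K | e \subset S) G e.
Proof.
move=> Kn al; set X := LHS.
have XE : X = \sum_(v in S) \sum_(u in S | adj K u v) G [set u; v] * theta v u.
  rewrite /X (exchange_big_dep (fun u => u \in S)) /=; last by move=> u v _ /andP[].
  apply: eq_bigr => u uS; apply: eq_big => [v|v _]; last by rewrite setUC.
  by rewrite uS adjC; case: (v \in S).
have := sum_adj_inner S G Kn.
have -> : \sum_(v in S) \sum_(u in S | adj K u v) G [set u; v] = X + X.
  rewrite {2}XE -big_split; apply: eq_bigr => v _ /=; rewrite -big_split /=.
  by apply: eq_bigr => u /andP[_ /al[_ h]]; rewrite -mulrDr h mulr1.
rewrite -mulr2n => /eqP; rewrite -subr_eq0 -mulrnBl mulrn_eq0 /= subr_eq0.
by move/eqP.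
Qed.

Lemma inner_edges_sum K S : ((inner_edges K S)%:R : R) = \sum_(e in K | e \subset S) 1.
Proof.
by rewrite /inner_edges -sum1_card natr_sum; apply: eq_bigl => e; rewrite inE.
Qed.

Lemma inner_edges_le_load K S : K \subset edges n ->
  (inner_edges K S)%:R <= \sum_(v in S) bl K v.
Proof.
move=> Kn; have [theta [[al _] ->]] := balanced_loadP (R := R) K.
rewrite inner_edges_sum -(sum_alloc_inner S (fun=> 1) Kn al); apply: ler_sum => v vS.
rewrite /load (eq_bigr (fun u => theta u v)); last by move=> u _; rewrite mul1r.
rewrite [leRHS](bigID (fun u => u \in S)) /= -[leLHS]addr0; apply: lerD.
  by rewrite le_eqVlt; apply/orP; left; apply/eqP; apply: eq_bigl => u; rewrite andbC.
by apply: sumr_ge0 => u /andP[/al[/andP[]]].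
Qed.

(* Across the boundary of a level set the whole weight of an edge goes outside. *)
Lemma weighted_load_level K S (t : R) (g : 'I_n -> R) (G : {set 'I_n} -> R) :
  K \subset edges n -> (forall u v, adj K u v -> g v <= G [set u; v]) ->
  S = [set v | t <= bl K v] ->
  \sum_(v in S) g v * bl K v <= \sum_(e in K | e \subset S) G e.
Proof.
move=> Kn gG S_def; have [theta [[al bal] E]] := balanced_loadP (R := R) K.
rewrite -(sum_alloc_inner S G Kn al); apply: ler_sum => v; rewrite S_def inE E => vS.
rewrite {1}/load mulr_sumr (bigID (fun u => t <= load K theta u)) /= [X in _ + X]big1 ?addr0.
  rewrite [leLHS](eq_bigl (fun u => (u \in [set v | t <= load K theta v]) && adj K u v)); last first.
    by move=> u; rewrite inE andbC.
  by apply: ler_sum => u /andP[_ uv]; rewrite ler_wpM2r ?gG //; case: (al _ _ uv) => /andP[].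
move=> u /andP[uv]; rewrite -ltNge => h; rewrite (bal _ _ uv) ?mulr0 //.
exact: lt_le_trans h vS.
Qed.

(** Consider the set D where the load would decrease. Inside D the larger graph has at least as many
    edges, and across the boundary of D it sends at least as much weight inwards; hence its total
    load on D cannot be smaller. *)
Lemma balanced_load_mono K K' v : K \subset K' -> bl K v <= bl K' v.
Proof.
move=> KK'; have [theta [[al bal] ->]] := balanced_loadP (R := R) K.
have [theta' [[al' bal'] ->]] := balanced_loadP (R := R) K'.
rewrite leNgt; apply/negP => vD.
pose D := [set v | load K' theta' v < load K theta v].
have vD' : v \in D by rewrite inE.
have split_load (L : graph n) (th : 'M[R]_n) : \sum_(v in D) load L th v =
    \sum_(v in D) \sum_(u in D | adj L u v) th u v +
    \sum_(v in D) \sum_(u | adj L u v && (u \notin D)) th u v.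
  rewrite -big_split; apply: eq_bigr => w _ /=; rewrite /load (bigID (fun u => u \in D)) /=.
  by congr (_ + _); apply: eq_bigl => u; rewrite andbC.
have inside : \sum_(v in D) \sum_(u in D | adj K u v) theta u v <=
              \sum_(v in D) \sum_(u in D | adj K' u v) theta' u v.
  pose Ke := K :&: edges n; pose Ke' := K' :&: edges n.
  have adjE (L : graph n) u w : adj (L :&: edges n) u w = adj L u w.
    by rewrite /adj inE set2_edges; case: (u != w); rewrite ?andbT.
  have := sum_alloc_inner (K := Ke) (theta := theta) D (fun=> 1) (subsetIr _ _).
  have := sum_alloc_inner (K := Ke') (theta := theta') D (fun=> 1) (subsetIr _ _).
  have alE (L : graph n) (th : 'M[R]_n) : allocation L th -> allocation (L :&: edges n) th.
    by move=> h u w; rewrite adjE; apply: h.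
  have E1 (L : graph n) (th : 'M[R]_n) : \sum_(v in D) \sum_(u in D | adj (L :&: edges n) u v) 1 * th u v =
     \sum_(v in D) \sum_(u in D | adj L u v) th u v.
    by apply: eq_bigr => w _; apply: eq_big => [u|u _]; rewrite ?adjE ?mul1r.
  rewrite !E1 => /(_ (alE _ _ al')) -> /(_ (alE _ _ al)) ->.
  rewrite -!inner_edges_sum ler_nat /inner_edges; apply/subset_leq_card/fintype.subsetP => e.
  by rewrite !inE => /andP[/andP[/(fintype.subsetP KK') -> ->] ->].
have outside : \sum_(v in D) \sum_(u | adj K u v && (u \notin D)) theta u v <=
               \sum_(v in D) \sum_(u | adj K' u v && (u \notin D)) theta' u v.
  apply: ler_sum => w wD; rewrite [leRHS](bigID (fun u => adj K u w)) /= -[leLHS]addr0.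
  apply: lerD; last by apply: sumr_ge0 => u /andP[/andP[/al'[/andP[]]]].
  rewrite [leRHS](eq_bigl (fun u => adj K u w && (u \notin D))); last first.
    move=> u; case: (boolP (adj K u w)) => h; rewrite ?andbF // (adj_sub KK' h).
    by rewrite andbT.
  apply: ler_sum => u /andP[uw uD]; have uw' := adj_sub KK' uw.
  move: wD uD; rewrite !inE -leNgt => wD uD.
  (* Either the edge gives nothing to w in K, or w is no more loaded than u in K; then w is strictly
     less loaded than u in K', and balance there gives w the whole edge. *)
  have [h|h] := ltP (load K theta u) (load K theta w).
    by rewrite bal //; case: (al' _ _ uw') => /andP[].
  have [/andP[_ t1] _] := al _ _ uw; have [_ s1] := al' _ _ uw'.
  have z : theta' w u = 0.
    by apply: bal'; [rewrite adjC|exact: lt_le_trans wD (le_trans h uD)].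
  by rewrite z addr0 in s1; rewrite s1.
have : \sum_(v in D) load K' theta' v < \sum_(v in D) load K theta v.
  by apply: ltr_sum => [|w]; [apply/hasP; exists v; rewrite ?mem_index_enum | rewrite inE].
by rewrite !split_load ltNge lerD.
Qed.

End LoadTheory.

(** * The Perron-Frobenius eigenvalue and a positive eigenvector *)

Section RealComplex.
Context {R : realType}.
Local Notation toC := (real_complex R).

Lemma real_complex_ge0 (x : R) : (0 <= toC x) = (0 <= x).
Proof. exact: ler0c. Qed.

Lemma real_complex_le (x y : R) : (toC x <= toC y) = (x <= y).
Proof. exact: lecR. Qed.

Lemma real_complex_norm (x : R) : 0 <= x -> `|toC x| = toC x.
Proof. by move=> x0; rewrite ger0_norm // real_complex_ge0. Qed.

(** In the l1 norm weighted by the positive right eigenvector f, the matrix acts on row vectors with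
    norm at most r, so no complex eigenvalue exceeds r in modulus. Two real eigenvalues that
    dominate each other coincide, which identifies the choice made by [xget]. *)
Lemma dominant_perron_frobenius m (A : 'M[R]_m) (f : 'I_m -> R) (r : R) :
  (forall i j, 0 <= A i j) -> (forall i, 0 < f i) ->
  (forall i, \sum_j A i j * f j = r * f i) -> eigenvalue A r -> perron_frobenius A = r.
Proof.
move=> A0 f0 fE er.
have dom (z : R[i]%C) : eigenvalue (map_mx toC A) z -> `|z| <= toC r.
  case/eigenvalueP => v vE v0.
  pose W := \sum_j `|v 0 j| * toC (f j).
  have W0 : 0 < W.
    rewrite lt_neqAle sumr_ge0 ?andbT; last first.
      by move=> j _; rewrite mulr_ge0 // real_complex_ge0 ltW.
    rewrite eq_sym psumr_eq0; last by move=> j _; rewrite mulr_ge0 // real_complex_ge0 ltW.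
    apply: contra v0 => /allP h; apply/eqP/rowP => j; rewrite mxE.
    have := h j (mem_index_enum _); rewrite /= mulf_eq0 normr_eq0 => /orP[/eqP//|].
    by rewrite fmorph_eq0 (gt_eqF (f0 j)).
  have : `|z| * W <= toC r * W.
    rewrite mulr_sumr; apply: (@le_trans _ _ (\sum_j \sum_i `|v 0 i| * toC (A i j) * toC (f j))).
      apply: ler_sum => j _; rewrite mulrA -normrM.
      have -> : z * v 0 j = \sum_i v 0 i * toC (A i j).
        by have /rowP/(_ j) := vE; rewrite !mxE => <-; apply: eq_bigr => i _; rewrite mxE.
      rewrite -mulr_suml; apply: ler_wpM2r; first by rewrite real_complex_ge0 ltW.
      apply: le_trans (ler_norm_sum _ _ _) _.
      by apply: ler_sum => i _; rewrite normrM (real_complex_norm (A0 i j)).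
    rewrite exchange_big /= mulr_sumr le_eqVlt; apply/orP; left; apply/eqP.
    apply: eq_bigr => i _; rewrite mulrCA -rmorphM -fE rmorph_sum mulr_sumr.
    by apply: eq_bigr => j _; rewrite rmorphM mulrA.
  by rewrite ler_pM2r.
have pr : is_perron_frobenius A r by [].
rewrite /perron_frobenius; have := xgetI 0 pr; set r' := xget _ _ => -[er' dom'].
have toC_eig x : eigenvalue A x -> eigenvalue (map_mx toC A) (toC x).
  case/eigenvalueP => v vE v0; apply/eigenvalueP; exists (map_mx toC v).
    by rewrite -map_mxM vE map_mxZ.
  by rewrite map_mx_eq0.
have f1 := dom' _ (toC_eig _ er); have f2 := dom _ (toC_eig _ er').
have nn x : real_complex R `|x| <= `|toC x|.
  have [x0|x0] := leP 0 x; first by rewrite ger0_norm // real_complex_norm.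
  by rewrite (ltr0_norm x0) -normrN -rmorphN real_complex_norm // oppr_ge0 ltW.
have := le_trans (nn _) f1; have := le_trans (nn _) f2; rewrite !real_complex_le => h1 h2.
by apply/eqP; rewrite eq_le (le_trans (ler_norm _) h1) (le_trans (ler_norm _) h2).
Qed.

End RealComplex.

Section PerronVector.
Context {R : realType} {m : nat}.
Variables (Q : 'M[R]_m) (alpha : 'rV[R]_m).
Hypotheses (Qsym : forall i j, Q i j = Q j i) (Qpos : forall i j, 0 < Q i j).
Hypotheses (alpha_ge0 : forall i, 0 <= alpha 0 i) (alpha_neq0 : exists i, 0 < alpha 0 i).

(** The symmetric form D^(1/2) Q D^(1/2), to which the variational principle applies. *)
Let M i j := Num.sqrt (alpha 0 i) * Q i j * Num.sqrt (alpha 0 j).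
Let quad (x : 'I_m -> R) := \sum_i \sum_j M i j * x i * x j.
Let sq (x : 'I_m -> R) := \sum_i x i ^+ 2.

Let M_sym i j : M i j = M j i.
Proof. by rewrite /M Qsym; ring. Qed.

Let M_ge0 i j : 0 <= M i j.
Proof. by rewrite !mulr_ge0 ?sqrtr_ge0 ?ltW. Qed.

(** The maximum is taken over the nonnegative part of the unit sphere, which is compact. It
    dominates every y, because replacing y by its absolute values can only increase a quadratic form
    with nonnegative coefficients. *)
Lemma rayleigh_max : exists x : 'I_m -> R, [/\ forall i, 0 <= x i, sq x = 1 &
  forall y, quad y <= quad x * sq y].
Proof.
pose box := [set v : 'rV[R]_m | forall i, `[0, 1]%classic (v ord0 i)]%classic.
pose sqr (v : 'rV[R]_m) := sq (v 0); pose qdr (v : 'rV[R]_m) := quad (v 0).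
have cc i (v : 'rV[R]_m) : {for v, continuous (fun v : 'rV[R]_m => v 0 i)}.
  exact: coord_continuous.
have csq : continuous sqr.
  move=> v; apply: (@continuous_sumr R _ _ (index_enum 'I_m) predT (fun i (v : 'rV[R]_m) => v 0 i ^+ 2)) => i.
  exact: (cvgM (cc i v) (cc i v)).
have cqd : continuous qdr.
  move=> v; apply: (@continuous_sumr R _ _ (index_enum 'I_m) predT
    (fun i (v : 'rV[R]_m) => \sum_j M i j * v 0 i * v 0 j)) => i.
  apply: (@continuous_sumr R _ _ (index_enum 'I_m) predT
    (fun j (v : 'rV[R]_m) => M i j * v 0 i * v 0 j)) => j.
  exact: (cvgM (cvgM (@cst_continuous _ _ (M i j) v) (cc i v)) (cc j v)).
pose A := (box `&` sqr @^-1` [set 1])%classic.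
have cA : compact A.
  apply: compact_closedI.
    have := @rV_compact R m (fun=> `[0, 1]%classic). apply => i; apply: segment_compact.
  by move/continuous_closedP: csq; apply; exact: closed_eq.
have [i0 ai0] := alpha_neq0.
have A0 : (A !=set0)%classic.
  exists (delta_mx 0 i0); split => [i|] /=.
    by rewrite /= mxE in_itv /= ?eqxx; case: (i == i0); rewrite ?lexx ?ler01.
  rewrite /sqr /sq (bigD1 i0) //= big1 => [|i /negbTE ii0]; rewrite mxE ?ii0 ?eqxx /=.
    by rewrite expr1n addr0.
  by rewrite expr0n.
have [c cA' cmax] := compact_EVT_max A0 cA (continuous_subspaceT cqd).
have [cb cs] : A c by rewrite in_setE in cA'.
exists (c 0); split => [i||y]; [|exact: cs|].
  by have := cb i; rewrite /= in_itv /= => /andP[].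
have [/eqP y0|y0] := boolP (sq y == 0).
  rewrite y0 mulr0 /quad big1 // => i _; rewrite big1 // => j _.
  have -> : y i = 0; last by rewrite mulr0 mul0r.
  by apply/eqP; rewrite -sqrf_eq0; apply/eqP; move/eqP: y0; rewrite psumr_eq0 => [/allP/(_ i (mem_index_enum _))/eqP//|k _]; exact: sqr_ge0.
have sy : 0 < sq y by rewrite lt_neqAle eq_sym y0 sumr_ge0 // => i _; exact: sqr_ge0.
set r := Num.sqrt (sq y); have r0 : 0 < r by rewrite sqrtr_gt0.
have rr : r ^+ 2 = sq y by rewrite sqr_sqrtr // ltW.
pose z : 'rV[R]_m := \row_i (`|y i| / r).
have z1 : sqr z = 1.
  rewrite /sqr /sq (eq_bigr (fun i => y i ^+ 2 / sq y)); last first.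
    by move=> i _; rewrite mxE expr_div_n rr real_normK // num_real.
  by rewrite -mulr_suml divff.
have zA : z \in A.
  rewrite in_setE; split => [i|//] /=; rewrite mxE ?in_itv /= divr_ge0 ?(ltW r0) //=.
  rewrite ler_pdivrMr // mul1r -(ler_pXn2r (n := 2)) ?nnegrE ?(ltW r0) //.
  rewrite rr real_normK ?num_real // /sq (bigD1 i) //= lerDl.
  by apply: sumr_ge0 => j _; exact: sqr_ge0.
have := cmax z zA; rewrite /qdr => h.
have : quad y <= quad (z 0) * sq y.
  rewrite -rr /quad !mulr_suml; apply: ler_sum => i _; rewrite mulr_suml; apply: ler_sum => j _.
  rewrite !mxE -mulrA (_ : _ * r ^+ 2 = M i j * (`|y i| * `|y j|)); last by field; rewrite gt_eqF.
  by rewrite ler_wpM2l // -normrM ler_norm.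
by move=> /le_trans; apply; rewrite ler_wpM2r // ltW.
Qed.

(** The eigenvalue equation is the first-order condition at the maximiser, obtained by perturbing
    one coordinate k. The perturbation may leave the nonnegative orthant, which the previous bound
    allows. *)
Lemma rayleigh_eigen : exists (x : 'I_m -> R) (r : R), [/\ forall i, 0 <= x i, 0 < r,
  exists i, 0 < Num.sqrt (alpha 0 i) * x i & forall i, \sum_j M i j * x j = r * x i].
Proof.
have [x [x0 x1 xmax]] := rayleigh_max; exists x, (quad x).
have [i0 ai0] := alpha_neq0.
have qd1 k t : quad (fun i => x i + t * (i == k)%:R) =
    quad x + 2 * t * (\sum_j M k j * x j) + t ^+ 2 * M k k.
  have S (F : 'I_m -> R) : \sum_i F i * (i == k)%:R = F k.
    by rewrite (bigD1 k) //= eqxx mulr1 big1 ?addr0 // => i /negbTE->; rewrite mulr0.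
  rewrite /quad (eq_bigr (fun i => \sum_j M i j * x i * x j + (t * (M i k * x i)) +
      (t * (\sum_j M i j * x j) + t ^+ 2 * M i k) * (i == k)%:R)); last first.
    move=> i _; rewrite (eq_bigr (fun j => M i j * x i * x j + (t * (i == k)%:R) * (M i j * x j) +
       (t * M i j * x i + t ^+ 2 * (i == k)%:R * M i j) * (j == k)%:R)); last by move=> j _; ring.
    by rewrite !big_split /= S -mulr_sumr; ring.
  rewrite !big_split /= S -mulr_sumr.
  rewrite [X in _ + t * X + _](eq_bigr (fun j => M k j * x j)); last by move=> j _; rewrite M_sym.
  by ring.
have sq1 k t : sq (fun i => x i + t * (i == k)%:R) = 1 + 2 * t * x k + t ^+ 2.
  transitivity (sq x + 2 * t * x k + t ^+ 2); last by rewrite x1.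
  rewrite /sq !(bigD1 (P := predT) k) //= eqxx mulr1.
  rewrite (eq_bigr (fun i => x i ^+ 2)); last by move=> i /negbTE->; rewrite mulr0 addr0.
  by ring.
have q0 : 0 < quad x.
  have := xmax (fun i => 0 + 1 * (i == i0)%:R).
  have -> : sq (fun i => 0 + 1 * (i == i0)%:R) = 1.
    rewrite /sq (bigD1 i0) //= eqxx big1 => [|i /negbTE->]; first by rewrite add0r mulr1 expr1n addr0.
    by rewrite mulr0 addr0 expr0n.
  have -> : quad (fun i => 0 + 1 * (i == i0)%:R) = M i0 i0.
    have F : (false%:R : R) = 0 by [].
    rewrite /quad (bigD1 i0) //= (bigD1 i0) //= !big1; last first.
    - by move=> j /negbTE->; rewrite F; ring.
    - by move=> j /negbTE ->; rewrite big1 // => k _; rewrite F; ring.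
    - by rewrite eqxx !add0r !mulr1 !addr0.
  rewrite mulr1; apply: lt_le_trans.
  by rewrite /M !mulr_gt0 ?sqrtr_gt0.
split => //.
  apply: contrapT => h; move: q0; rewrite /quad big1 ?ltxx // => i _.
  rewrite big1 // => j _; have : ~ 0 < Num.sqrt (alpha 0 i) * x i by move=> hi; apply: h; exists i.
  have : 0 <= Num.sqrt (alpha 0 i) * x i by rewrite mulr_ge0 ?sqrtr_ge0.
  rewrite le_eqVlt => /orP[/eqP z _|//].
  rewrite /M (_ : _ * _ * _ * _ * _ = Num.sqrt (alpha 0 i) * x i * (Q i j * Num.sqrt (alpha 0 j) * x j)) => [|]; [by rewrite -z mul0r|ring].
move=> k; set a := \sum_j _; set b := M k k.
have key t : 2 * t * (a - quad x * x k) + t ^+ 2 * (b - quad x) <= 0.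
  have := xmax (fun i => x i + t * (i == k)%:R); rewrite qd1 sq1 -/a -/b; nra.
apply/eqP; rewrite -subr_eq0; set dd := a - _ in key *; set ee := b - quad x in key.
have [//|dn0] := eqVneq dd 0.
have d2 : 0 < dd ^+ 2 by rewrite exprn_even_gt0.
have c0 : 0 < 1 + `|ee| by rewrite ltr_pwDl.
(* This t has the sign of [dd] and is small enough for the linear term to dominate the quadratic
   one. *)
have := key (dd / (1 + `|ee|)).
have -> : 2 * (dd / (1 + `|ee|)) * dd + (dd / (1 + `|ee|)) ^+ 2 * ee =
   dd ^+ 2 * (2 * (1 + `|ee|) + ee) / (1 + `|ee|) ^+ 2 by field; rewrite gt_eqF.
rewrite leNgt divr_gt0 ?exprn_gt0 // mulr_gt0 //.
have := ler_norm (- ee); rewrite normrN; have := normr_ge0 ee; lra.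
Qed.

(** Applying Q once more to D^(1/2) x makes the vector positive everywhere, even on empty
    communities where alpha vanishes. The same form, a nonnegative combination of columns of Q,
    transfers any comparison of rows of Q to the entries of f. *)
Lemma perron_vector : exists2 f : 'I_m -> R, forall i, 0 < f i &
  [/\ 0 < perron_frobenius (Q *m diag_mx alpha),
      forall i, \sum_j Q i j * alpha 0 j * f j = perron_frobenius (Q *m diag_mx alpha) * f i &
      forall B, (forall i j k, Q i k <= B * Q j k) -> forall i j, f i <= B * f j].
Proof.
have [x [r [x0 r0 [i0 xi0] xE]]] := rayleigh_eigen.
pose f i := \sum_j Q i j * (Num.sqrt (alpha 0 j) * x j).
have nn j : 0 <= Num.sqrt (alpha 0 j) * x j by rewrite mulr_ge0 ?sqrtr_ge0.
have f0 i : 0 < f i.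
  rewrite /f (bigD1 i0) //=; apply: ltr_pwDl; first by rewrite mulr_gt0.
  by apply: sumr_ge0 => j _; rewrite mulr_ge0 // ltW.
have fE i : \sum_j Q i j * alpha 0 j * f j = r * f i.
  rewrite /f mulr_sumr; apply: eq_bigr => j _.
  rewrite [RHS](_ : _ = Q i j * Num.sqrt (alpha 0 j) * (r * x j)); last by ring.
  rewrite -xE !mulr_sumr; apply: eq_bigr => k _; rewrite /M.
  rewrite -{1}[alpha 0 j]sqr_sqrtr //; ring.
have AE i j : (Q *m diag_mx alpha) i j = Q i j * alpha 0 j.
  by rewrite mul_mx_diag mxE.
have PF : perron_frobenius (Q *m diag_mx alpha) = r.
  apply: (dominant_perron_frobenius (f := f)) => //.
  - by move=> i j; rewrite AE mulr_ge0 // ltW.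
  - by move=> i; under eq_bigr do rewrite AE.
  apply/eigenvalueP; exists (\row_j (alpha 0 j * f j)).
    apply/rowP => j; rewrite !mxE.
    transitivity (alpha 0 j * (\sum_i Q j i * alpha 0 i * f i)); last by rewrite fE; ring.
    by rewrite mulr_sumr; apply: eq_bigr => i _; rewrite AE mxE Qsym; ring.
  have [i1 ai1] := alpha_neq0.
  apply/eqP => /rowP/(_ i1); rewrite !mxE => /eqP; rewrite mulf_eq0.
  by rewrite (gt_eqF ai1) (gt_eqF (f0 i1)).
exists f => //; rewrite PF; split => // B hB i j.
rewrite /f mulr_sumr; apply: ler_sum => k _; rewrite mulrA.
by rewrite ler_wpM2r.
Qed.

End PerronVector.

(** * Cycles of a permutation and their weights *)

Section PermutationCycles.
Context {T : finType}.
Implicit Types (t : {perm T}) (S : {set T}) (v x y : T).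

Lemma porbit_step t x : porbit t (t x) = porbit t x.
Proof. by have := porbit_perm t 1 x; rewrite expg1. Qed.

Lemma porbit_iter t x i : porbit t (iter i t x) = porbit t x.
Proof. by rewrite -permX porbit_perm. Qed.

Lemma porbit_iterP t x y : y \in porbit t x -> exists2 i, (i < #|porbit t x|)%N & y = iter i t x.
Proof. by rewrite porbit_traject => /trajectP[i ix ->]; exists i. Qed.

Lemma porbit_partition t : partition (porbits t) [set: T].
Proof.
have -> : porbits t = preim_partition (porbit t) [set: T].
  apply/setP => O; apply/imsetP/imsetP => -[x _ ->]; exists x; rewrite ?inE //;
  by apply/setP => y; rewrite !inE /= -eq_porbit_mem eq_sym.
exact: preim_partitionP.
Qed.

Lemma sum_porbits (V : nmodType) t (F : T -> V) :
  \sum_v F v = \sum_(O in porbits t) \sum_(v in O) F v.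
Proof.
have /and3P[/eqP c tr _] := porbit_partition t.
by rewrite -big_trivIset // c; apply: eq_bigl => v; rewrite inE.
Qed.

(** The choice is made by [pick] on the set of points of the cycle, so it depends on the cycle
    alone. *)
Definition cycle_reps t : {set T} := [set v | [pick x in porbit t v] == Some v].

Lemma cycle_reps_uniq t v w : v \in cycle_reps t -> w \in cycle_reps t ->
  porbit t v = porbit t w -> v = w.
Proof. by rewrite !inE => /eqP hv /eqP hw E; move: hv; rewrite E hw => -[]. Qed.

Lemma cycle_reps_ex t v : exists2 w, w \in cycle_reps t & w \in porbit t v.
Proof.
have : [pick x in porbit t v] != None.
  by case: pickP => // /(_ v); rewrite porbit_id.
case E: [pick x in porbit t v] => [w|//] _.
have wv : w \in porbit t v by move: E; case: pickP => // x xv [<-].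
exists w => //; rewrite inE.
have -> : porbit t w = porbit t v by apply/eqP; rewrite eq_porbit_mem.
by rewrite E.
Qed.

Lemma card_cycle_reps t : #|cycle_reps t| = #|porbits t|.
Proof.
rewrite -(card_in_imset (f := porbit t) (D := mem (cycle_reps t))); last first.
  by move=> v w vR wR; apply: cycle_reps_uniq.
congr #|pred_of_set _|; apply/setP => O; apply/imsetP/imsetP => -[v _ ->].
  by exists v.
have [w wR wv] := cycle_reps_ex t v; exists w => //.
by apply/esym/eqP; rewrite eq_porbit_mem.
Qed.

(* The image of a representative is the only point of its cycle that is not
   hit by the other points of the cycle. *)
Lemma perm_determined t t' : cycle_reps t = cycle_reps t' ->
  (forall v, v \notin cycle_reps t -> t v = t' v) -> t = t'.
Proof.
move=> ER tt'; apply/perm.permP => r; case: (boolP (r \in cycle_reps t)) => [rR|/tt'//].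
pose z := (t'^-1)%g (t r); have tz : t' z = t r by rewrite permKV.
have [zR|zR] := boolP (z \in cycle_reps t); last first.
  by have := tt' _ zR; rewrite tz => /perm_inj E; rewrite E rR in zR.
pose P i := iter i t (t r) \in cycle_reps t.
have exP : exists i, P i.
  have : r \in porbit t (t r) by rewrite porbit_step porbit_id.
  by case/porbit_iterP => i _ Er; exists i; rewrite /P -Er.
case: (ex_minnP exP) => i Pi imin.
have Er : iter i t (t r) = r.
  by apply: cycle_reps_uniq Pi rR _; rewrite porbit_iter porbit_step.
have agree j : (j <= i)%N -> iter j t (t r) = iter j t' (t r).
  elim: j => // j IH ji /=; rewrite -IH ?(ltnW ji) //; apply: tt'.
  by apply/negP => /imin; rewrite leqNgt ji.
have : porbit t' r = porbit t' z.
  by rewrite -{1}Er agree // porbit_iter -tz porbit_step.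
by move=> E; rewrite -tz; congr (t' _); apply: cycle_reps_uniq (esym E); rewrite -?ER.
Qed.

(** There are at most 2^n sets of representatives R0. A permutation is determined by R0 and its
    values off R0, so at most n^(n-|R0|) permutations share R0, each weighing n^|R0|. *)
Lemma sum_pow_cycles :
  (\sum_(t : {perm T}) #|T| ^ #|porbits t| <= 2 ^ #|T| * #|T| ^ #|T|)%N.
Proof.
rewrite (partition_big cycle_reps predT) //=.
apply: (@leq_trans (\sum_(R0 : {set T}) #|T| ^ #|T|)%N); last first.
  rewrite sum_nat_const leq_mul2r; apply/orP; right.
  by rewrite -[X in (2 ^ X)%N]cardsT -card_powerset powersetT cardsT.
apply: leq_sum => R0 _.
rewrite (eq_bigr (fun=> #|T| ^ #|R0|)%N); last by move=> t /eqP <-; rewrite card_cycle_reps.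
rewrite sum_nat_const; apply: (@leq_trans (#|T| ^ (#|T| - #|R0|) * #|T| ^ #|R0|)%N); last first.
  by rewrite -expnD subnK // max_card.
rewrite leq_mul2r; apply/orP; right.
pose r t := [ffun x : {x | x \notin R0} => t (val x)].
have r_inj : {in [pred t | cycle_reps t == R0] &, injective r}.
  move=> t t'; rewrite !inE => /eqP tR /eqP tR' /ffunP E; apply: perm_determined.
    by rewrite tR tR'.
  by move=> v; rewrite tR => vR; have := E (exist _ v vR); rewrite !ffunE.
have := leq_card_in _ _ r_inj; rewrite card_ffun card_sig.
suff -> : #|[pred x | x \notin R0]| = (#|T| - #|R0|)%N by [].
by rewrite -(cardsC R0) addKn; apply: eq_card => x; rewrite !inE.
Qed.

(** Take a permutation with the most cycles among those agreeing with t on S. If one of its cycles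
    had two points outside S, composing with their transposition would split it without changing any
    value on S. *)
Lemma split_cycles t S : exists t', (forall v, v \in S -> t' v = t v) /\
  (forall v, #|porbit t' v :\: S| <= 1)%N.
Proof.
pose P (t' : {perm T}) := [forall (v | v \in S), t' v == t v].
have Pt : P t by apply/forall_inP.
have [t' /forall_inP Pt' tmax] := arg_maxnP (fun t' => #|porbits t'|) Pt.
exists t'; split => [v /Pt'/eqP//|v]; rewrite leqNgt; apply/negP => /card_gt1P[x [y []]].
rewrite !inE => /andP[xS xv] /andP[yS yv] xy.
have := porbits_mul_tperm t' x y; have -> : x \in porbit t' y.
  have /eqP-> : porbit t' y == porbit t' v by rewrite eq_porbit_mem.
  by [].
rewrite xy /= addn0 addn1 => E.
have hP : P (tperm x y * t')%g.
  apply/forall_inP => w wS; rewrite permM tpermD ?Pt' //.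
    by apply: contraNneq xS => ->.
  by apply: contraNneq yS => ->.
by have := tmax _ hP; rewrite /geq /= E ltnn.
Qed.

Section CycleWeight.
Context {R : realType}.

(* A cycle of length c inside S has weight c - 1 in total, and so has a cycle
   with exactly one point outside S. *)
Definition cycle_weight t S v : R :=
  if porbit t v \subset S then 1 - #|porbit t v|%:R^-1 else 1.

Lemma cycle_weight_ge0 t S v : 0 <= cycle_weight t S v.
Proof.
rewrite /cycle_weight; case: ifP => // _; rewrite subr_ge0 invf_le1 ?ler1n ?ltr0n lt0n;
exact: card_porbit_neq0.
Qed.

Lemma cycle_weight_le1 t S v : cycle_weight t S v <= 1.
Proof. by rewrite /cycle_weight; case: ifP => // _; rewrite gerBl invr_ge0. Qed.

Lemma cycle_weight_half t S v : t v != v -> 2^-1 <= cycle_weight t S v.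
Proof.
move=> tv; rewrite /cycle_weight; case: ifP => _; last by rewrite invf_le1 // ler1n.
have c2 : (1 < #|porbit t v|)%N.
  apply/card_gt1P; exists v, (t v); rewrite porbit_id eq_sym; split => //.
  by rewrite -(porbit_step t v) porbit_id.
have : (#|porbit t v|%:R)^-1 <= 2^-1 :> R.
  by rewrite lef_pV2 ?posrE ?ltr0n ?ler_nat // (ltn_trans _ c2).
lra.
Qed.

(** Cycle by cycle, weight plus one is at least the length: with equality for a cycle inside S, and
    otherwise because each point of S weighs 1 and at most one point is missing. *)
Lemma cycle_weight_sum t S : (forall v, #|porbit t v :\: S| <= 1)%N ->
  #|T|%:R - #|porbits t|%:R <= \sum_(v in S) cycle_weight t S v.
Proof.
move=> hS; have -> : #|T|%:R = \sum_(v : T) 1 :> R by rewrite -sum1_card natr_sum.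
rewrite lerBlDr [X in _ <= X + _]big_mkcond !(sum_porbits t) /=.
have -> : #|porbits t|%:R = \sum_(O in porbits t) 1 :> R by rewrite -sum1_card natr_sum.
rewrite -big_split /=; apply: ler_sum => O /imsetP[x _ ->].
have same v : v \in porbit t x -> porbit t v = porbit t x.
  by move=> vx; apply/eqP; rewrite eq_porbit_mem.
have [sub|nsub] := boolP (porbit t x \subset S).
  rewrite [X in _ <= X + _](eq_bigr (fun=> 1 - #|porbit t x|%:R^-1)) => [|v vx]; last first.
    by rewrite /cycle_weight (same _ vx) sub (fintype.subsetP sub).
  rewrite !sumr_const -[(1 - _) *+ _]mulr_natl mulrBr mulr1 divff ?subrK //.
  by rewrite pnatr_eq0 card_porbit_neq0.
rewrite [X in _ <= X + _](eq_bigr (fun v => (v \in S)%:R)) => [|v vx]; last first.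
  by rewrite /cycle_weight (same _ vx) (negbTE nsub); case: ifP.
rewrite sumr_const -natr_sum -[X in _ + X]/(1%:R) -natrD ler_nat.
have -> : (\sum_(v in porbit t x) (v \in S) = #|porbit t x :&: S|)%N.
  by rewrite -sum1_card big_mkcond [RHS]big_mkcond; apply: eq_bigr => v _; rewrite inE; do 2!case: (_ \in _).
by rewrite -[X in (X <= _)%N](cardsID S) leq_add2l hS.
Qed.

End CycleWeight.

End PermutationCycles.

(** * Weighted sums over subsets of a permuted set *)

Lemma ler_sum_inj (R : numDomainType) (A B : finType) (P : pred A) (h : A -> B)
    (F : A -> R) (G : B -> R) :
  {in P &, injective h} -> (forall b, 0 <= G b) -> (forall a, P a -> F a <= G (h a)) ->
  \sum_(a | P a) F a <= \sum_b G b.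
Proof.
move=> hinj G0 FG; apply: (@le_trans _ _ (\sum_(a | P a) G (h a))); first exact: ler_sum.
have -> : \sum_(a | P a) G (h a) = \sum_(b in [set h a | a in [set a | P a]]) G b.
  rewrite big_imset /=; first by apply: eq_bigl => a; rewrite inE.
  by move=> a b; rewrite !inE => aP bP; apply: hinj.
by rewrite big_mkcond; apply: ler_sum => b _; case: ifP.
Qed.

Section OrbitSums.
Context {R : realType} {I : finType}.
Variables (t : {perm I}) (D : {set I}) (a : I -> R) (p : R).
Hypotheses (a_ge0 : forall i, 0 <= a i) (a_half : forall i, a i <= 2^-1) (p_ge0 : 0 <= p).
Hypothesis a_supp : forall i, i \notin D -> a i = 0.
Implicit Types (N : {set I}) (i v : I).

Definition run_ends N : {set I} := [set i in N | t i \notin N].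

(** For N a set of copied elements, N together with the images of its run ends must be present: each
    element pays its factor a, and each end of a run one additional p. *)
Definition run_weight N : R := (\prod_(i in N) a i) * p ^+ #|run_ends N|.

Let ti := (t^-1)%g.

Let itK k v : iter k ti (iter k t v) = v.
Proof. by elim: k v => // k IH v; rewrite iterSr iterS permK IH. Qed.

Let itKV k v : iter k t (iter k ti v) = v.
Proof. by elim: k v => // k IH v; rewrite iterSr iterS permKV IH. Qed.

(** Number of steps backwards from i that stay in N; a maximal run ending at i thus has one element
    more. *)
Let run N i := find (fun j => iter j.+1 ti i \notin N) (iota 0 #|I|).

Let run_le N i : (run N i <= #|I|)%N.
Proof. by rewrite -[X in (_ <= X)%N](size_iota 0) find_size. Qed.

Let run_mem N i k : i \in N -> (k <= run N i)%N -> iter k ti i \in N.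
Proof.
case: k => // k iN kr; have := before_find 0%N kr.
by rewrite nth_iota ?(leq_trans kr) // add0n => /negbFE.
Qed.

Let run_ge N i k : (k <= #|I|)%N -> (forall j, (j < k)%N -> iter j.+1 ti i \in N) -> (k <= run N i)%N.
Proof.
move=> kI h; rewrite leqNgt; apply/negP => rk.
have r_lt : (run N i < size (iota 0 #|I|))%N by rewrite size_iota (leq_trans rk).
have hs : has (fun j => iter j.+1 ti i \notin N) (iota 0 #|I|) by rewrite has_find.
have := nth_find 0%N hs; rewrite -/(run N i) nth_iota ?(leq_trans rk) // add0n.
by rewrite h.
Qed.

Definition orbit_free N := [forall (i | i \in N), ~~ (porbit t i \subset N)].

(* A set containing no full orbit is recovered from its maximal runs. *)
Let code N : {ffun I -> 'I_(#|I|.+2)} :=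
  [ffun i => if i \in run_ends N then inord (run N i).+1 else ord0].

Let codeE N i : code N i = (if i \in run_ends N then (run N i).+1 else 0%N) :> nat.
Proof. by rewrite ffunE; case: ifP => // _; rewrite inordK // !ltnS run_le. Qed.

Let decode (f : {ffun I -> 'I_(#|I|.+2)}) : {set I} :=
  [set v | [exists i, exists m : 'I_(#|I|.+2), (m < f i)%N && (v == iter m ti i)]].

Let codeK N : orbit_free N -> decode (code N) = N.
Proof.
move=> /forall_inP nf; apply/setP => v; rewrite inE; apply/idP/idP; last first.
  move=> vN; have /subsetPn[w wv wN] := nf _ vN.
  have [k0 k0I Ek0] := porbit_iterP wv.
  have exk : exists k, iter k t v \notin N by exists k0; rewrite -Ek0.
  have [k kN kmin] := ex_minnP exk.
  have kk0 : (k <= k0)%N by apply: kmin; rewrite -Ek0.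
  have kI : (k <= #|I|)%N by rewrite (leq_trans kk0) // (leq_trans (ltnW k0I)) // max_card.
  case: k kN kmin kk0 kI => [|k] kN kmin kk0 kI; first by rewrite /= vN in kN.
  have inN j : (j <= k)%N -> iter j t v \in N.
    by move=> jk; apply: contraLR jk => jN; rewrite -ltnNge kmin.
  have iE : iter k t v \in run_ends N by rewrite inE inN //= -iterS.
  apply/existsP; exists (iter k t v); apply/existsP.
  have k2 : (k < #|I|.+2)%N by rewrite ltnS (leq_trans (ltnW kI)).
  exists (Ordinal k2); rewrite /= itK eqxx andbT codeE iE ltnS.
  apply: run_ge; first by rewrite ltnW.
  move=> j jk; rewrite -{1}(subnKC jk) iterD itK.
  by apply: inN; rewrite leq_subr.
case/existsP => i /existsP[m /andP[]]; rewrite codeE; case: ifP => //.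
by rewrite inE => /andP[iN _] mr /eqP->; apply: run_mem.
Qed.

(** Runs attached to distinct ends are disjoint: if two met, the end of one would have its image
    inside the other, hence in N. *)
Let sum_runs N : (\sum_(i in run_ends N) (run N i).+1 <= #|N|)%N.
Proof.
pose PD := [set x : I * 'I_(#|I|.+1) | (x.1 \in run_ends N) && (x.2 <= run N x.1)%N].
have PDE x : (x \in PD) = (x.1 \in run_ends N) && (x.2 <= run N x.1)%N by rewrite inE.
have -> : (\sum_(i in run_ends N) (run N i).+1 = #|PD|)%N.
  rewrite -sum1_card (eq_bigl (fun x : I * 'I_(#|I|.+1) => (x.1 \in run_ends N) && (x.2 <= run N x.1)%N)); last first.
    by move=> x; rewrite inE.
  rewrite -(pair_big_dep (mem (run_ends N)) (fun i (m : 'I_(#|I|.+1)) => (m <= run N i)%N) (fun _ _ => 1%N)) /=.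
  apply: eq_bigr => i _.
  have rl : ((run N i).+1 <= #|I|.+1)%N by rewrite ltnS run_le.
  have <- : (\sum_(j < (run N i).+1) 1 = (run N i).+1)%N by rewrite sum_nat_const card_ord muln1.
  by rewrite (big_ord_widen _ (fun=> 1%N) rl).
pose h (x : I * 'I_(#|I|.+1)) := iter x.2 ti x.1.
have h_inj : {in PD &, injective h}.
  have key (i i' : I) (k k' : nat) : i \in run_ends N -> i' \in run_ends N ->
      (k' <= run N i')%N -> iter k ti i = iter k' ti i' -> (k < k')%N -> False.
    rewrite !inE => /andP[iN tiN] /andP[iN' _] kr E kk.
    have : iter k t (iter k ti i) = iter k t (iter k' ti i') by rewrite E.
    rewrite itKV -(subnKC kk) addSn -addnS iterD itKV iterS => Ei.
    move: tiN; rewrite Ei permKV run_mem //.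
    by rewrite (leq_trans _ kr) // leq_subr.
  move=> [i k] [i' k']; rewrite !PDE /h /= => /andP[iE kr] /andP[iE' kr'] E.
  have [kk|kk|kk] := ltngtP k k'.
  - by case: (key i i' k k').
  - by case: (key i' i k' k).
  have kk' : k = k' by apply: val_inj.
  by rewrite kk' in E *; congr (_, _); rewrite -(itKV k' i) E itKV.
rewrite -(card_in_imset h_inj); apply/subset_leq_card/fintype.subsetP => v /imsetP[[i k]].
by rewrite PDE inE /= => /andP[/andP[iN _] kr] ->; apply: run_mem.
Qed.

(** Local factor of a code: the value 0 means that no run ends at i, and j > 0 a run of length j,
    bounded by p 2^(-j) since every a is at most 1/2. *)
Let phi i (j : nat) : R := if j == 0%N then 1 else if i \in D then p * 2^-1 ^+ j else 0.

Let phi_ge0 i j : 0 <= phi i j.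
Proof. by rewrite /phi; do 2!case: ifP => // _; rewrite mulr_ge0 // exprn_ge0. Qed.

Let run_weight_code N : run_weight N <= \prod_i phi i (code N i).
Proof.
have [ND|/subsetPn[i iN iD]] := boolP (N \subset D); last first.
  by rewrite /run_weight (bigD1 i) //= a_supp // !mul0r prodr_ge0.
have -> : \prod_i phi i (code N i) = \prod_(i in run_ends N) (p * 2^-1 ^+ (run N i).+1).
  rewrite [RHS]big_mkcond; apply: eq_bigr => i _; rewrite codeE.
  case: (boolP (i \in _)) => //; rewrite inE => /andP[/(fintype.subsetP ND) iD _].
  by rewrite /phi /= iD.
rewrite big_split /= prodr_const mulrC /run_weight ler_wpM2r ?exprn_ge0 // prodrXr.
apply: (@le_trans _ _ (2^-1 ^+ #|N|)).
  by rewrite -prodr_const; apply: ler_prod => i _; rewrite a_ge0 a_half.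
by apply: ler_wiXn2l; rewrite ?invr_ge0 ?invf_le1 ?ler1n ?sum_runs.
Qed.

(** After encoding by ends and lengths the sum factors over points, and the lengths contribute p
    (1/2 + 1/4 + ...) <= p at each point of D. *)
Lemma sum_orbit_free : \sum_(N | orbit_free N) run_weight N <= (1 + p) ^+ #|D|.
Proof.
apply: (@le_trans _ _ (\sum_(f : {ffun I -> 'I_(#|I|.+2)}) \prod_i phi i (f i))).
  apply: (ler_sum_inj (h := code)) => [N N'|f|N _]; last exact: run_weight_code.
    by move=> hN hN' E; rewrite -(codeK hN) E codeK.
  by apply: prodr_ge0.
rewrite -(bigA_distr_bigA (fun (i : I) (j : 'I_(#|I|.+2)) => phi i j)) /=.
rewrite -prodr_const [leRHS]big_mkcond; apply: ler_prod => i _; rewrite sumr_ge0 //=.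
rewrite big_ord_recl /=; case: (boolP (i \in D)) => iD; last first.
  by rewrite big1 ?addr0 // => j _; rewrite /phi /= (negbTE iD).
apply: lerD; first by [].
have -> : \sum_(j < #|I|.+1) phi i (lift ord0 j) = p * (\sum_(j < #|I|.+1) 2^-1 ^+ j.+1).
  by rewrite mulr_sumr; apply: eq_bigr => j _; rewrite /phi /= iD.
rewrite ler_piMr //; move: #|I|.+1 => k.
have -> : \sum_(i < k) 2^-1 ^+ i.+1 = 1 - 2^-1 ^+ k :> R.
  elim: k => [|k IH]; first by rewrite big_ord0 expr0 subrr.
  by rewrite big_ord_recr /= IH exprS; lra.
by rewrite gerBl exprn_ge0.
Qed.

Let full N : {set {set I}} := [set O in porbits t | O \subset N].

Let rest N : {set I} := N :\: cover (full N).

Let porbit_full N i : (i \in cover (full N)) = (porbit t i \subset N).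
Proof.
apply/bigcupP/idP => [|h].
  case=> O; rewrite inE => /andP[/imsetP[x _ ->] xN] ix.
  by have /eqP-> : porbit t i == porbit t x by rewrite eq_porbit_mem.
by exists (porbit t i); rewrite ?porbit_id // inE h andbT imset_f.
Qed.

Let cover_full_sub N : cover (full N) \subset N.
Proof. by apply/bigcupsP => O; rewrite inE => /andP[]. Qed.

Let rest_ends N : run_ends (rest N) = run_ends N.
Proof.
apply/setP => i; rewrite !inE !porbit_full porbit_step.
have [h|h] := boolP (porbit t i \subset N); last by [].
have -> : t i \in N; last by rewrite andbF.
by apply: (fintype.subsetP h); rewrite -(porbit_step t i) porbit_id.
Qed.

Let rest_free N : orbit_free (rest N).
Proof.
apply/forall_inP => i; rewrite inE porbit_full => /andP[h _].
by apply: contra h => /fintype.subset_trans; apply; apply: subsetDl.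
Qed.

Lemma run_weight_split N :
  run_weight N = (\prod_(O in full N) \prod_(i in O) a i) * run_weight (rest N).
Proof.
rewrite /run_weight rest_ends mulrA; congr (_ * _).
rewrite -big_trivIset /=; last first.
  have /and3P[_ tr _] := porbit_partition t; apply: trivIsetS tr.
  by apply/fintype.subsetP => O; rewrite inE => /andP[].
rewrite (bigID (fun i => i \in cover (full N))) /=; congr (_ * _); apply: eq_bigl => i.
  by rewrite andb_idl // => /(fintype.subsetP (cover_full_sub N)).
by rewrite inE andbC.
Qed.

(** A set splits uniquely into the full orbits it contains and an orbit-free rest. Full orbits have
    no run ends, so the weight is multiplicative over this splitting and the two sums separate. *)
Lemma sum_run_weight :
  \sum_N run_weight N <= (1 + p) ^+ #|D| * \prod_(O in porbits t) (1 + \prod_(i in O) a i).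
Proof.
pose b O : R := if O \in porbits t then \prod_(i in O) a i else 0.
have b0 O : 0 <= b O by rewrite /b; case: ifP => // _; apply: prodr_ge0.
pose B (C : {set {set I}}) : R := \prod_O (if O \in C then b O else 1).
have B0 C : 0 <= B C by apply: prodr_ge0 => O _; case: ifP.
have w0 N : 0 <= run_weight N by rewrite /run_weight mulr_ge0 ?exprn_ge0 // prodr_ge0.
apply: (@le_trans _ _ (\sum_(x : {set {set I}} * {set I})
    B x.1 * (if orbit_free x.2 then run_weight x.2 else 0))).
  apply: (ler_sum_inj (h := fun N => (full N, rest N))) => [N N' _ _ [E1 E2]|x|N _] /=.
  - by rewrite -(setID N (cover (full N))) -/(rest N) E2 (setIidPr (cover_full_sub N)) E1
      -(setIidPr (cover_full_sub N')) setID.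
  - by rewrite mulr_ge0 //; case: ifP.
  - rewrite rest_free run_weight_split le_eqVlt; apply/orP; left; apply/eqP; congr (_ * _).
    rewrite /B [LHS]big_mkcond; apply: eq_bigr => O _; case: ifP => //.
    by rewrite inE /b => /andP[->].
rewrite -(pair_bigA _ (fun C N => B C * (if orbit_free N then run_weight N else 0))) /=.
rewrite -big_distrlr /= -big_mkcond mulrC ler_pM ?sumr_ge0 //; first exact: sum_orbit_free.
rewrite /B sum_set_prod le_eqVlt; apply/orP; left; apply/eqP.
by rewrite [RHS]big_mkcond; apply: eq_bigr => O _; rewrite /b addrC; case: ifP; rewrite ?addr0.
Qed.

End OrbitSums.

(** * Orbits of pairs of vertices *)

Section EdgeOrbits.
Context {R : realType} {n : nat}.
Implicit Types (t : 'S_n) (e : {set 'I_n}) (u v : 'I_n) (S : {set 'I_n}).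

Lemma iter_fix_porbit (T : finType) (t : {perm T}) x l :
  (0 < l)%N -> iter l t x = x -> (#|porbit t x| <= l)%N.
Proof.
move=> l0 E; rewrite leqNgt; apply/negP => lc.
have := uniq_traject_porbit t x; set s := traject _ _ _ => us.
have sz : size s = #|porbit t x| by rewrite size_traject.
have h0 : (0 < size s)%N by rewrite sz (leq_ltn_trans _ lc).
have hl : (l < size s)%N by rewrite sz.
have := nth_uniq x h0 hl us; rewrite /s !nth_traject ?(leq_ltn_trans _ lc) // E /= eqxx.
by case: l l0 {E lc hl}.
Qed.

Definition edge_perm t : {perm {set 'I_n}} := perm (imset_inj (@perm_inj _ t)).

Lemma edge_permE t e : edge_perm t e = t @: e.
Proof. by rewrite permE. Qed.

Lemma iter_edge_perm t k u v :
  iter k (edge_perm t) [set u; v] = [set iter k t u; iter k t v].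
Proof.
elim: k => // k IH; rewrite !iterS IH edge_permE.
by rewrite imsetU !imset_set1.
Qed.

Variables (t : 'S_n) (S : {set 'I_n}) (p L : R).
Hypotheses (p_ge0 : 0 <= p) (L_ge0 : 0 <= L) (p_half : p * expR L <= 2^-1).

Let g := cycle_weight (R := R) t S.

(** The maximum over the endpoints is the smallest symmetric weight that dominates both vertex
    weights, as [weighted_load_level] requires. *)
Definition edge_weight e : R := \big[Num.max/0]_(u in e) g u.

Lemma edge_weight_le1 e : edge_weight e <= 1.
Proof. by apply: bigmax_le => // u _; apply: cycle_weight_le1. Qed.

Definition edge_coef e : R :=
  if (e \in edges n) && (e \subset S) then p * expR (L * edge_weight e) else 0.

Lemma edge_coef_ge0 e : 0 <= edge_coef e.
Proof. by rewrite /edge_coef; case: ifP => // _; rewrite mulr_ge0 // expR_ge0. Qed.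

Lemma edge_coef_half e : edge_coef e <= 2^-1.
Proof.
rewrite /edge_coef; case: ifP => _; last by rewrite invr_ge0.
apply: le_trans p_half; rewrite ler_wpM2l // ler_expR.
by rewrite ler_piMr // edge_weight_le1.
Qed.

(** A share of the orbit bound charged to each pair: e^(-L) covers long orbits, and the inverse
    cycle lengths cover the short orbits of pairs lying in a single cycle. *)
Definition orbit_cost e : R :=
  if e \in edges n then expR (- L) +
    \sum_(u in e) (if e \subset porbit t u then #|porbit t u|%:R^-1 else 0) else 0.

Lemma orbit_cost_ge0 e : 0 <= orbit_cost e.
Proof.
rewrite /orbit_cost; case: ifP => // _; rewrite addr_ge0 ?expR_ge0 // sumr_ge0 // => u _.
by case: ifP => // _; rewrite invr_ge0.
Qed.

(* An orbit of pairs is at least as long as the longer of its two vertex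
   cycles, except that a pair inside one cycle may come back swapped after
   half a turn. *)
Lemma orbit_prod_le O : O \in porbits (edge_perm t) ->
  \prod_(e in O) edge_coef e <= \sum_(e in O) orbit_cost e.
Proof.
case/imsetP => e0 _ ->; set O' := porbit _ e0.
have e0O : e0 \in O' by exact: porbit_id.
have [/forall_inP hall|] := boolP [forall (e | e \in O'), (e \in edges n) && (e \subset S)]; last first.
  rewrite negb_forall_in => /exists_inP[e eO /negbTE he].
  by rewrite (bigD1 e) //= /edge_coef he mul0r sumr_ge0 // => e' _; apply: orbit_cost_ge0.
have [u [v [uv e0E vu]]] : exists u v, [/\ u != v, e0 = [set u; v] & (#|porbit t v| <= #|porbit t u|)%N].
  have /andP[] := hall _ e0O; rewrite edgesE => /cards2P[x [y [xy E]]] _.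
  have [h|h] := leqP #|porbit t y| #|porbit t x|; first by exists x, y.
  by exists y, x; rewrite eq_sym xy setUC E (ltnW h).
have inO k : [set iter k t u; iter k t v] \in O'.
  by rewrite -iter_edge_perm -e0E -permX mem_porbit.
have OE e : e \in O' -> exists k, e = [set iter k t u; iter k t v].
  by case/porbit_iterP => k _ ->; exists k; rewrite e0E iter_edge_perm.
have subS w : w \in e0 -> porbit t w \subset S.
  rewrite e0E => we; apply/fintype.subsetP => z /porbit_iterP[k _ ->].
  have /andP[_ /fintype.subsetP] := hall _ (inO k); apply.
  by move: we; rewrite !inE => /orP[]/eqP->; rewrite eqxx ?orbT.
set c := #|porbit t u| in vu.
have c0 : (0 < c)%N by rewrite lt0n card_porbit_neq0.
have gE w : w \in e0 -> forall k, g (iter k t w) <= 1 - c%:R^-1.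
  move=> we k; rewrite /g /cycle_weight porbit_iter subS //.
  rewrite lerB // lef_pV2 ?posrE ?ltr0n // ?ler_nat.
    by move: we; rewrite e0E !inE => /orP[]/eqP->.
  by rewrite lt0n card_porbit_neq0.
have ue : u \in e0 by rewrite e0E !inE eqxx.
have ve : v \in e0 by rewrite e0E !inE eqxx orbT.
have GE e : e \in O' -> edge_weight e <= 1 - c%:R^-1.
  move=> /OE[k ->]; apply: bigmax_le.
    by rewrite subr_ge0 invf_le1 ?ltr0n // ler1n.
  by move=> w; rewrite !inE => /orP[]/eqP->; apply: gE.
have aE e : e \in O' -> edge_coef e <= expR (- (L / c%:R)).
  move=> eO; rewrite /edge_coef hall //.
  apply: (@le_trans _ _ (p * expR L * expR (- (L / c%:R)))); last first.
    by rewrite ler_piMl ?expR_ge0 // (le_trans p_half) // invf_le1 // ler1n.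
  rewrite -mulrA ler_wpM2l // -expRD ler_expR -{2}[L]mulr1 -mulrN -mulrDr.
  by rewrite ler_wpM2l // GE.
(* With at least c pairs, the factors e^(-L/c) multiply to at most e^(-L), paid by one pair. With l
   < c pairs, l steps must exchange u and v, so c <= 2l; the product is then at most 1/2 <= l/c,
   paid by the terms 1/c. *)
have [cl|lc] := leqP c #|O'|.
  apply: (@le_trans _ _ (expR (- L))).
    apply: (@le_trans _ _ (\prod_(e in O') expR (- (L / c%:R)))).
      by apply: ler_prod => e eO; rewrite edge_coef_ge0 aE.
    rewrite prodr_const -expRM_natl ler_expR mulrN lerN2.
    by rewrite mulrCA -[leLHS]mulr1 ler_wpM2l // ler_pdivlMr ?ltr0n // mul1r ler_nat.
  rewrite (bigD1 e0) //= -[leLHS]addr0 lerD ?sumr_ge0 // => [|e _]; last exact: orbit_cost_ge0.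
  rewrite /orbit_cost; have /andP[-> _] := hall _ e0O; rewrite lerDl sumr_ge0 // => w _.
  by case: ifP => // _; rewrite invr_ge0.
set l := #|O'| in lc.
have l0 : (0 < l)%N by rewrite lt0n card_porbit_neq0.
have El : [set iter l t u; iter l t v] = [set u; v].
  by rewrite -iter_edge_perm -e0E /l /O' iter_porbit.
have lu : iter l t u = v.
  have : iter l t u \in [set u; v] by rewrite -El !inE eqxx.
  rewrite !inE => /orP[/eqP E|/eqP//].
  by have := iter_fix_porbit l0 E; rewrite leqNgt lc.
have lv : iter l t v = u.
  have : iter l t v \in [set u; v] by rewrite -El !inE eqxx orbT.
  rewrite !inE => /orP[/eqP//|/eqP E]; move/eqP: uv => [].
  by move: E; rewrite -{2}lu -!permX => /perm_inj.
have c2l : (c <= l + l)%N.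
  by apply: iter_fix_porbit; rewrite ?addn_gt0 ?l0 // iterD lu lv.
apply: (@le_trans _ _ 2^-1).
  rewrite (bigD1 e0) //= -[leRHS]mulr1 ler_pM ?edge_coef_ge0 ?edge_coef_half //.
    by apply: prodr_ge0 => e _; apply: edge_coef_ge0.
  apply: prodr_ile1 => e _; rewrite edge_coef_ge0 (le_trans (edge_coef_half e)) //.
  by rewrite invf_le1 // ler1n.
apply: (@le_trans _ _ (\sum_(e in O') c%:R^-1)).
  rewrite sumr_const -/l -[leRHS]mulr_natl ler_pdivlMr ?ltr0n // mulrC ler_pdivrMr //.
  by rewrite -natrM ler_nat muln2 -addnn.
apply: ler_sum => e eO; rewrite /orbit_cost; have /andP[-> _] := hall _ eO.
have [k Ek] := OE _ eO.
have ke : iter k t u \in e by rewrite Ek !inE eqxx.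
rewrite (bigD1 (iter k t u)) //= porbit_iter.
have -> : e \subset porbit t u.
  rewrite Ek subUset !sub1set -!permX mem_porbit /= -lu -!permX -permM -expgD.
  exact: mem_porbit.
rewrite -/c addrCA lerDl addr_ge0 ?expR_ge0 // sumr_ge0 // => w _.
by case: ifP => // _; rewrite invr_ge0.
Qed.

Lemma card_edges_le : (#|edges n| <= n ^ 2)%N.
Proof.
have := sum_ordered_pairs (fun e : {set 'I_n} => 1%N).
rewrite sum1_card => h; rewrite -(@leq_pmul2r 2) //.
apply: (@leq_trans (\sum_(u : 'I_n) \sum_(v : 'I_n | u != v) 1)%N).
  by rewrite h mulr2n muln2 -addnn.
apply: (@leq_trans (\sum_(u : 'I_n) n)%N).
  by apply: leq_sum => u _; rewrite sum1_card (leq_trans (max_card _)) // card_ord.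
by rewrite sum_nat_const card_ord leq_pmulr.
Qed.

(** A vertex in a cycle of length c has fewer than c partners there, each bringing 1/c, so pairs
    inside cycles cost at most n altogether. *)
Lemma sum_orbit_cost : \sum_e orbit_cost e <= n%:R ^+ 2 * expR (- L) + n%:R.
Proof.
rewrite /orbit_cost -big_mkcond big_split /= lerD //.
  rewrite sumr_const -[leLHS]mulr_natl ler_wpM2r ?expR_ge0 // -natrX ler_nat.
  exact: card_edges_le.
rewrite -(ler_pM2l (x := 2)) // mulr_natl.
rewrite -(sum_ordered_pairs (fun e => \sum_(u in e) (if e \subset porbit t u then #|porbit t u|%:R^-1 else 0))).
apply: (@le_trans _ _ (\sum_(u : 'I_n) \sum_(v in porbit t u) 2 * #|porbit t u|%:R^-1)); last first.
  rewrite (eq_bigr (fun=> 2)) => [|u _]; last first.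
    rewrite sumr_const -[LHS]mulr_natl mulrCA divff ?mulr1 // pnatr_eq0.
    exact: card_porbit_neq0.
  by rewrite sumr_const card_ord mulr_natr.
apply: ler_sum => u _; rewrite [leLHS]big_mkcond [leRHS]big_mkcond; apply: ler_sum => v _.
have [uv|uv] /= := boolP (u != v); last by case: ifP => // _; rewrite mulr_ge0 // invr_ge0.
rewrite big_setU1 ?inE //= big_set1 !subUset !sub1set !porbit_id /= andbT.
rewrite [u \in _]porbit_sym; case: ifP => [vu|]; last by rewrite addr0.
have /eqP-> : porbit t v == porbit t u by rewrite eq_porbit_mem.
lra.
Qed.

End EdgeOrbits.

(** * First moment bound on dense self-overlaps *)

Section DenseCopies.
Context {R : realType} {n : nat}.
Implicit Types (t : 'S_n) (e : {set 'I_n}) (u v : 'I_n) (S : {set 'I_n}) (X M : graph n).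

Definition copied_edges t S X : {set {set 'I_n}} :=
  [set e in X | (e \subset S) && (t @: e \in X)].

Lemma setD_imset_run_ends (I : finType) (t : {perm I}) (M : {set I}) :
  [disjoint M & t @: run_ends t M].
Proof.
rewrite disjoint_sym; apply/pred0P => x /=; apply/negP => /andP[/imsetP[y]].
by rewrite inE => /andP[_ /negbTE h] ->; rewrite h.
Qed.

Section Moment.
Variables (pe : {set 'I_n} -> R) (t : 'S_n) (S : {set 'I_n}) (p L : R).
Hypotheses (pe_prob : prob_weights pe) (pe_supp : forall e, e \notin edges n -> pe e = 0).
Hypotheses (pe_le : forall e, pe e <= p) (p_ge0 : 0 <= p).

Let x e := expR (L * edge_weight (R := R) t S e).

Let pe_ge0 e : 0 <= pe e.
Proof. by case/andP: (pe_prob e). Qed.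

(** If all of M is copied, then M and the images of its run ends are present. These two sets are
    disjoint, so independence gives one factor p per element of M and another one per run end. *)
Lemma copied_subset_moment M :
  EE pe (fun X => (M \subset copied_edges t S X)%:R * \prod_(e in M) x e) <=
  run_weight (edge_perm t) (edge_coef t S p L) p M.
Proof.
have r0 : 0 <= run_weight (edge_perm t) (edge_coef t S p L) p M.
  rewrite /run_weight mulr_ge0 ?exprn_ge0 // prodr_ge0 // => e _.
  by apply: edge_coef_ge0.
under eq_EE => X do rewrite mulrC.
rewrite EE_Z.
have [/fintype.subsetP MS|/subsetPn[e eM eS]] :=
    boolP (M \subset [set e | (e \in edges n) && (e \subset S)]); last first.
  apply: le_trans r0; rewrite pmulr_rle0; last by apply: prodr_gt0 => e' _; exact: expR_gt0.
  apply: (@le_trans _ _ (Pr pe (fun X => (e \subset S) && ([set e] \subset X)))).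
    apply: Pr_le => // X /fintype.subsetP/(_ _ eM); rewrite !inE sub1set.
    by case/and3P => -> ->.
  have [eS'|_] := boolP (e \subset S); last by rewrite /Pr EE_cst.
  by rewrite Pr_subset big_set1 pe_supp //; move: eS; rewrite !inE eS' andbT.
set T := edge_perm t; set B := M :|: T @: run_ends T M.
have dis := setD_imset_run_ends T M.
apply: (@le_trans _ _ ((\prod_(e in M) x e) * Pr pe (fun X => B \subset X))).
  apply: ler_wpM2l; first by apply: prodr_ge0 => e _; apply: expR_ge0.
  apply: Pr_le => // X /fintype.subsetP h; rewrite subUset; apply/andP; split.
    by apply/fintype.subsetP => e /h; rewrite inE => /andP[].
  apply/fintype.subsetP => e /imsetP[e']; rewrite inE => /andP[/h + _] ->.
  by rewrite inE edge_permE => /and3P[].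
rewrite Pr_subset /B.
have -> : \prod_(e in M :|: T @: run_ends T M) pe e =
    (\prod_(e in M) pe e) * \prod_(e in run_ends T M) pe (T e).
  rewrite -(big_imset pe (h := T)) /=; last by move=> a b _ _; apply: perm_inj.
  by rewrite -bigU //=; apply: eq_bigl => e; rewrite inE.
rewrite mulrA -big_split /= /run_weight ler_pM ?prodr_ge0 //.
- by move=> e _; rewrite mulr_ge0 ?expR_ge0.
- apply: ler_prod => e eM; have := MS _ eM; rewrite inE => eE.
  by rewrite mulr_ge0 ?expR_ge0 // /edge_coef eE mulrC ler_wpM2r ?expR_ge0.
- rewrite -prodr_const; apply: ler_prod => e _; by rewrite pe_ge0 pe_le.
Qed.

(** Bounding a product of x by the product of 1 + x and expanding replaces the exact set of copied
    edges by events that a given M is copied, whose probabilities are explicit. *)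
Lemma copied_moment :
  EE pe (fun X => \prod_(e in copied_edges t S X) x e) <=
  \sum_(M : {set {set 'I_n}}) run_weight (edge_perm t) (edge_coef t S p L) p M.
Proof.
apply: (@le_trans _ _ (\sum_(M : {set {set 'I_n}}) EE pe (fun X => (M \subset copied_edges t S X)%:R * \prod_(e in M) x e))).
  rewrite -EE_sum; apply: EE_le => // X; set N := copied_edges t S X.
  rewrite (eq_bigr (fun M : {set {set 'I_n}} => \prod_e
     (if e \in M then (if e \in N then x e else 0) else 1))); last first.
    move=> M _; have [/fintype.subsetP MN|/subsetPn[e eM eN]] := boolP (M \subset N).
      by rewrite mul1r [LHS]big_mkcond; apply: eq_bigr => e _; case: ifP => // /MN ->.
    by rewrite mul0r (bigD1 e) //= eM (negbTE eN) mul0r.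
  rewrite sum_set_prod [leLHS]big_mkcond; apply: ler_prod => e _.
  by rewrite /x; case: ifP => _; rewrite ?expR_ge0 ?add0r ?lexx ?ler01 ?lerDl ?ler01.
by apply: ler_sum => M _; apply: copied_subset_moment.
Qed.

End Moment.

Lemma natr_exp_expR (k : nat) (a : R) : 0 <= a -> a ^+ k <= expR (k%:R * a).
Proof.
move=> a0; rewrite expRM_natl; apply: lerXn2r; rewrite ?nnegrE ?expR_ge0 //.
by apply: le_trans (expR_ge1Dx a); rewrite lerDr.
Qed.

(** With p = q/n and e^L = n/(2q), the product p e^L is exactly 1/2. The exponent collects n^2 p =
    qn from the runs, and n^2 e^(-L) = 2qn plus n from the full orbits. *)
Lemma copied_moment_expR (pe : {set 'I_n} -> R) t S (q : R) :
  prob_weights pe -> (forall e, e \notin edges n -> pe e = 0) ->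
  1 <= q -> (forall e, pe e <= q / n%:R) -> 2 * q <= n%:R ->
  EE pe (fun X => \prod_(e in copied_edges t S X)
     expR (ln (n%:R / (2 * q)) * edge_weight (R := R) t S e)) <= expR (n%:R * (3 * q + 1)).
Proof.
move=> hp hs q1 hq nq; set L := ln _; set p := q / n%:R.
have q0 : 0 < q by lra.
have n0 : 0 < n%:R :> R by lra.
have y0 : 0 < n%:R / (2 * q) by rewrite divr_gt0 // mulr_gt0.
have eL : expR L = n%:R / (2 * q) by rewrite lnK.
have L0 : 0 <= L by rewrite ln_ge0 // ler_pdivlMr ?mulr_gt0 // mul1r.
have p0 : 0 <= p by rewrite divr_ge0 ?ltW.
have phalf : p * expR L <= 2^-1.
  have -> : p * expR L = 2^-1; last by [].
  rewrite eL /p; field; by rewrite !gt_eqF.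
apply: le_trans (copied_moment t S L hp hs hq p0) _.
have asupp e : e \notin edges n -> edge_coef t S p L e = 0 by rewrite /edge_coef => /negbTE->.
apply: le_trans (sum_run_weight (D := edges n) (edge_perm t)
  (edge_coef_ge0 t S L p0) (edge_coef_half t S p0 L0 phalf) p0 asupp) _.
have -> : n%:R * (3 * q + 1) = (n%:R ^+ 2 * p) + (n%:R ^+ 2 * expR (- L) + n%:R).
  rewrite expRN eL /p; field; by rewrite !gt_eqF.
rewrite expRD; apply: ler_pM.
- by rewrite exprn_ge0 // addr_ge0.
- by apply: prodr_ge0 => O _; rewrite addr_ge0 // prodr_ge0 // => e _; apply: edge_coef_ge0.
- apply: (@le_trans _ _ (expR p ^+ #|edges n|)).
    by apply: lerXn2r; rewrite ?nnegrE ?expR_ge0 ?addr_ge0 // expR_ge1Dx.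
  by rewrite -expRM_natl ler_expR ler_wpM2r // -natrX ler_nat card_edges_le.
apply: (@le_trans _ _ (\prod_(O in porbits (edge_perm t)) expR (\sum_(e in O) orbit_cost t L e))).
  apply: ler_prod => O hO; apply/andP; split.
    by rewrite addr_ge0 // prodr_ge0 // => e _; apply: edge_coef_ge0.
  apply: le_trans (expR_ge1Dx _) _; rewrite ler_expR.
  exact: orbit_prod_le p0 L0 phalf _ hO.
rewrite -expR_sum ler_expR -sum_porbits; exact: sum_orbit_cost.
Qed.

Definition dense_copy (delta eps : R) X : bool :=
  (X \subset edges n) && [exists sigma : 'S_n, exists A : {set 'I_n},
    [&& A \subset Der sigma, eps * n%:R <= #|A|%:R &
      [forall (v | v \in A), 1 + delta <= balanced_load (R := R) (graph_meet sigma X X) v]]].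

(** S is the full level set, so that boundary edges give it no load. Outside S the permutation is
    modified to have as many cycles as possible. Load 1 already accounts for n minus the number of
    cycles, and the surplus delta acts on A, whose vertices are moved and so weigh at least 1/2. *)
Lemma dense_copy_witness (delta eps : R) X : 0 <= delta -> dense_copy delta eps X ->
  exists t S, n%:R - #|porbits t|%:R + delta * (eps * n%:R / 2) <=
    \sum_(e in copied_edges t S X) edge_weight (R := R) t S e.
Proof.
move=> d0 /andP[Xn /existsP[sigma /existsP[A /and3P[AD Acard /forall_inP Aload]]]].
set M := graph_meet sigma X X in Aload.
pose S := [set v | 1 + delta <= balanced_load (R := R) M v].
(* The inverse appears because e lies in the overlap when both e and its preimage under [sigma] are
   edges of X. *)
have [t [tS tc]] := split_cycles (sigma^-1)%g S.
exists t, S; set g := cycle_weight (R := R) t S.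
have AS : A \subset S by apply/fintype.subsetP => v vA; rewrite inE Aload.
have Mn : M \subset edges n by apply: fintype.subset_trans Xn; exact: subsetIr.
have gG u v : adj M u v -> g v <= edge_weight t S [set u; v].
  move=> _; by apply: (@le_bigmax_cond _ _ _ 0 v (fun w => w \in [set u; v]) (cycle_weight t S)); rewrite !inE eqxx orbT.
have := weighted_load_level Mn gG (erefl S).
have -> : \sum_(e in M | e \subset S) edge_weight t S e =
          \sum_(e in copied_edges t S X) edge_weight (R := R) t S e.
  apply: eq_bigl => e; rewrite [in RHS]inE.
  have [eS|_] := boolP (e \subset S); last by rewrite /= !andbF.
  rewrite /=.
  have te : t @: e = (sigma^-1)%g @: e.
    by apply: eq_in_imset => v ve; apply: tS; exact: (fintype.subsetP eS _ ve).
  rewrite te andbT inE andbC; congr (_ && _); apply/imsetP/idP => [[e' e'X ->]|h].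
    rewrite -imset_comp (eq_imset (g := id)) ?imset_id // => v /=; exact: permK.
  exists ((sigma^-1)%g @: e) => //.
  rewrite -imset_comp (eq_imset (g := id)) ?imset_id // => v /=; exact: permKV.
apply: le_trans.
have s1 := cycle_weight_sum (R := R) tc; rewrite card_ord in s1.
have s2 : eps * n%:R / 2 <= \sum_(v in S) g v.
  apply: (@le_trans _ _ (\sum_(v in A) 2^-1)).
    by rewrite sumr_const -[leRHS]mulr_natl ler_wpM2r // invr_ge0.
  rewrite [leRHS](big_setID A) /= (setIidPr AS) -[leLHS]addr0 lerD ?sumr_ge0 //.
    apply: ler_sum => v vA; apply: cycle_weight_half.
    rewrite tS ?(fintype.subsetP AS) //.
    have := fintype.subsetP AD _ vA; rewrite inE; apply: contra => /eqP E.
    by rewrite -{1}E permKV.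
  by move=> v _; apply: cycle_weight_ge0.
have s3 : (1 + delta) * \sum_(v in S) g v <= \sum_(v in S) g v * balanced_load (R := R) M v.
  rewrite mulr_sumr; apply: ler_sum => v; rewrite inE => h; rewrite mulrC.
  by rewrite ler_wpM2l ?cycle_weight_ge0.
apply: le_trans s3; rewrite mulrDl mul1r; apply: lerD => //.
by rewrite ler_wpM2l.
Qed.

(** With k cycles the term is (2q/n)^(n-k) <= (2q)^n n^k / n^n, and the sum of n^k is at most
    (2n)^n. *)
Lemma sum_expR_cycles (q : R) : 1 <= q -> 2 * q <= n%:R ->
  \sum_(t : 'S_n) expR (- (ln (n%:R / (2 * q)) * (n%:R - #|porbits t|%:R))) <= expR (n%:R * (4 * q)).
Proof.
move=> q1 nq; have n0 : 0 < n%:R :> R by lra.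
have y0 : 0 < n%:R / (2 * q) by rewrite divr_gt0 //; lra.
have q20 : 0 < 2 * q by lra.
apply: (@le_trans _ _ (\sum_(t : 'S_n) (n ^ #|porbits t|)%:R * ((2 * q) ^+ n / n%:R ^+ n))).
  apply: ler_sum => t _.
  have cn : (#|porbits t| <= n)%N.
    by rewrite -card_cycle_reps (leq_trans (max_card _)) // card_ord.
  rewrite -natrB // mulrC expRN expRM_natl lnK // expr_div_n invf_div natrX.
  have -> : n%:R ^+ #|porbits t| * ((2 * q) ^+ n / n%:R ^+ n) =
      (2 * q) ^+ n / n%:R ^+ (n - #|porbits t|) :> R.
    have -> : n%:R ^+ n = n%:R ^+ (n - #|porbits t|) * n%:R ^+ #|porbits t| :> R.
      by rewrite -exprD subnK.
    have h1 : n%:R ^+ (n - #|porbits t|) != 0 :> R by rewrite expf_neq0 // gt_eqF.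
    have h2 : n%:R ^+ #|porbits t| != 0 :> R by rewrite expf_neq0 // gt_eqF.
    move: h1 h2; set X := _ ^+ n; set Y := _ ^+ (n - _); set Z := _ ^+ _ => h1 h2.
    by field; rewrite h1 h2.
  rewrite ler_wpM2r ?invr_ge0 ?exprn_ge0 ?(ltW n0) //.
  by apply: ler_weXn2l; [lra|rewrite leq_subr].
rewrite -mulr_suml -natr_sum.
have h := sum_pow_cycles (T := 'I_n); rewrite card_ord in h.
apply: (@le_trans _ _ ((2 ^ n * n ^ n)%:R * ((2 * q) ^+ n / n%:R ^+ n))).
  by rewrite ler_wpM2r ?ler_nat // divr_ge0 ?exprn_ge0 ?ltW.
have -> : (2 ^ n * n ^ n)%:R * ((2 * q) ^+ n / n%:R ^+ n) = (4 * q) ^+ n :> R.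
  rewrite natrM !natrX (_ : 4 * q = 2 * (2 * q)); last by ring.
  rewrite [in RHS]exprMn; have h1 : n%:R ^+ n != 0 :> R by rewrite expf_neq0 // gt_eqF.
  by move: h1; set X := n%:R ^+ n; set Y := _ ^+ n; set Z := _ ^+ n => h1; field.
by apply: natr_exp_expR; lra.
Qed.

(** An exponential Markov bound summed over all pairs (t, S). The constant 7q + 2 adds 1 for the 2^n
    sets S, 4q for the permutations and 3q + 1 for the moment. *)
Lemma dense_copy_bound (pe : {set 'I_n} -> R) (q delta eps : R) :
  prob_weights pe -> (forall e, e \notin edges n -> pe e = 0) ->
  1 <= q -> (forall e, pe e <= q / n%:R) -> 2 * q <= n%:R -> 0 < delta -> 0 < eps ->
  Pr pe (dense_copy delta eps) <=
    expR (n%:R * (7 * q + 2 - ln (n%:R / (2 * q)) * (delta * eps / 2))).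
Proof.
move=> hp hs q1 hq nq d0 e0; set L := ln _.
have L0 : 0 <= L by rewrite ln_ge0 // ler_pdivlMr ?mul1r //; lra.
pose c (t : 'S_n) : R := expR (- (L * (n%:R - #|porbits t|%:R + delta * (eps * n%:R / 2)))).
apply: (@le_trans _ _ (EE pe (fun X => \sum_(t : 'S_n) \sum_(S : {set 'I_n})
   c t * \prod_(e in copied_edges t S X) expR (L * edge_weight t S e)))).
  have F0 (t : 'S_n) S X : 0 <= c t * \prod_(e in copied_edges t S X) expR (L * edge_weight t S e).
    by rewrite mulr_ge0 ?expR_ge0 // prodr_ge0 // => e _; apply: expR_ge0.
  apply: EE_le => // X; have [dX|_] := boolP (dense_copy _ _ _); last first.
    by apply: sumr_ge0 => t _; apply: sumr_ge0.
  have [t [S h]] := dense_copy_witness (ltW d0) dX.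
  rewrite (bigD1 t) //= (bigD1 S) //= -addrA -[leLHS]addr0 lerD //; last first.
    by rewrite addr_ge0 ?sumr_ge0 // => t' _; rewrite sumr_ge0.
  by rewrite -expR_sum -mulr_sumr /c -expRD -[leLHS]expR0 ler_expR addrC subr_ge0 ler_wpM2l.
rewrite EE_sum; under eq_bigr do rewrite EE_sum.
apply: (@le_trans _ _ (\sum_(t : 'S_n) \sum_(S : {set 'I_n}) c t * expR (n%:R * (3 * q + 1)))).
  apply: ler_sum => t _; apply: ler_sum => S _; rewrite EE_Z ler_wpM2l ?expR_ge0 //.
  exact: copied_moment_expR.
under eq_bigr do rewrite sumr_const -[_ *+ _]mulr_natl.
have -> : #|{set 'I_n}| = (2 ^ n)%N by rewrite -cardsT -powersetT card_powerset cardsT card_ord.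
rewrite -mulr_sumr -mulr_suml.
have -> : \sum_t c t = (\sum_(t : 'S_n) expR (- (L * (n%:R - #|porbits t|%:R)))) *
    expR (- (L * (delta * (eps * n%:R / 2)))).
  by rewrite mulr_suml; apply: eq_bigr => t _; rewrite -expRD /c mulrDr opprD.
have h2 : (2 ^ n)%:R <= expR n%:R :> R.
  rewrite natrX -[n%:R]mulr1 expRM_natl; apply: lerXn2r; rewrite ?nnegrE ?expR_ge0 //.
  by have := expR_ge1Dx (1 : R); lra.
have -> : n%:R * (7 * q + 2 - L * (delta * eps / 2)) =
   n%:R + (n%:R * (4 * q) + - (L * (delta * (eps * n%:R / 2))) + n%:R * (3 * q + 1)) by ring.
have s0 : 0 <= \sum_(t : 'S_n) expR (- (L * (n%:R - #|porbits t|%:R))).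
  by apply: sumr_ge0 => t _; apply: expR_ge0.
rewrite !expRD; apply: ler_pM => //.
  by rewrite !mulr_ge0 ?expR_ge0.
rewrite ler_wpM2r ?expR_ge0 // ler_wpM2r ?expR_ge0 //.
exact: sum_expR_cycles.
Qed.

End DenseCopies.

Lemma dense_copy_vanishes (R : realType) (q delta eps eta : R) :
  1 <= q -> 0 < delta -> 0 < eps -> 0 < eta ->
  exists a : R, forall n (pe : {set 'I_n} -> R), a <= n%:R ->
    prob_weights pe -> (forall e, e \notin edges n -> pe e = 0) ->
    (forall e, pe e <= q / n%:R) -> Pr pe (dense_copy delta eps) <= eta.
Proof.
(* Once L >= B the gain exceeds 7q + 2 by at least 1, so the bound is e^(-n). *)
move=> q1 d0 e0 h0; set B := (7 * q + 3) * 2 / (delta * eps).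
exists (Num.max (2 * q) (Num.max (2 * q * expR B) eta^-1)) => n pe.
rewrite !ge_max => /and3P[n1 n2 n3] hp hs hq.
apply: le_trans (dense_copy_bound hp hs q1 hq n1 d0 e0) _.
have n0 : 0 < n%:R :> R by lra.
have q20 : 0 < 2 * q by lra.
have BL : B <= ln (n%:R / (2 * q)).
  rewrite -[B]expRK ler_ln ?posrE ?expR_gt0 ?divr_gt0 // ler_pdivlMr // mulrC.
  exact: n2.
have de : 0 < delta * eps by rewrite mulr_gt0.
have h : 7 * q + 3 <= ln (n%:R / (2 * q)) * (delta * eps / 2).
  apply: (@le_trans _ _ (B * (delta * eps / 2))); last by rewrite ler_wpM2r // divr_ge0 // ltW.
  have -> : B * (delta * eps / 2) = 7 * q + 3; last by [].
  by rewrite /B; field; rewrite !gt_eqF.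
apply: (@le_trans _ _ (expR (- n%:R))).
  rewrite ler_expR -[leRHS]mulr1 mulNr -mulrN ler_wpM2l ?(ltW n0) //; lra.
rewrite expRN -[eta]invrK lef_pV2 ?posrE ?expR_gt0 ?invr_gt0 //.
by apply: le_trans n3 _; apply: le_trans (expR_ge1Dx _); rewrite lerDr.
Qed.

(** * Exploration of a graph *)

Section Exploration.
Context {R : realType} {n : nat}.
Implicit Types (X : graph n) (A U Z S N : {set 'I_n}) (u v : 'I_n).

Definition nbrs X u U : {set 'I_n} := [set v in U | [set u; v] \in X].

Definition next_vertex A U : option 'I_n :=
  if [pick u in A] is Some u then Some u else [pick u in U].

(* The active set after k steps; when it is exhausted, the exploration restarts
   from a vertex that has not been seen. *)
Fixpoint explore k A U X : {set 'I_n} :=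
  if k is k'.+1 then
    if next_vertex A U is Some u then
      let N := nbrs X u (U :\ u) in explore k' (A :\ u :|: N) (U :\ u :\: N) X
    else A
  else A.

Variant next_vertex_spec A U : option 'I_n -> Type :=
| NextActive u of u \in A : next_vertex_spec A U (Some u)
| NextFresh u of A = set0 & u \in U : next_vertex_spec A U (Some u)
| NextNone of A = set0 & U = set0 : next_vertex_spec A U None.

Lemma next_vertexP A U : next_vertex_spec A U (next_vertex A U).
Proof.
rewrite /next_vertex; case: pickP => [u uA|A0]; first exact: NextActive.
have A0' : A = set0 by apply/setP => x; rewrite A0 inE.
case: pickP => [u uU|U0]; first exact: NextFresh.
by apply: NextNone => //; apply/setP => x; rewrite U0 inE.
Qed.

Lemma nbrs_sub X u U : nbrs X u U \subset U.
Proof. by apply/fintype.subsetP => v; rewrite inE => /andP[]. Qed.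

Lemma explore_sub k A U X : explore k A U X \subset A :|: U.
Proof.
elim: k A U => [|k IH] A U /=; first exact: subsetUl.
case: next_vertexP => [u _|u _ _|_ _]; last exact: subsetUl.
all: apply: fintype.subset_trans (IH _ _) _; apply/fintype.subsetP => v; rewrite !inE;
  by case: (v == u) => //=; case: (v \in A) => //=; case: (v \in U) => //=.
Qed.

Definition pairs_in S : {set {set 'I_n}} := [set e : {set 'I_n} | e \subset S].

(** This locality gives independence: once u has been processed, the rest of the exploration ignores
    all pairs containing u. *)
Lemma explore_depends k A U X : explore k A U X = explore k A U (X :&: pairs_in (A :|: U)).
Proof.
elim: k A U X => //= k IH A U X.
have key u : u \in A :|: U ->
   (let N := nbrs X u (U :\ u) in explore k (A :\ u :|: N) (U :\ u :\: N) X) =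
   (let N := nbrs (X :&: pairs_in (A :|: U)) u (U :\ u) in
      explore k (A :\ u :|: N) (U :\ u :\: N) (X :&: pairs_in (A :|: U))).
  move=> uAU /=.
  have -> : nbrs (X :&: pairs_in (A :|: U)) u (U :\ u) = nbrs X u (U :\ u).
    apply/setP => v; rewrite !inE subUset !sub1set uAU !inE.
    by case: (v \in U); rewrite ?andbF //= orbT !andbT.
  set N := nbrs X u (U :\ u).
  rewrite IH [RHS]IH; congr (explore _ _ _ _); apply/setP => e; rewrite !inE.
  case: (boolP (e \subset A :\ u :|: N :|: (U :\ u :\: N))) => h; rewrite ?andbF ?andbT //.
  have -> : e \subset A :|: U.
    apply: fintype.subset_trans h _; apply/fintype.subsetP => v.
    by rewrite !inE; case: (v == u) => //=; case: (v \in A) => //=; case: (v \in U).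
  by rewrite andbT.
by case: next_vertexP => [u uA|u _ uU|_ _] //; apply: key; rewrite inE ?uA ?uU ?orbT.
Qed.

(** Edges of the current component with an endpoint already processed. Those inside A are left out:
    they form the surplus to be gained at the end. *)
Definition touching X Z A : nat := #|[set e in X | (e \subset Z :|: A) && ~~ (e \subset A)]|.

Lemma touching_inner X Z A :
  inner_edges X (Z :|: A) = (touching X Z A + inner_edges X A)%N.
Proof.
rewrite /inner_edges /touching -(cardsID (pairs_in A)) addnC; congr (_ + _)%N; apply: eq_card => e;
  rewrite !inE.
  by case: (e \in X); rewrite //= andbC.
case: (e \in X) => //=; rewrite andbC andb_idr // => h.
by apply: fintype.subset_trans h (subsetUr _ _).
Qed.

Lemma card_star X u U : u \notin U ->
  #|nbrs X u U| = #|[set [set u; v] | v in nbrs X u U]|.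
Proof.
move=> uU; rewrite card_in_imset // => v w; rewrite !inE => /andP[vU _] /andP[wU _] E.
have : v \in [set u; w] by rewrite -E !inE eqxx orbT.
rewrite !inE => /orP[/eqP vu|/eqP//]; by move: uU; rewrite -vu vU.
Qed.

(* Only the current component is kept: each explored vertex other than its root
   is paid for by the edge through which it was discovered. *)
Lemma explore_excess k X Z A U :
  [disjoint Z & A :|: U] -> [disjoint A & U] ->
  (#|Z :|: A| <= touching X Z A + 1)%N ->
  exists S, (#|S| + inner_edges X (explore k A U X) <= inner_edges X S + 1)%N.
Proof.
elim: k Z A U => [|k IH] Z A U dZ dA hT.
  by exists (Z :|: A); rewrite touching_inner /= addnAC leq_add2r.
have base : exists S, (#|S| + inner_edges X A <= inner_edges X S + 1)%N.
  by exists (Z :|: A); rewrite touching_inner addnAC leq_add2r.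
rewrite /=; case: next_vertexP => [u uA|u A0 uU|_ _] //.
- set N := nbrs X u (U :\ u).
  have uU : u \notin U by rewrite (disjointFr dA uA).
  have NU : N \subset U by apply: fintype.subset_trans (nbrs_sub _ _ _) (subD1set _ _).
  have inU x : x \in N -> x \in U by move/(fintype.subsetP NU).
  have NX x : x \in N -> [set u; x] \in X by rewrite inE => /andP[].
  have cN : #|N| = #|[set [set u; v] | v in N]| by rewrite card_star ?inE ?eqxx.
  clearbody N.
  (* Each discovered vertex joins the component together with its edge to u, so both sides of the
     invariant grow by |N|. *)
  apply: (IH (u |: Z)).
  + rewrite -setI_eq0; apply/eqP/setP => x; rewrite !inE.
    have [->|xu] /= := eqVneq x u.
      by rewrite ?andbF ?orbF; apply/negbTE/negP => /inU; rewrite (negbTE uU).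
    have [xZ|//] /= := boolP (x \in Z).
    have := disjointFr dZ xZ; rewrite inE => /negbT; rewrite negb_or => /andP[/negbTE-> xU].
    by rewrite (negbTE xU) andbF orbF /=; apply/negbTE/negP => /inU; rewrite (negbTE xU).
  + rewrite -setI_eq0; apply/eqP/setP => x; rewrite !inE.
    have [_|xu] /= := eqVneq x u; first by rewrite !andbF.
    have [xA|xA] /= := boolP (x \in A).
      by rewrite (disjointFr dA xA) andbF.
    by case: (x \in N).
  have E1 : u |: Z :|: (A :\ u :|: N) = (Z :|: A) :|: N.
    apply/setP => x; rewrite !inE; have [->|xu] /= := eqVneq x u; first by rewrite uA orbT.
    by rewrite orbA.
  have dN : [disjoint Z :|: A & N].
    rewrite -setI_eq0; apply/eqP/setP => x; rewrite !inE.
    have [/inU xU|//] := boolP (x \in N); last by rewrite andbF.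
    rewrite andbT; apply/negbTE; rewrite negb_or; apply/andP; split.
      by apply/negP => /(disjointFr dZ); rewrite inE xU orbT.
    by apply/negP => /(disjointFr dA); rewrite xU.
  rewrite E1 cardsU (disjoint_setI0 dN) cards0 subn0.
  suff h : (touching X Z A + #|N| <= touching X (u |: Z) (A :\ u :|: N))%N.
    by rewrite (leq_trans (leq_add hT (leqnn #|N|))) // addnAC leq_add2r.
  rewrite cN /touching.
  set P := [set e in X | _]; set Q := [set [set u; v] | v in N].
  have dPQ : [disjoint P & Q].
    rewrite -setI_eq0; apply/eqP/setP => e; rewrite inE [RHS]inE.
    apply/negP => /andP[+ /imsetP[v vN E]]; rewrite inE => /and3P[_ h _].
    have : v \in Z :|: A by apply: (fintype.subsetP h); rewrite E !inE eqxx orbT.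
    by move/(disjointFr dN); rewrite vN.
  have -> : (#|P| + #|Q| = #|P :|: Q|)%N by rewrite cardsU (disjoint_setI0 dPQ) cards0 subn0.
  apply/subset_leq_card/fintype.subsetP => e; rewrite in_setU => /orP[].
    rewrite [e \in P]inE => /and3P[eX h1 h2]; rewrite inE eX E1 /=; apply/andP; split.
      by apply: fintype.subset_trans h1 (subsetUl _ _).
    apply: contra h2 => h2; apply/fintype.subsetP => x xe.
    have := fintype.subsetP h2 _ xe; rewrite inE => /orP[|xN]; first by rewrite inE => /andP[].
    by have := disjointFl dN xN; rewrite (fintype.subsetP h1).
  case/imsetP => v vN ->; rewrite inE E1 NX //=.
  rewrite !subUset !sub1set !inE eqxx uA vN !orbT /=; apply/negP => /andP[/inU].
  by rewrite (negbTE uU).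
(* The active set is exhausted: the old component is dropped and the invariant restarts with u as
   root, the +1 paying for u. *)
- rewrite A0 set0D set0U; set N := nbrs X u (U :\ u).
  have uN : u \notin N by rewrite !inE eqxx.
  have NX x : x \in N -> [set u; x] \in X by rewrite inE => /andP[].
  have cN : #|N| = #|[set [set u; v] | v in N]| by rewrite card_star ?inE ?eqxx.
  clearbody N.
  apply: (IH [set u]).
  + rewrite -setI_eq0; apply/eqP/setP => x; rewrite !inE; have [->|//] := eqVneq x u.
    by rewrite (negbTE uN).
  + by rewrite -setI_eq0; apply/eqP/setP => x; rewrite !inE; case: (x \in N); rewrite ?andbF.
  rewrite cardsU1 uN /= add1n addn1 ltnS cN.
  apply/subset_leq_card/fintype.subsetP => e /imsetP[v vN ->]; rewrite inE NX //=.
  by rewrite !subUset !sub1set !inE !eqxx vN orbT /= negb_and uN.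
Qed.

End Exploration.

(** * Drift of the exploration and mean number of surplus edges *)

Section ExplorationMean.
Context {R : realType} {n : nat}.
Implicit Types (X : graph n) (A U N : {set 'I_n}) (u v : 'I_n).
Variables (p : {set 'I_n} -> R) (f : 'I_n -> R) (q qm B r : R).
Hypotheses (n_gt0 : (0 < n)%N) (p_prob : prob_weights p).
Hypotheses (p_le : forall e, p e <= q / n%:R).
Hypotheses (p_ge : forall u v, u != v -> qm / n%:R <= p [set u; v]) (qm_ge0 : 0 <= qm).
Hypotheses (f_bounds : forall u, 1 <= f u <= B) (r_gt1 : 1 < r).
Hypotheses (f_growth : forall u, r * f u <= \sum_(v | v != u) p [set u; v] * f v).

Let mass A : R := \sum_(v in A) f v.

(** Pairs of active vertices have never been examined, so the edges among them come in addition to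
    those that discovered the vertices. *)
Definition fresh_edges k A U : R := EE p (fun X => (inner_edges X (explore k A U X))%:R).

Let n0 : 0 < n%:R :> R. Proof. by rewrite ltr0n. Qed.
Let p0 e : 0 <= p e. Proof. by case/andP: (p_prob e). Qed.
Let f1 u : 1 <= f u. Proof. by case/andP: (f_bounds u). Qed.
Let fB u : f u <= B. Proof. by case/andP: (f_bounds u). Qed.

Lemma inner_explore_depends k A U :
  depends_on (pairs_in (A :|: U)) (fun X => (inner_edges X (explore k A U X))%:R : R).
Proof.
move=> X; rewrite -explore_depends; congr (_%:R); apply: eq_card => e; rewrite !inE.
have [eS|_] := boolP (e \subset explore k A U X); last by rewrite !andbF.
by rewrite (fintype.subset_trans eS (explore_sub _ _ _ _)) !andbT.
Qed.

Lemma fresh_edges_step k A U u : next_vertex A U = Some u ->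
  fresh_edges k.+1 A U = EE p (fun X =>
    fresh_edges k (A :\ u :|: nbrs X u (U :\ u)) (U :\ u :\: nbrs X u (U :\ u))).
Proof.
move=> E; rewrite /fresh_edges /= E.
(* Deleting u from every candidate a makes [h a] independent of the pairs at u for all a, as
   [EE_cond] demands; the actual neighbourhood never contains u. *)
pose h (a : {set 'I_n}) X : R :=
  (inner_edges X (explore k (A :\ u :|: (a :\ u)) (U :\ u :\: (a :\ u)) X))%:R.
have Nu X : nbrs X u (U :\ u) :\ u = nbrs X u (U :\ u).
  by apply/setP => v; rewrite !inE; case: (v == u).
transitivity (EE p (fun X => h (nbrs X u (U :\ u)) X)).
  by apply: eq_EE => X; rewrite /h Nu.
rewrite (EE_cond p (J := [set e : {set 'I_n} | u \in e])).
- by apply: eq_EE => X; apply: eq_EE => Y; rewrite /h Nu.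
- by move=> X; apply/setP => v; rewrite !inE eqxx andbT.
- move=> a; apply: depends_onS (@inner_explore_depends k _ _).
  apply/fintype.subsetP => e; rewrite !inE => /fintype.subsetP h'; apply/negP => /h'.
  by rewrite !inE eqxx /= ?andbF.
Qed.

Lemma EE_mass_nbrs u U : u \notin U ->
  EE p (fun X => mass (nbrs X u U)) = \sum_(v in U) p [set u; v] * f v.
Proof.
move=> uU; transitivity (EE p (fun X => \sum_(v in U) f v * ([set u; v] \in X)%:R)); last first.
  by rewrite EE_sum; apply: eq_bigr => v _; rewrite EE_Z -/(Pr _ _) Pr_mem mulrC.
apply: eq_EE => X; rewrite /mass big_mkcond [RHS]big_mkcond; apply: eq_bigr => v _; rewrite inE.
by case: (v \in U) => //=; case: (_ \in X); rewrite ?mulr1 ?mulr0.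
Qed.

Lemma card_le_mass A : #|A|%:R <= mass A.
Proof.
by rewrite -sum1_card natr_sum; apply: ler_sum => v _; apply: f1.
Qed.

(** At most t + |A| vertices are no longer fresh, and each of them removes at most (q/n) B from the
    growth sum. *)
Lemma mean_discovered t A U u : (n <= t + #|A| + #|U|)%N ->
  r * f u - q * B / n%:R * (t%:R + #|A|%:R) <= \sum_(v in U :\ u) p [set u; v] * f v.
Proof.
move=> hn; have := f_growth u; rewrite (bigID (fun v => v \in U)) /=.
have -> : \sum_(v | (v != u) && (v \in U)) p [set u; v] * f v =
          \sum_(v in U :\ u) p [set u; v] * f v by apply: eq_bigl => v; rewrite !inE.
suff : \sum_(v | (v != u) && (v \notin U)) p [set u; v] * f v <= q * B / n%:R * (t%:R + #|A|%:R) by lra.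
have q0 : 0 <= q / n%:R by apply: le_trans (p0 set0) (p_le _).
have B1 : 1 <= B by apply: le_trans (f1 u) (fB u).
have qBn : 0 <= q * B / n%:R by rewrite mulrAC mulr_ge0 //; lra.
apply: (@le_trans _ _ (\sum_(v in ~: U) q * B / n%:R)).
  rewrite big_mkcond [leRHS]big_mkcond; apply: ler_sum => v _; rewrite inE.
  case: (v \in U); rewrite ?andbF //= andbT; case: (v != u) => //.
  by rewrite mulrAC ler_pM // ?p0 ?(le_trans _ (f1 v)).
rewrite sumr_const -[leLHS]mulr_natl mulrC ler_wpM2l // -natrD ler_nat.
by rewrite -(leq_add2r #|U|) addnC cardsC card_ord.
Qed.

Let rho : R := 1 - q * B / n%:R.
Let kappa : R := (r - 1) / 2.

(** Processing u loses at most f u and gains r f u on average. Of the correction, the part in |A| is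
    absorbed by rho because |A| <= mass A, and the part in t by half of r - 1. *)
Lemma mass_drift t A U u : next_vertex A U = Some u -> [disjoint A & U] ->
  (n <= t + #|A| + #|U|)%N -> q * B / n%:R * t%:R <= kappa ->
  rho * mass A + kappa <= EE p (fun X => mass (A :\ u :|: nbrs X u (U :\ u))).
Proof.
move=> E dA hn ht.
have -> : EE p (fun X => mass (A :\ u :|: nbrs X u (U :\ u))) =
    mass (A :\ u) + \sum_(v in U :\ u) p [set u; v] * f v.
  rewrite -EE_mass_nbrs ?inE ?eqxx // -[mass (A :\ u) in RHS](EE_cst p) -EE_D.
  apply: eq_EE => X; rewrite /mass -bigU /=; first by apply: eq_bigl => v; rewrite inE.
  rewrite -setI_eq0; apply/eqP/setP => v; rewrite !inE.
  by have [/(disjointFr dA)->|_] := boolP (v \in A); rewrite ?andbF.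
have := mean_discovered u hn; have fu := f1 u.
have q0 : 0 <= q / n%:R by apply: le_trans (p0 set0) (p_le _).
have B1 : 1 <= B by apply: le_trans (f1 u) (fB u).
have qBn : 0 <= q * B / n%:R by rewrite mulrAC mulr_ge0 //; lra.
have hc := card_le_mass A.
move: E; case: next_vertexP => // [w wA|w A0 _] [] E; subst w.
  have -> : mass (A :\ u) = mass A - f u by rewrite /mass (big_setD1 u wA) /= addrC addrK.
  rewrite /rho /kappa in ht *; set x := q * B / n%:R in ht qBn *.
  have : x * #|A|%:R <= x * mass A by rewrite ler_wpM2l.
  have : 0 <= (r - 1) * (f u - 1) by rewrite mulr_ge0 // subr_ge0 // ltW.
  move: ht hc; set S := \sum_(v in _) _; set M := mass A; set F := f u; lra.
rewrite /rho /kappa A0 /mass set0D !big_set0 cards0 in ht *.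
set x := q * B / n%:R in ht qBn *.
have : 0 <= (r - 1) * (f u - 1) by rewrite mulr_ge0 // subr_ge0 // ltW.
move: ht fu r_gt1; set S := \sum_(v in _) _; set F := f u; lra.
Qed.

Lemma EE_inner_edges_ge A : qm / (2 * n%:R) * (#|A|%:R ^+ 2 - #|A|%:R) <=
  EE p (fun X => (inner_edges X A)%:R).
Proof.
rewrite (eq_EE (g := fun X => \sum_(e : {set 'I_n} | e \subset A) (e \in X)%:R)); last first.
  move=> X; rewrite /inner_edges -sum1_card natr_sum big_mkcond [RHS]big_mkcond.
  by apply: eq_bigr => e _; rewrite inE andbC; case: (_ \subset _) => //; case: (_ \in _).
rewrite EE_sum (eq_bigr p); last by move=> e _; rewrite -/(Pr _ _) Pr_mem.
apply: (@le_trans _ _ (\sum_(e in edges n) (if e \subset A then p e else 0))).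
  rewrite -(ler_pM2l (x := 2)) // [leRHS]mulr_natl -sum_ordered_pairs.
  apply: (@le_trans _ _ (\sum_(u in A) \sum_(v in A :\ u) qm / n%:R)).
    rewrite (eq_bigr (fun=> (#|A|%:R - 1) * (qm / n%:R))) => [|u uA]; last first.
      by rewrite sumr_const -[LHS]mulr_natl (cardsD1 u A) uA natrD addrC addKr.
    rewrite sumr_const -[leRHS]mulr_natl le_eqVlt; apply/orP; left; apply/eqP.
    by field; rewrite gt_eqF.
  rewrite [leLHS]big_mkcond; apply: ler_sum => u _.
  rewrite [leRHS]big_mkcond; case: (boolP (u \in A)) => uA; last first.
    by apply: sumr_ge0 => v _; case: ifP => // _; case: ifP.
  rewrite [leLHS]big_mkcond; apply: ler_sum => v _; rewrite !inE subUset !sub1set uA /=.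
  have [->|vu] /= := eqVneq v u; first by rewrite ?eqxx.
  by case: (v \in A) => //; apply: p_ge; rewrite eq_sym.
rewrite -big_mkcondr [leRHS](bigID (fun e => e \in edges n)) /= -[leLHS]addr0; apply: lerD; last by apply: sumr_ge0.
by rewrite le_eqVlt; apply/orP; left; apply/eqP; apply: eq_bigl => e; rewrite andbC.
Qed.

Section Recursion.
Variables (T : nat) (b : R).
Hypotheses (T_le : (T <= n)%N) (T_kappa : q * B / n%:R * T%:R <= kappa).
Hypotheses (rho_ge0 : 0 <= rho) (b_ge : 1 <= 2 * b).

Let a : R := qm / (2 * n%:R) * ((2 * b - 1) / B).
Let d : R := qm / (2 * n%:R) * b ^+ 2.

(** The final count is quadratic in the active set, while only the mean mass is controlled. The
    square is therefore replaced by its tangent 2b|A| - b^2, a bound linear in the mass that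
    propagates backwards through the steps. *)
Lemma fresh_edges_ge k t A U : [disjoint A & U] -> (n <= t + #|A| + #|U|)%N -> (t + k <= T)%N ->
  a * (rho ^+ k * mass A + kappa * \sum_(j < k) rho ^+ j) - d <= fresh_edges k A U.
Proof.
have B1 : 1 <= B.
  by have v : 'I_n := Ordinal n_gt0; apply: le_trans (f1 v) (fB v).
have c0 : 0 <= qm / (2 * n%:R) by rewrite divr_ge0 // mulr_ge0 // ltW.
have a0 : 0 <= a by rewrite mulr_ge0 // divr_ge0 ?subr_ge0 // (le_trans ler01 B1).
elim: k t A U => [|k IH] t A U dA hn hk.
  rewrite expr0 mul1r big_ord0 mulr0 addr0; apply: le_trans (EE_inner_edges_ge A).
  rewrite /a /d -mulrA -mulrBr ler_wpM2l //.
  have mB : mass A <= B * #|A|%:R.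
    rewrite /mass -sum1_card natr_sum mulr_sumr; apply: ler_sum => v _; rewrite mulr1; exact: fB.
  apply: (@le_trans _ _ ((2 * b - 1) * #|A|%:R - b ^+ 2)); last first.
    have := sqr_ge0 (#|A|%:R - b); nra.
  by rewrite lerD2r -mulrA ler_wpM2l ?subr_ge0 // mulrC ler_pdivrMr ?(lt_le_trans _ B1) // mulrC.
case E : (next_vertex A U) => [u|]; last first.
  (* At most T <= n steps are made, so unseen vertices cannot have run out yet. *)
  exfalso; move: E; case: next_vertexP => // [[A0 U0]] _.
  move: hn; rewrite A0 U0 cards0 !addn0 => hn.
  by have := leq_trans hk (leq_trans T_le hn); rewrite addnS ltnNge leq_addr.
have ht : q * B / n%:R * t%:R <= kappa.
  apply: le_trans T_kappa; rewrite ler_wpM2l ?ler_nat ?(leq_trans _ hk) ?leq_addr //.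
  have q0 : 0 <= q / n%:R by apply: le_trans (p0 set0) (p_le _).
  by rewrite mulrAC mulr_ge0 //; lra.
rewrite (fresh_edges_step _ E).
have drift := mass_drift E dA hn ht.
have dA' X x : x \in nbrs X u (U :\ u) -> [/\ x != u, x \in U & x \notin A].
  rewrite !inE => /andP[/andP[xu xU] _]; split => //.
  by apply/negP => /(disjointFr dA); rewrite xU.
have uAU : (u \in A) || (u \in U).
  by move: E; case: next_vertexP => // [w wA|w _ wU] [<-]; rewrite ?wA ?wU ?orbT.
have stepk X : a * (rho ^+ k * mass (A :\ u :|: nbrs X u (U :\ u)) + kappa * \sum_(j < k) rho ^+ j) - d <=
    fresh_edges k (A :\ u :|: nbrs X u (U :\ u)) (U :\ u :\: nbrs X u (U :\ u)).
  set N := nbrs X u (U :\ u).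
  have dis : [disjoint A :\ u :|: N & U :\ u :\: N].
    rewrite -setI_eq0; apply/eqP/setP => x; rewrite inE [x \in _ :\: _]inE [x \in _ :|: _]inE [RHS]inE.
    have [xN|xN] := boolP (x \in N); first by rewrite andbF.
    rewrite orbF /= !inE; case: (x == u) => //=.
    by have [/(disjointFr dA)->|] := boolP (x \in A).
  apply: (IH t.+1) => //; last by rewrite addSnnS.
  have cU : (A :\ u :|: N) :|: (U :\ u :\: N) = (A :|: U) :\ u.
    apply/setP => x; rewrite inE [x \in _ :\: _]inE [x \in _ :|: _]inE.
    have [/dA'[/negbTE xu xU _]|xN] := boolP (x \in N); first by rewrite orbT !inE xu xU orbT.
    by rewrite /= orbF !inE; case: (x == u).
  have : (#|A :\ u :|: N| + #|U :\ u :\: N| = #|(A :|: U) :\ u|)%N.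
    by rewrite -cU [RHS]cardsU (disjoint_setI0 dis) cards0 subn0.
  have : (#|A :|: U| = #|A| + #|U|)%N by rewrite cardsU (disjoint_setI0 dA) cards0 subn0.
  rewrite (cardsD1 u (A :|: U)) inE uAU add1n => h1 h2.
  by rewrite -addnA h2 addSnnS h1 addnA.
apply: le_trans (EE_le p_prob stepk).
rewrite EE_B EE_cst EE_Z EE_D EE_Z EE_cst lerD2r ler_wpM2l // big_ord_recr /=.
apply: (@le_trans _ _ (rho ^+ k * (rho * mass A + kappa) + kappa * \sum_(j < k) rho ^+ j)).
  rewrite exprS le_eqVlt; apply/orP; left; apply/eqP; ring.
by rewrite lerD2r ler_wpM2l // exprn_ge0.
Qed.

(** By Bernoulli's inequality rho^j >= 1 - xj >= 1/2 throughout the T steps, so the drift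
    accumulates to at least kappa T/2. *)
Lemma fresh_edges_total : q * B / n%:R * T%:R <= 2^-1 ->
  a * (kappa * (T%:R / 2)) - d <= fresh_edges T set0 setT.
Proof.
move=> hT.
have B1 : 1 <= B.
  by have v : 'I_n := Ordinal n_gt0; apply: le_trans (f1 v) (fB v).
have c0 : 0 <= qm / (2 * n%:R) by rewrite divr_ge0 // mulr_ge0 // ltW.
have a0 : 0 <= a by rewrite mulr_ge0 // divr_ge0 ?subr_ge0 // (le_trans ler01 B1).
have := @fresh_edges_ge T 0 set0 setT.
rewrite disjoint_sym disjoints_subset setC0 subsetT cards0 cardsT card_ord !add0n.
move=> /(_ isT (leqnn _) (leqnn _)); apply: le_trans.
rewrite lerD2r ler_wpM2l // /mass big_set0 mulr0 add0r ler_wpM2l //; first by rewrite /kappa divr_ge0 ?subr_ge0 ?(ltW r_gt1).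
set x := q * B / n%:R in hT *.
have x0 : 0 <= x.
  have q0 : 0 <= q / n%:R by apply: le_trans (p0 set0) (p_le _).
  by rewrite /x mulrAC mulr_ge0 //; lra.
have bern j : 1 - x * j%:R <= rho ^+ j.
  elim: j => [|j IH]; first by rewrite mulr0 subr0.
  apply: (@le_trans _ _ (rho * (1 - x * j%:R))); last by rewrite exprS ler_wpM2l.
  rewrite -natr1 /rho -/x; have := ler0n R j; nra.
apply: (@le_trans _ _ (\sum_(j < T) 2^-1)).
  by rewrite sumr_const card_ord -[leRHS]mulr_natl.
apply: ler_sum => j _; apply: le_trans (bern j).
have : x * j%:R <= x * T%:R by rewrite ler_wpM2l // ler_nat ltnW.
lra.
Qed.

End Recursion.

End ExplorationMean.

Lemma fresh_edges_linear (R : realType) (q qm B r : R) : 0 < q -> 0 < qm -> 1 <= B -> 1 < r ->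
  exists2 k0 : R, 0 < k0 & exists a0 : R, forall n (p : {set 'I_n} -> R) (f : 'I_n -> R),
    a0 <= n%:R -> prob_weights p -> (forall e, p e <= q / n%:R) ->
    (forall u v, u != v -> qm / n%:R <= p [set u; v]) ->
    (forall u, 1 <= f u <= B) ->
    (forall u, r * f u <= \sum_(v | v != u) p [set u; v] * f v) ->
    exists T, k0 * n%:R <= fresh_edges p T set0 setT.
Proof.
move=> q0 m0 B1 r1; have B0 : 0 < B by lra.
pose kappa : R := (r - 1) / 2; have k0 : 0 < kappa by rewrite /kappa; lra.
(* Fraction of the vertices explored: small enough to keep both the loss of drift and the decay of
   rho^j under control. *)
pose c1 : R := Num.min 1 (Num.min (2^-1 / (q * B)) (kappa / (q * B))).
have qB0 : 0 < q * B by rewrite mulr_gt0.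
have c10 : 0 < c1.
  by rewrite !lt_min ltr01; apply/andP; split => //; apply/andP; split; apply: divr_gt0.
have c1a : c1 <= 1 by rewrite ge_min lexx.
have c1b : q * B * c1 <= 2^-1 by rewrite mulrC -ler_pdivlMr // !ge_min lexx !orbT.
have c1c : q * B * c1 <= kappa by rewrite mulrC -ler_pdivlMr // !ge_min lexx !orbT.
(* The tangent point is b = beta n. This beta maximises the resulting bound, proportional to 2 beta
   (kappa c1 / (8B)) - beta^2. *)
pose beta : R := kappa * c1 / (8 * B).
have be0 : 0 < beta by apply: divr_gt0; apply: mulr_gt0.
exists (qm * beta ^+ 2 / 2); first by apply: divr_gt0 => //; apply: mulr_gt0 => //; apply: exprn_gt0.
exists (Num.max 1 (Num.max (2 / c1) (beta^-1))) => n p f.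
rewrite !ge_max => /and3P[n1 n2 n3] hp pq pm f1 fr.
have n0 : 0 < n%:R :> R by lra.
have n0' : (0 < n)%N by rewrite -(ltr0n R).
have c1n : 0 <= c1 * n%:R by rewrite mulr_ge0 // ltW.
pose T := Num.truncn (c1 * n%:R).
have /andP[T1 T2] := truncn_itv c1n.
rewrite -/T in T1 T2.
have Tn : (T <= n)%N by rewrite -(ler_nat R); apply: le_trans T1 _; rewrite ler_piMl // ltW.
have TqB : q * B / n%:R * T%:R <= q * B * c1.
  rewrite mulrAC ler_pdivrMr // -[leRHS]mulrA ler_wpM2l // ltW //.
have Tge : c1 * n%:R / 2 <= T%:R.
  have : 2 <= c1 * n%:R by rewrite mulrC -ler_pdivrMr.
  by move: T2; rewrite -natr1; lra.
have bn1 : 1 <= beta * n%:R by rewrite -ler_pdivrMl // mulr1.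
exists T.
have := @fresh_edges_total R n p f q qm B r n0' hp pq pm (ltW m0) f1 r1 fr T (beta * n%:R) Tn
  (le_trans TqB c1c).
have rho0 : 0 <= 1 - q * B / n%:R.
  have [T0|Tpos] := posnP T.
    exfalso; move: Tge; rewrite T0; have := mulr_gt0 c10 n0; lra.
  have : q * B / n%:R * 1 <= q * B / n%:R * T%:R.
    by rewrite ler_wpM2l ?ler1n // divr_ge0 // ltW.
  lra.
have bge : 1 <= 2 * (beta * n%:R) by lra.
move=> /(_ rho0 bge (le_trans TqB c1b)); apply: le_trans.
rewrite -/kappa.
apply: (@le_trans _ _ (qm / (2 * n%:R) * (beta * n%:R / B) * (kappa * (c1 * n%:R / 2 / 2)) -
    qm / (2 * n%:R) * (beta * n%:R) ^+ 2)).
  rewrite le_eqVlt; apply/orP; left; apply/eqP.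
  rewrite {2}/beta; rewrite {1}/beta expr2 {1}/beta; field; by rewrite !gt_eqF.
have c0 : 0 < qm / (2 * n%:R) by rewrite divr_gt0 // mulr_gt0.
rewrite lerD2r ler_pM //.
- exact: (mulr_ge0 (ltW c0) (divr_ge0 (mulr_ge0 (ltW be0) (ltW n0)) (ltW B0))).
- by apply: mulr_ge0; [exact: ltW k0|apply: divr_ge0 => //; apply: divr_ge0].
- rewrite ler_wpM2l ?(ltW c0) // ler_wpM2r ?invr_ge0 ?(ltW B0) //; lra.
- by rewrite ler_wpM2l ?(ltW k0) // ler_wpM2r // invr_ge0.
Qed.

(** * Concentration of the excess and the dense core *)

Section Excess.
Context {R : realType} {n : nat}.
Implicit Types (X : graph n) (S : {set 'I_n}) (e : {set 'I_n}) (u v : 'I_n).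
Variable M : R.

Definition overdegree X v : R := Num.max 0 ((degree X v)%:R - M).

Definition excess_on X S : R :=
  (inner_edges X S)%:R - #|S|%:R - \sum_(v in S) overdegree X v.

(* The degree penalty makes the excess witness many vertices of large load. *)
Definition excess X : R := \big[Num.max/0]_(S : {set 'I_n}) excess_on X S.

Lemma excess_on_le X S : excess_on X S <= excess X.
Proof. exact: le_bigmax. Qed.

Lemma inner_edgesU1 e X S : (inner_edges (e |: X) S <= inner_edges (X :\ e) S + 1)%N.
Proof.
rewrite addn1 /inner_edges.
apply: leq_trans (_ : #|e |: [set e0 in X :\ e | e0 \subset S]| <= _)%N; last first.
  by rewrite cardsU1; case: (_ \notin _); rewrite // add0n leqW.
apply/subset_leq_card/fintype.subsetP => x; rewrite !inE.
by case: (x == e) => //=; case: (x \in X).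
Qed.

Lemma inner_edges_mono X X' S : X \subset X' -> (inner_edges X S <= inner_edges X' S)%N.
Proof.
move=> XX; apply/subset_leq_card/fintype.subsetP => e; rewrite !inE => /andP[/(fintype.subsetP XX)-> ->].
by [].
Qed.

Lemma degree_mono X X' v : X \subset X' -> (degree X v <= degree X' v)%N.
Proof.
move=> XX; apply/subset_leq_card/fintype.subsetP => u; rewrite !inE; exact: adj_sub.
Qed.

Lemma degreeU1 e X v : (degree (e |: X) v <=
  degree (X :\ e) v + \sum_(u | v != u) ([set v; u] == e))%N.
Proof.
rewrite /degree.
have -> : (\sum_(u | v != u) ([set v; u] == e) = #|[set u | (v != u) && ([set v; u] == e)]|)%N.
  rewrite -sum1_card big_mkcond [RHS]big_mkcond; apply: eq_bigr => u _; rewrite inE.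
  by case: (v != u) => //=; case: (_ == e).
apply: leq_trans (leq_card_setU _ _); apply/subset_leq_card/fintype.subsetP => u.
rewrite !inE /adj !inE (eq_sym v u) (setUC [set v]).
by case: (u != v); case: ([set u; v] == e); case: ([set u; v] \in X).
Qed.

Lemma sum_incident e : (\sum_(v : 'I_n) \sum_(u : 'I_n | v != u) ([set v; u] == e) <= 2)%N.
Proof.
rewrite (sum_ordered_pairs (fun x => ((x == e) : nat))).
have : (\sum_(x in edges n) (x == e) <= 1)%N.
  rewrite big_mkcond (bigD1 e) //= big1 ?addn0; first by rewrite eqxx; case: ifP.
  by move=> x /negbTE ->; case: ifP.
by rewrite mulr2n => h; rewrite (leq_add h h).
Qed.

(** An added edge raises the inner edge count by at most 1, and the degree penalty by at most 1 at
    each of its two endpoints. *)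
Lemma excess_lipschitz : lipschitz 2 excess.
Proof.
move=> e X.
have sub : X :\ e \subset e |: X.
  by apply: fintype.subset_trans (subD1set _ _) (subsetUr _ _).
have od v : overdegree (X :\ e) v <= overdegree (e |: X) v <=
    overdegree (X :\ e) v + (\sum_(u | v != u) ([set v; u] == e))%:R.
  have h1 : (degree (X :\ e) v)%:R <= (degree (e |: X) v)%:R :> R by rewrite ler_nat degree_mono.
  have h2 : (degree (e |: X) v)%:R <= (degree (X :\ e) v)%:R +
      (\sum_(u | v != u) ([set v; u] == e))%:R :> R by rewrite -natrD ler_nat degreeU1.
  have h3 : 0 <= (\sum_(u | v != u) ([set v; u] == e))%:R :> R by rewrite ler0n.
  rewrite /overdegree; apply/andP; split.
    by rewrite ge_max !le_max lexx /=; apply/orP; right; lra.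
  rewrite ge_max; apply/andP; split; first by rewrite addr_ge0 // le_max lexx.
  have : (degree (X :\ e) v)%:R - M <= Num.max 0 ((degree (X :\ e) v)%:R - M) by rewrite le_max lexx orbT.
  lra.
have up S : excess_on (e |: X) S <= excess_on (X :\ e) S + 2.
  have : \sum_(v in S) overdegree (X :\ e) v <= \sum_(v in S) overdegree (e |: X) v.
    by apply: ler_sum => v _; case/andP: (od v).
  have : (inner_edges (e |: X) S)%:R <= (inner_edges (X :\ e) S)%:R + 1 :> R.
    by rewrite -[1]/(1%:R) -natrD ler_nat inner_edgesU1.
  rewrite /excess_on; lra.
have dn S : excess_on (X :\ e) S <= excess_on (e |: X) S + 2.
  have : \sum_(v in S) overdegree (e |: X) v <= \sum_(v in S) overdegree (X :\ e) v + 2.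
    apply: (@le_trans _ _ (\sum_(v in S) (overdegree (X :\ e) v + (\sum_(u | v != u) ([set v; u] == e))%:R))).
      by apply: ler_sum => v _; case/andP: (od v).
    rewrite big_split /= lerD2l -natr_sum ler_nat; apply: leq_trans (sum_incident e).
    by rewrite [leqRHS](bigID (fun v => v \in S)) /= leq_addr.
  have : (inner_edges (X :\ e) S)%:R <= (inner_edges (e |: X) S)%:R :> R by rewrite ler_nat inner_edges_mono.
  rewrite /excess_on; lra.
have ge0 Y : 0 <= excess Y by apply: bigmax_ge_id.
rewrite ler_norml; apply/andP; split.
  suff : excess (X :\ e) <= excess (e |: X) + 2 by lra.
  apply: bigmax_le => [|S _]; first by rewrite addr_ge0.
  by apply: le_trans (dn S) _; rewrite lerD2r excess_on_le.
suff : excess (e |: X) <= excess (X :\ e) + 2 by lra.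
apply: bigmax_le => [|S _]; first by rewrite addr_ge0.
by apply: le_trans (up S) _; rewrite lerD2r excess_on_le.
Qed.

Lemma excess_explore T X :
  (inner_edges X (explore T set0 setT X))%:R - 1 - \sum_v overdegree X v <= excess X.
Proof.
have [||| S hS] := @explore_excess n T X set0 set0 setT.
- by rewrite disjoint_sym disjoints_subset setC0 subsetT.
- by rewrite disjoint_sym disjoints_subset setC0 subsetT.
- by rewrite setU0 cards0.
apply: le_trans (excess_on_le X S); rewrite /excess_on.
have : \sum_(v in S) overdegree X v <= \sum_v overdegree X v.
  rewrite [leRHS](bigID (fun v => v \in S)) /= lerDl sumr_ge0 // => v _.
  by rewrite /overdegree le_max lexx.
have : #|S|%:R + (inner_edges X (explore T set0 setT X))%:R <= (inner_edges X S)%:R + 1 :> R.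
  by rewrite -[1]/(1%:R) -!natrD ler_nat.
lra.
Qed.

(** The penalty times M is at most the squared degree, whose mean is bounded by q + q^2 on expanding
    over pairs of neighbours. *)
Lemma EE_overdegree (p : {set 'I_n} -> R) (q : R) v : prob_weights p -> 0 < M -> (0 < n)%N ->
  (forall e, p e <= q / n%:R) -> EE p (fun X => overdegree X v) <= (q + q ^+ 2) / M.
Proof.
move=> hp M0 n0' hq; have n0 : 0 < n%:R :> R by rewrite ltr0n.
have p0 e : 0 <= p e by case/andP: (hp e).
rewrite ler_pdivlMr // mulrC -EE_Z.
apply: (@le_trans _ _ (EE p (fun X => \sum_u \sum_u' (adj X u v)%:R * (adj X u' v)%:R))).
  apply: EE_le => // X; rewrite -big_distrlr /= -natr_sum.
  have -> : (\sum_u adj X u v = degree X v)%N.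
    by rewrite /degree -sum1_card [RHS]big_mkcond; apply: eq_bigr => u _; rewrite inE; case: adj.
  set x := (degree X v)%:R; have x0 : 0 <= x by rewrite ler0n.
  rewrite /overdegree -/x; case: (leP (x - M) 0) => h.
    by rewrite mulr0 mulr_ge0.
  have : M * (x - M) <= M * x by rewrite ler_wpM2l ?(ltW M0) // gerBl ltW.
  have : M * x <= x * x by rewrite ler_wpM2r //; lra.
  lra.
rewrite EE_sum; under eq_bigr do rewrite EE_sum.
have pair u u' : EE p (fun X => (adj X u v)%:R * (adj X u' v)%:R) <=
    (u == u')%:R * (q / n%:R) + (q / n%:R) ^+ 2.
  have [uv|uv] := boolP (u != v); last first.
    rewrite (eq_EE (g := fun=> 0)) ?EE_cst => [|X]; last by rewrite /adj (negbTE uv) mul0r.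
    by rewrite addr_ge0 ?sqr_ge0 // mulr_ge0 // (le_trans (p0 set0)).
  have [u'v|u'v] := boolP (u' != v); last first.
    rewrite (eq_EE (g := fun=> 0)) ?EE_cst => [|X]; last by rewrite /adj (negbTE u'v) mulr0.
    by rewrite addr_ge0 ?sqr_ge0 // mulr_ge0 // (le_trans (p0 set0)).
  have -> : EE p (fun X => (adj X u v)%:R * (adj X u' v)%:R) =
            Pr p (fun X => [set [set u; v]; [set u'; v]] \subset X).
    by apply: eq_EE => X; rewrite /adj uv u'v subUset !sub1set /= -natrM mulnb.
  rewrite Pr_subset; have [<-|uu'] := eqVneq u u'.
    by rewrite setUid big_set1 mul1r -[leLHS]addr0 lerD ?sqr_ge0.
  rewrite big_setU1 /= ?inE; last first.
    apply: contra uu' => /eqP E; have : u \in [set u'; v] by rewrite -E !inE eqxx.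
    by rewrite !inE (negbTE uv) orbF.
  by rewrite big_set1 mul0r add0r expr2 ler_pM.
apply: (@le_trans _ _ (\sum_(u : 'I_n) \sum_(u' : 'I_n) ((u == u')%:R * (q / n%:R) + (q / n%:R) ^+ 2))).
  by apply: ler_sum => u _; apply: ler_sum => u' _; apply: pair.
rewrite (eq_bigr (fun=> q / n%:R + n%:R * (q / n%:R) ^+ 2)) => [|u _]; last first.
  rewrite big_split /= sumr_const card_ord mulr_natl; congr (_ + _).
  rewrite (bigD1 u) //= eqxx mul1r big1 ?addr0 // => u'.
  by rewrite eq_sym => /negbTE->; rewrite mul0r.
rewrite sumr_const card_ord -[leLHS]mulr_natl le_eqVlt; apply/orP; left; apply/eqP.
by field; rewrite gt_eqF.
Qed.

(** In a set achieving the excess, a vertex contributes at most its load minus 1 minus its penalty.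
    This is below delta at low load, and at most M otherwise since the load is at most the
    degree. *)
Lemma excess_large_load (delta k0 : R) X : 0 <= M -> 0 <= delta -> 0 <= k0 ->
  X \subset edges n -> k0 < excess X ->
  k0 <= delta * n%:R + M * #|[set v | 1 + delta <= balanced_load (R := R) X v]|%:R.
Proof.
move=> M0 d0 k00 Xn hk.
have [S hS] : exists S, k0 < excess_on X S.
  apply: contrapT => h; move: hk; apply/negP; rewrite -leNgt.
  apply: bigmax_le => // S _; rewrite leNgt; apply/negP => hS; by apply: h; exists S.
apply: le_trans (ltW hS) _.
set w := balanced_load (R := R) X.
apply: (@le_trans _ _ (\sum_(v in S) (w v - 1 - overdegree X v))).
  have := inner_edges_le_load (R := R) S Xn.
  by rewrite !sumrB sumr_const /excess_on -/w; lra.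
apply: (@le_trans _ _ (\sum_(v : 'I_n) (delta + M * (1 + delta <= w v)%R%:R))); last first.
  rewrite big_split /= sumr_const card_ord -[X in X + _ <= _]mulr_natr lerD2l -mulr_sumr -natr_sum.
  rewrite ler_wpM2l // ler_nat -sum1_card [leqRHS]big_mkcond.
  by apply: leq_sum => v _; rewrite inE; case: ifP.
rewrite big_mkcond; apply: ler_sum => v _.
have o0 : 0 <= overdegree X v by rewrite le_max lexx.
case: ifP => _; last by rewrite addr_ge0 // mulr_ge0.
have : (degree X v)%:R - M <= overdegree X v by rewrite le_max lexx orbT.
have := balanced_load_le_degree (R := R) X v; rewrite -/w.
case: (leP (1 + delta) (w v)) => h /=; rewrite ?mulr1 ?mulr0; lra.
Qed.

End Excess.

Lemma dense_core (R : realType) (q qm B r : R) : 0 < q -> 0 < qm -> 1 <= B -> 1 < r ->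
  exists delta c : R, [/\ 0 < delta, 0 < c & forall eta, 0 < eta ->
    exists a0 : R, forall n (p : {set 'I_n} -> R) (f : 'I_n -> R),
    a0 <= n%:R -> prob_weights p -> (forall e, e \notin edges n -> p e = 0) ->
    (forall e, p e <= q / n%:R) ->
    (forall u v, u != v -> qm / n%:R <= p [set u; v]) ->
    (forall u, 1 <= f u <= B) ->
    (forall u, r * f u <= \sum_(v | v != u) p [set u; v] * f v) ->
    Pr p (fun X => (X \subset edges n) &&
      ~~ (c * n%:R <= #|[set v | 1 + delta <= balanced_load (R := R) X v]|%:R)) <= eta].
Proof.
move=> q0 m0 B1 r1; have [k0 k00 [a0 ha0]] := fresh_edges_linear q0 m0 B1 r1.
have qq : 0 < q + q ^+ 2 by rewrite addr_gt0 // exprn_gt0.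
(* This M limits the mean penalty to k0 n/4, leaving a mean excess of at least k0 n/2. A deviation
   k0 n/4 is allowed, and the remaining k0 n/4 exceeds delta n + M c n once delta and M c are both
   k0/8 and the set has fewer than cn vertices. *)
pose M := 4 * (q + q ^+ 2) / k0.
have M0 : 0 < M by apply: divr_gt0 => //; apply: mulr_gt0.
exists (k0 / 8), (k0 / (8 * M)); split; [exact: divr_gt0|by apply: divr_gt0 => //; apply: mulr_gt0|].
move=> eta eta0; exists (Num.max a0 (Num.max 1 (Num.max (4 / k0) (64 * q / (k0 ^+ 2 * eta))))).
move=> n p f; rewrite !ge_max => /and4P[na n1 n4 n64] hp hs hq hm hf hg.
have n0 : 0 < n%:R :> R by lra.
have n0' : (0 < n)%N by rewrite -(ltr0n R).
have [T hT] := ha0 n p f na hp hq hm hf hg.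
have mean : k0 * n%:R / 2 <= EE p (excess M).
  have h1 : fresh_edges p T set0 setT - 1 - n%:R * ((q + q ^+ 2) / M) <= EE p (excess M).
    apply: le_trans (EE_le hp (excess_explore M T)).
    rewrite !EE_B EE_cst EE_sum lerD2l lerN2.
    apply: (@le_trans _ _ (\sum_(v : 'I_n) (q + q ^+ 2) / M)).
      by apply: ler_sum => v _; apply: EE_overdegree.
    by rewrite sumr_const card_ord -[leLHS]mulr_natl.
  have h2 : (q + q ^+ 2) / M = k0 / 4 by rewrite /M; field; rewrite !gt_eqF.
  have h3 : 4 <= n%:R * k0 by rewrite -ler_pdivrMr.
  rewrite h2 in h1; lra.
have sp : \sum_e p e <= q * n%:R.
  rewrite (bigID (fun e => e \in edges n)) /= [X in _ + X]big1 ?addr0; last by move=> e; exact: hs.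
  apply: (@le_trans _ _ (\sum_(e in edges n) q / n%:R)); first exact: ler_sum.
  rewrite sumr_const -[leLHS]mulr_natl.
  apply: (@le_trans _ _ ((n ^ 2)%:R * (q / n%:R))).
    by rewrite ler_wpM2r ?ler_nat ?card_edges_le // divr_ge0 // ltW.
  by rewrite natrX le_eqVlt; apply/orP; left; apply/eqP; field; rewrite gt_eqF.
have t0 : 0 < k0 * n%:R / 4 by rewrite divr_gt0 // mulr_gt0.
apply: (@le_trans _ _ (2 ^+ 2 * (\sum_e p e) / (k0 * n%:R / 4) ^+ 2)); last first.
  rewrite ler_pdivrMr ?exprn_gt0 //.
  apply: (@le_trans _ _ (2 ^+ 2 * (q * n%:R))); first by rewrite ler_wpM2l.
  have : 64 * q <= n%:R * (k0 ^+ 2 * eta) by rewrite -ler_pdivrMr // mulr_gt0 // exprn_gt0.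
  move=> h; rewrite (_ : eta * _ = n%:R * (k0 ^+ 2 * eta) * n%:R / 16); last by field.
  have : 64 * q * n%:R <= n%:R * (k0 ^+ 2 * eta) * n%:R by rewrite ler_wpM2r // ltW.
  lra.
apply: le_trans (Pr_chebyshev hp (@excess_lipschitz R n M) t0).
apply: Pr_le => // X /andP[Xn]; rewrite -ltNge => hlt; rewrite leNgt; apply/negP => hex.
have hex' : k0 * n%:R / 4 < excess M X by lra.
have := @excess_large_load R n M (k0 / 8) _ X (ltW M0) _ (ltW t0) Xn hex'.
move=> /(_ (divr_ge0 (ltW k00) (ler0n R 8))).
set D := #|_|%:R in hlt *.
have : M * D < M * (k0 / (8 * M) * n%:R) by rewrite ltr_pM2l.
have -> : M * (k0 / (8 * M) * n%:R) = k0 * n%:R / 8 by field; rewrite gt_eqF.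
lra.
Qed.

(** * Joint law of the two subsampled graphs *)

Section PairLaw.
Context {R : realType} {I : finType}.
Variables (p : I -> R) (s : R).
Implicit Types (k J : {set I}).

(* Joint law of the presence of an edge in the two subsampled graphs. *)
Definition pair_mass (x : R) (b1 b2 : bool) : R :=
  if b1 then (if b2 then x * s ^+ 2 else x * (s * (1 - s)))
  else (if b2 then x * (s * (1 - s)) else 1 - x + x * (1 - s) ^+ 2).

Definition pair_wt (k1 k2 : {set I}) : R := \prod_e pair_mass (p e) (e \in k1) (e \in k2).

Hypotheses (p_prob : prob_weights p) (s_ge0 : 0 <= s) (s_le1 : s <= 1).

Lemma pair_mass_ge0 x b1 b2 : 0 <= x <= 1 -> 0 <= pair_mass x b1 b2.
Proof.
move=> /andP[x0 x1]; have s1 : 0 <= 1 - s by rewrite subr_ge0.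
have x1' : 0 <= 1 - x by rewrite subr_ge0.
case: b1; case: b2; rewrite /pair_mass; try by rewrite !mulr_ge0 ?exprn_ge0.
by apply: addr_ge0 => //; rewrite mulr_ge0 ?exprn_ge0.
Qed.

Lemma pair_wt_ge0 k1 k2 : 0 <= pair_wt k1 k2.
Proof. by apply: prodr_ge0 => e _; apply: pair_mass_ge0. Qed.

Lemma sum_pair_prod (F : I -> bool -> bool -> R) :
  \sum_(k1 : {set I}) \sum_(k2 : {set I}) \prod_e F e (e \in k1) (e \in k2) =
  \prod_e (F e true true + F e true false + (F e false true + F e false false)).
Proof.
rewrite (eq_bigr (fun k1 : {set I} => \prod_e (if e \in k1 then F e true true + F e true false
    else F e false true + F e false false))); first by rewrite sum_set_prod.
move=> k1 _; rewrite (eq_bigr (fun k2 : {set I} => \prod_e (if e \in k2 then F e (e \in k1) true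
    else F e (e \in k1) false))).
  by rewrite sum_set_prod; apply: eq_bigr => e _; case: (e \in k1).
by move=> k2 _; apply: eq_bigr => e _; case: (e \in k2).
Qed.

Lemma pair_wt_meet J :
  \sum_(k1 : {set I}) \sum_(k2 : {set I}) (k1 :&: k2 == J)%:R * pair_wt k1 k2 = wt (fun e => s ^+ 2 * p e) J.
Proof.
rewrite (eq_bigr (fun k1 : {set I} => \sum_(k2 : {set I}) \prod_e
   (((e \in k1) && (e \in k2) == (e \in J))%:R * pair_mass (p e) (e \in k1) (e \in k2)))).
  rewrite (sum_pair_prod (fun e b1 b2 => (b1 && b2 == (e \in J))%:R * pair_mass (p e) b1 b2)) /=.
  by apply: eq_bigr => e _; case: (e \in J); rewrite /= ?mul1r ?mul0r /pair_mass; ring.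
move=> k1 _; apply: eq_bigr => k2 _; have [<-|kJ] := eqVneq (k1 :&: k2) J.
  by rewrite mul1r; apply: eq_bigr => e _; rewrite inE eqxx mul1r.
rewrite mul0r; have [e he] : exists e, (e \in k1) && (e \in k2) != (e \in J).
  apply/existsP; apply: contraR kJ; rewrite negb_exists => /forallP h.
  by apply/eqP/setP => e; have := h e; rewrite negbK inE => /eqP.
by rewrite (bigD1 e) //= (negbTE he) !mul0r.
Qed.

Lemma pair_sum_meet (phi : {set I} -> R) :
  \sum_(k1 : {set I}) \sum_(k2 : {set I}) pair_wt k1 k2 * phi (k1 :&: k2) = EE (fun e => s ^+ 2 * p e) phi.
Proof.
rewrite /EE; transitivity (\sum_(J : {set I}) \sum_(k1 : {set I}) \sum_(k2 : {set I})
    (k1 :&: k2 == J)%:R * pair_wt k1 k2 * phi J); last first.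
  apply: eq_bigr => J _; rewrite -pair_wt_meet mulr_suml; apply: eq_bigr => k1 _.
  by rewrite mulr_suml.
rewrite [RHS]exchange_big /=; apply: eq_bigr => k1 _; rewrite [RHS]exchange_big /=.
apply: eq_bigr => k2 _; rewrite (bigD1 (k1 :&: k2)) //= eqxx mul1r big1 ?addr0 // => J /negbTE.
by rewrite eq_sym => ->; rewrite !mul0r.
Qed.

Lemma pair_wt_total : \sum_(k1 : {set I}) \sum_(k2 : {set I}) pair_wt k1 k2 = 1.
Proof.
rewrite -(EE_cst (fun e => s ^+ 2 * p e) 1) -pair_sum_meet.
by apply: eq_bigr => k1 _; apply: eq_bigr => k2 _; rewrite mulr1.
Qed.

Lemma pair_wt_factor k1 k2 : (forall e, pair_mass (p e) false false != 0) ->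
  pair_wt k1 k2 = (\prod_e pair_mass (p e) false false) *
   (\prod_(e in k1 :&: k2) (pair_mass (p e) true true / pair_mass (p e) false false)) *
   (\prod_(e in k1 :\: (k1 :&: k2)) (pair_mass (p e) true false / pair_mass (p e) false false)) *
   (\prod_(e in k2 :\: (k1 :&: k2)) (pair_mass (p e) true false / pair_mass (p e) false false)).
Proof.
move=> h0; rewrite !(big_mkcond (fun e => e \in _)) -!big_split /=; apply: eq_bigr => e _.
rewrite !inE; have := h0 e; case: (e \in k1); case: (e \in k2); rewrite /= ?mulr1 // => h;
by rewrite [RHS]mulrC divfK.
Qed.

(** The weight factors over common edges, edges of k1 alone and edges of k2 alone. The swap leaves
    the first and third sets unchanged and permutes the second among edges of equal probability. *)
Lemma pair_wt_invariant (h : I -> I) k1 k2 : (forall e, pair_mass (p e) false false != 0) ->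
  injective h -> (forall e, p (h e) = p e) ->
  h @: (k1 :&: k2) = k1 :&: k2 -> (h @: k1) :&: k2 = k1 :&: k2 ->
  pair_wt (h @: k1) k2 = pair_wt k1 k2.
Proof.
move=> h0 hinj hp hI hm; rewrite !pair_wt_factor // hm; congr (_ * _ * _).
have -> : h @: k1 :\: (k1 :&: k2) = h @: (k1 :\: (k1 :&: k2)).
  apply/setP => y; rewrite inE; apply/andP/imsetP => [[yJ /imsetP[x xk Ey]]|[x]].
    exists x => //; rewrite inE xk andbT; apply: contra yJ => xJ.
    by have := imset_f h xJ; rewrite hI Ey.
  rewrite inE => /andP[xJ xk] ->; split; last exact: imset_f.
  by rewrite -hI mem_imset.
rewrite big_imset /=; last by move=> x y _ _; apply: hinj.
by apply: eq_bigr => e _; rewrite hp.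
Qed.

(** Deleting e from k1 and e' from k2 is injective, keeps the intersection, and costs a factor rho
    for each deletion. *)
Lemma pair_wt_collision (rho : R) e e' J : e != e' -> 0 <= rho ->
  (forall x, pair_mass (p x) true false <= rho * pair_mass (p x) false false) ->
  \sum_(k1 : {set I}) \sum_(k2 : {set I}) ([&& k1 :&: k2 == J, e \in k1, e \notin k2, e' \in k2 & e' \notin k1])%:R *
     pair_wt k1 k2 <= rho ^+ 2 * wt (fun e => s ^+ 2 * p e) J.
Proof.
move=> ee' r0 hr; rewrite -pair_wt_meet mulr_sumr.
under [leRHS]eq_bigr do rewrite mulr_sumr.
rewrite !pair_bigA /=.
rewrite (eq_bigr (fun z => if [&& z.1 :&: z.2 == J, e \in z.1, e \notin z.2, e' \in z.2 & e' \notin z.1]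
   then pair_wt z.1 z.2 else 0)); last by move=> z _; case: ifP; rewrite ?mul1r ?mul0r.
rewrite -big_mkcond /=; apply: (ler_sum_inj (h := fun z => (z.1 :\ e, z.2 :\ e'))).
- move=> [a b] [a' b']; rewrite -!topredE /= => /and5P[_ ea _ eb _] /and5P[_ ea' _ eb' _] [E1 E2].
  by rewrite -(setD1K ea) -(setD1K eb) E1 E2 !setD1K.
- by move=> z; rewrite !mulr_ge0 ?exprn_ge0 // pair_wt_ge0.
move=> [a b] /= /and5P[/eqP abJ ea eb eb' ea'].
have -> : (a :\ e) :&: (b :\ e') == J.
  rewrite -abJ; apply/eqP/setP => x; rewrite !inE.
  have [->|_] /= := eqVneq x e; first by rewrite (negbTE eb) !andbF.
  by have [->|_] /= := eqVneq x e'; rewrite ?(negbTE ea').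
have split2 (x y : {set I}) : pair_wt x y =
    pair_mass (p e) (e \in x) (e \in y) * (pair_mass (p e') (e' \in x) (e' \in y) *
      \prod_(i | (i != e) && (i != e')) pair_mass (p i) (i \in x) (i \in y)).
  rewrite /pair_wt (bigD1 e) //=; congr (_ * _); rewrite (bigD1 e') //=.
  by rewrite eq_sym.
rewrite mul1r (split2 a b) (split2 (a :\ e) (b :\ e')).
have m1 : (e \in a :\ e) = false by rewrite !inE eqxx.
have m2 : (e \in b :\ e') = false by rewrite !inE (negbTE eb) andbF.
have m3 : (e' \in a :\ e) = false by rewrite !inE (negbTE ea') andbF.
have m4 : (e' \in b :\ e') = false by rewrite !inE eqxx.
rewrite ea (negbTE eb) eb' (negbTE ea') m1 m2 m3 m4.
have -> : \prod_(i | (i != e) && (i != e')) pair_mass (p i) (i \in a :\ e) (i \in b :\ e') =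
    \prod_(i | (i != e) && (i != e')) pair_mass (p i) (i \in a) (i \in b).
  by apply: eq_bigr => i /andP[ie ie']; rewrite !inE ie ie'.
set P := \prod_(_ | _) _; have P0 : 0 <= P by apply: prodr_ge0 => x _; apply: pair_mass_ge0.
have -> : pair_mass (p e') false true = pair_mass (p e') true false by [].
rewrite expr2 (_ : rho * rho * _ = (rho * pair_mass (p e) false false) * ((rho * pair_mass (p e') false false) * P)); last by ring.
have n1 := hr e; have n2 := hr e'.
have q1 : 0 <= pair_mass (p e) true false by apply: pair_mass_ge0.
have q2 : 0 <= pair_mass (p e') true false by apply: pair_mass_ge0.
by apply: ler_pM => //; [rewrite mulr_ge0|rewrite ler_wpM2r].
Qed.

End PairLaw.

(** * Swaps bound the posterior probability of a correct match *)

Section SwapInequality.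
Context {R : realType} {n : nat}.
Implicit Types (G H J : graph n) (w j x : 'I_n).
Variables (mu : graph n -> graph n -> R) (sw : graph n -> 'I_n -> 'I_n -> 'S_n).
Hypothesis mu_ge0 : forall k1 k2, 0 <= mu k1 k2.

Definition valid_swap (k1 k2 : graph n) w j : bool :=
  let sg := sw (k1 :&: k2) w j in
  [&& sg w == j, mu (graph_image sg k1) k2 == mu k1 k2 &
      graph_meet sg k1 k2 == k1 :&: k2].

Definition swappable (M : nat) (k1 k2 : graph n) w : bool := (M <= #|[set j | valid_swap k1 k2 w j]|)%N.

Lemma graph_imageM (s t : 'S_n) G : graph_image (s * t)%g G = graph_image t (graph_image s G).
Proof.
rewrite /graph_image -imset_comp; apply: eq_imset => e /=.
by rewrite -imset_comp; apply: eq_imset => v /=; rewrite permM.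
Qed.

Lemma graph_image1 G : graph_image 1%g G = G.
Proof.
rewrite /graph_image -[RHS]imset_id; apply: eq_imset => e /=.
by rewrite -[RHS]imset_id; apply: eq_imset => v; rewrite perm1.
Qed.

Lemma graph_imageK (s : 'S_n) G : graph_image s^-1%g (graph_image s G) = G.
Proof. by rewrite -graph_imageM mulgV graph_image1. Qed.

Lemma graph_imageVK (s : 'S_n) G : graph_image s (graph_image s^-1%g G) = G.
Proof. by rewrite -graph_imageM mulVg graph_image1. Qed.

Lemma reindex_graph_image (s : 'S_n) (F : graph n -> R) :
  \sum_(G : graph n) F (graph_image s G) = \sum_(G : graph n) F G.
Proof.
rewrite [RHS](reindex_inj (h := graph_image s)) //.
exact: can_inj (graph_imageK s).
Qed.

(* The swapped matching determines the swap: the intersection graph is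
   unchanged and j is the new image of x. *)
Lemma swappable_mass (M : nat) G H x w :
  M%:R * \sum_(pi : 'S_n | (pi x == w) && swappable M (graph_image pi G) H w)
    mu (graph_image pi G) H <= \sum_(pi : 'S_n) mu (graph_image pi G) H.
Proof.
rewrite mulr_sumr.
apply: (@le_trans _ _ (\sum_(z : 'S_n * 'I_n | (z.1 x == w) &&
    valid_swap (graph_image z.1 G) H w z.2) mu (graph_image z.1 G) H)).
  rewrite -(pair_big_dep (fun pi : 'S_n => pi x == w) (fun (pi : 'S_n) j => valid_swap (graph_image pi G) H w j)
    (fun (pi : 'S_n) j => mu (graph_image pi G) H)) /=.
  rewrite [leLHS]big_mkcondr; apply: ler_sum => pi _.
  case: ifP => [h|_]; last by apply: sumr_ge0.
  by rewrite sumr_const -[leRHS]mulr_natl ler_wpM2r // ler_nat; move: h; rewrite /swappable cardsE.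
pose tr (z : 'S_n * 'I_n) := (z.1 * sw (graph_image z.1 G :&: H) w z.2)%g.
apply: (ler_sum_inj (h := tr)) => // [z z'|[pi j] /andP[_ /and3P[_ /eqP E _]]]; last first.
  by rewrite /tr /= graph_imageM E.
case: z z' => [pi j] [pi' j'] /andP[/= /eqP h1 /and3P[/eqP h2 _ /eqP h3]]
  /andP[/= /eqP h1' /and3P[/eqP h2' _ /eqP h3']] E; rewrite /tr /= in E.
have EI : graph_image pi G :&: H = graph_image pi' G :&: H.
  by rewrite -[LHS]h3 -[RHS]h3' /graph_meet -!graph_imageM E.
have Ej : j = j'.
  by have := congr1 (fun u : 'S_n => u x) E; rewrite /= !permM h1 h1' h2 h2'.
by move: E; rewrite EI Ej => /mulIg ->.
Qed.

(** Given G and H, a swappable guess for the image of x carries at most 1/M of the posterior mass.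
    Unswappable vertices are counted as correct. Passing from k1 to G is a bijective change of
    variables for each matching. *)
Lemma overlap_le (M : nat) (hat : estimator n) : (0 < M)%N -> (0 < n)%N ->
  \sum_(k1 : graph n) \sum_(k2 : graph n) mu k1 k2 = 1 ->
  \sum_(pi : 'S_n) \sum_(k1 : graph n) \sum_(k2 : graph n) mu k1 k2 / n`!%:R *
     ov (R := R) (hat (graph_image pi^-1%g k1) k2) pi <=
  M%:R^-1 + (\sum_(k1 : graph n) \sum_(k2 : graph n) mu k1 k2 * #|[set w | ~~ swappable M k1 k2 w]|%:R) / n%:R.
Proof.
move=> M0 n0 tot.
have nR : 0 < n%:R :> R by rewrite ltr0n.
have fR : 0 < n`!%:R :> R by rewrite ltr0n fact_gt0.
have MR : 0 < M%:R :> R by rewrite ltr0n.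
have cS : #|{: 'S_n}| = n`! by rewrite card_Sn.
pose bad (pi : 'S_n) k1 k2 : R := \sum_x (~~ swappable M k1 k2 (pi x : 'I_n))%:R.
have badE (pi : 'S_n) k1 k2 : bad pi k1 k2 = #|[set w | ~~ swappable M k1 k2 w]|%:R.
  rewrite /bad -(reindex_inj (h := pi) perm_inj (P := predT) (F := fun w => (~~ swappable M k1 k2 w)%:R)) /=.
  rewrite -sum1_card natr_sum [RHS]big_mkcond; apply: eq_bigr => w _; rewrite inE.
  by case: swappable.
pose hit x (pi : 'S_n) G H : R := ((hat G H x == pi x) && swappable M (graph_image pi G) H (pi x))%:R.
have split_ov (pi : 'S_n) G H : #|finset (fun v => hat G H v == pi v)|%:R <=
    \sum_x hit x pi G H + bad pi (graph_image pi G) H.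
  rewrite -sum1_card natr_sum big_mkcond /bad -big_split /=; apply: ler_sum => x _.
  rewrite inE /hit; case: (hat G H x == pi x); case: (swappable _ _ _ _) => /=;
  by rewrite ?addr0 ?add0r ?lexx ?ler01.
have main : \sum_(pi : 'S_n) \sum_(G : graph n) \sum_(H : graph n) mu (graph_image pi G) H * \sum_x hit x pi G H <=
    n%:R * (n`!%:R / M%:R).
  rewrite (eq_bigr (fun pi : 'S_n => \sum_x \sum_(G : graph n) \sum_(H : graph n) mu (graph_image pi G) H * hit x pi G H)).
    rewrite exchange_big /= mulr_natl -[X in _ *+ X]card_ord -sumr_const; apply: ler_sum => x _.
    rewrite ler_pdivlMr // mulrC mulr_sumr.
    apply: (@le_trans _ _ (\sum_(pi : 'S_n) \sum_(G : graph n) \sum_(H : graph n) mu (graph_image pi G) H)).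
      rewrite -mulr_sumr exchange_big /= mulr_sumr [leRHS]exchange_big /=; apply: ler_sum => G _.
      rewrite exchange_big /= mulr_sumr [leRHS]exchange_big /=; apply: ler_sum => H _.
      apply: le_trans (swappable_mass M G H x (hat G H x)); rewrite ler_wpM2l ?ler0n //.
      rewrite [leRHS]big_mkcond; apply: ler_sum => pi _; rewrite /hit (eq_sym (pi x)).
      by have [->|] := eqVneq (hat G H x) (pi x); case: swappable; rewrite /= ?mulr1 ?mulr0.
    rewrite (eq_bigr (fun=> 1)); first by rewrite sumr_const cS.
    by move=> pi _; rewrite (reindex_graph_image pi (fun G => \sum_(H : graph n) mu G H)).
  move=> pi _; rewrite [RHS]exchange_big /=; apply: eq_bigr => G _.
  rewrite [RHS]exchange_big /=; apply: eq_bigr => H _; by rewrite mulr_sumr.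
have E : \sum_(pi : 'S_n) \sum_(k1 : graph n) \sum_(k2 : graph n) mu k1 k2 / n`!%:R *
     ov (R := R) (hat (graph_image pi^-1%g k1) k2) pi =
   (\sum_(pi : 'S_n) \sum_(G : graph n) \sum_(H : graph n) mu (graph_image pi G) H *
      #|finset (fun v => hat G H v == pi v)|%:R) / (n`!%:R * n%:R).
  rewrite mulr_suml; apply: eq_bigr => pi _.
  rewrite -(reindex_graph_image pi) mulr_suml; apply: eq_bigr => G _.
  rewrite mulr_suml; apply: eq_bigr => H _; rewrite graph_imageK /ov; field.
  by rewrite !gt_eqF.
rewrite E ler_pdivrMr ?mulr_gt0 //.
apply: (@le_trans _ _ (\sum_(pi : 'S_n) \sum_(G : graph n) \sum_(H : graph n) (mu (graph_image pi G) H * \sum_x hit x pi G H +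
    mu (graph_image pi G) H * bad pi (graph_image pi G) H))).
  apply: ler_sum => pi _; apply: ler_sum => G _; apply: ler_sum => H _.
  by rewrite -mulrDr ler_wpM2l.
under eq_bigr do under eq_bigr do rewrite big_split.
under eq_bigr do rewrite big_split.
rewrite big_split /= mulrDl; apply: lerD.
  by apply: le_trans main _; rewrite le_eqVlt; apply/orP; left; apply/eqP; field; rewrite gt_eqF.
rewrite (eq_bigr (fun=> \sum_(k1 : graph n) \sum_(k2 : graph n) mu k1 k2 * #|[set w | ~~ swappable M k1 k2 w]|%:R)).
  rewrite sumr_const cS -[leLHS]mulr_natl le_eqVlt; apply/orP; left; apply/eqP; field; by rewrite gt_eqF.
move=> pi _; rewrite (reindex_graph_image pi (fun G => \sum_(H : graph n) mu G H * bad pi G H)).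
by apply: eq_bigr => k1 _; apply: eq_bigr => k2 _; rewrite badE.
Qed.

End SwapInequality.

(** * Exchanging two isomorphic components *)

Section ComponentSwap.
Context {n m : nat}.
Variables (com : 'I_n -> 'I_m) (L : nat).
Implicit Types (J : graph n) (u v w j : 'I_n).

Definition component J w : {set 'I_n} := [set v | connect (adj J) w v].

Lemma adj_connect_sym J : connect_sym (adj J).
Proof. by apply: sym_connect_sym => u v; apply: adjC. Qed.

Lemma component_refl J w : w \in component J w.
Proof. by rewrite inE connect0. Qed.

Lemma component_closed J w u v : adj J u v -> (u \in component J w) = (v \in component J w).
Proof.
move=> uv; rewrite !inE; apply/idP/idP => h; apply: connect_trans h (connect1 _) => //.
by rewrite adjC.
Qed.

Lemma component_disjoint J w j : j \notin component J w ->
  [disjoint component J w & component J j].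
Proof.
move=> jw; apply/pred0P => x /=; apply/negP; rewrite !inE => /andP[wx jx].
by move: jw; rewrite inE (connect_trans wx) // adj_connect_sym.
Qed.

(** The root comes first, so a swap following the enumerations sends root to root. *)
Definition component_enum J w : seq 'I_n := w :: enum (component J w :\ w).

Lemma component_enum_uniq J w : uniq (component_enum J w).
Proof. by rewrite /= enum_uniq mem_enum !inE eqxx. Qed.

Lemma mem_component_enum J w : component_enum J w =i component J w.
Proof.
move=> v; rewrite in_cons mem_enum in_setD1.
by case: eqVneq => //= ->; rewrite component_refl.
Qed.

Lemma size_component_enum J w : size (component_enum J w) = #|component J w|.
Proof. by rewrite -(card_uniqP (component_enum_uniq J w)); apply: eq_card; exact: mem_component_enum. Qed.

Definition code_type : finType :=
  ('I_L.+1 * {ffun 'I_L -> 'I_m} * {ffun 'I_L * 'I_L -> bool})%type.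

(* Isomorphism type of a rooted component with communities; faithful only for
   components with at most L vertices. *)
Definition component_code J w : code_type :=
  (inord #|component J w|, [ffun i : 'I_L => com (nth w (component_enum J w) i)],
   [ffun x : 'I_L * 'I_L => adj J (nth w (component_enum J w) x.1) (nth w (component_enum J w) x.2)]).

Definition swap_fun J w j v : 'I_n :=
  if v \in component J w then nth v (component_enum J j) (index v (component_enum J w))
  else if v \in component J j then nth v (component_enum J w) (index v (component_enum J j))
  else v.

(** [swap_fun] need not be a bijection for arbitrary roots; the identity serves as default when it
    is not. *)
Definition component_swap J w j : 'S_n :=
  if [pick s : 'S_n | [forall v, s v == swap_fun J w j v]] is Some s then s else 1%g.

Section Valid.
Variables (J : graph n) (w j : 'I_n).
Hypotheses (J_edges : J \subset edges n).
Hypotheses (w_small : (#|component J w| <= L)%N) (j_small : (#|component J j| <= L)%N).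
Hypotheses (same_code : component_code J w = component_code J j) (j_out : j \notin component J w).

Let dis := component_disjoint j_out.

Let same_size : size (component_enum J w) = size (component_enum J j).
Proof.
rewrite !size_component_enum; have := congr1 (fun x : code_type => nat_of_ord x.1.1) same_code.
by rewrite /= !inordK.
Qed.

Let size_le : (size (component_enum J w) <= L)%N.
Proof. by rewrite size_component_enum. Qed.

Let com_nth x y i : (i < size (component_enum J w))%N ->
  com (nth x (component_enum J w) i) = com (nth y (component_enum J j) i).
Proof.
move=> hi; have iL : (i < L)%N by rewrite (leq_trans hi).
have := congr1 (fun x : code_type => x.1.2 (Ordinal iL)) same_code.
rewrite /component_code !ffunE (set_nth_default x) // => ->.
by rewrite (set_nth_default y) // -same_size.
Qed.

Let adj_nth x x' y y' i i' : (i < size (component_enum J w))%N -> (i' < size (component_enum J w))%N ->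
  adj J (nth x (component_enum J w) i) (nth x' (component_enum J w) i') =
  adj J (nth y (component_enum J j) i) (nth y' (component_enum J j) i').
Proof.
move=> hi hi'; have iL : (i < L)%N by rewrite (leq_trans hi).
have iL' : (i' < L)%N by rewrite (leq_trans hi').
have := congr1 (fun x : code_type => x.2 (Ordinal iL, Ordinal iL')) same_code.
rewrite /component_code !ffunE /= (set_nth_default x) // (set_nth_default x' w) // => ->.
by rewrite (set_nth_default y) -?same_size // (set_nth_default y' j) // -same_size.
Qed.

Variant swap_spec v : 'I_n -> Type :=
| SwapL i of (i < size (component_enum J w))%N & v = nth v (component_enum J w) i &
    v \in component J w : swap_spec v (nth v (component_enum J j) i)
| SwapR i of (i < size (component_enum J w))%N & v = nth v (component_enum J j) i &
    v \in component J j : swap_spec v (nth v (component_enum J w) i)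
| SwapO of v \notin component J w & v \notin component J j : swap_spec v v.

Lemma swap_funP v : swap_spec v (swap_fun J w j v).
Proof.
rewrite /swap_fun; case: ifPn => [vw|vw].
  have vi : v \in component_enum J w by rewrite mem_component_enum.
  by apply: SwapL; rewrite ?index_mem ?nth_index.
case: ifPn => [vj|vj]; last exact: SwapO.
have vi : v \in component_enum J j by rewrite mem_component_enum.
by apply: SwapR; rewrite ?same_size ?index_mem ?nth_index.
Qed.

Let swapL i x : (i < size (component_enum J w))%N ->
  swap_fun J w j (nth x (component_enum J w) i) = nth x (component_enum J j) i.
Proof.
move=> hi; rewrite /swap_fun -mem_component_enum mem_nth // index_uniq ?component_enum_uniq //.
by apply: set_nth_default; rewrite -same_size.
Qed.

Let swapR i x : (i < size (component_enum J w))%N ->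
  swap_fun J w j (nth x (component_enum J j) i) = nth x (component_enum J w) i.
Proof.
move=> hi; rewrite /swap_fun.
have hj : nth x (component_enum J j) i \in component J j.
  by rewrite -mem_component_enum mem_nth // -same_size.
rewrite (disjointFl dis hj) hj index_uniq ?component_enum_uniq -?same_size //.
exact: set_nth_default.
Qed.

Lemma swap_fun_invol : involutive (swap_fun J w j).
Proof.
move=> v; case: (swap_funP v) => [i hi E _|i hi E _|h1 h2]; [by rewrite swapR|by rewrite swapL|].
by rewrite /swap_fun (negbTE h1) (negbTE h2).
Qed.

Lemma component_swapE v : component_swap J w j v = swap_fun J w j v.
Proof.
rewrite /component_swap; case: pickP => [s /forallP/(_ v)/eqP//|].
move/(_ (perm (can_inj swap_fun_invol))) => /forallP h; exfalso; apply: h => x.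
by rewrite permE.
Qed.

Lemma component_swap_root : component_swap J w j w = j.
Proof.
rewrite component_swapE /swap_fun component_refl /=.
by rewrite eqxx.
Qed.

Lemma component_swap_com v : com (component_swap J w j v) = com v.
Proof.
rewrite component_swapE; case: (swap_funP v) => [i hi E _|i hi E _|//].
  by rewrite [in RHS]E; apply/esym/com_nth.
by rewrite [in RHS]E; apply/com_nth.
Qed.

Lemma component_swap_adj u v : adj J u v ->
  adj J (component_swap J w j u) (component_swap J w j v).
Proof.
move=> uv; rewrite !component_swapE.
case: (swap_funP u) => [i hi Eu uw|i hi Eu uj|uw uj].
- have vw : v \in component J w by rewrite -(component_closed _ uv).
  case: (swap_funP v) => [i' hi' Ev _|i' _ _ vj|vw' _]; last by rewrite vw in vw'.
    by rewrite -(adj_nth u v) // -Eu -Ev.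
  by have := disjointFr dis vw; rewrite vj.
- have vj : v \in component J j by rewrite -(component_closed _ uv).
  case: (swap_funP v) => [i' _ _ vw|i' hi' Ev _|_ vj']; last by rewrite vj in vj'.
    by have := disjointFr dis vw; rewrite vj.
  by rewrite (adj_nth u v u v) // -Eu -Ev.
have vw : v \notin component J w by rewrite -(component_closed _ uv).
have vj : v \notin component J j by rewrite -(component_closed _ uv).
by rewrite /swap_fun (negbTE vw) (negbTE vj).
Qed.

Lemma component_swap_invol : involutive (component_swap J w j).
Proof. by move=> v; rewrite !component_swapE swap_fun_invol. Qed.

Lemma component_swap_image : graph_image (component_swap J w j) J = J.
Proof.
set s := component_swap J w j.
have sub e : e \in J -> s @: e \in J.
  move=> eJ; have := fintype.subsetP J_edges _ eJ; rewrite edgesE => /cards2P[u [v [uv E]]].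
  have auv : adj J u v by rewrite /adj uv -E.
  by have /andP[_] := component_swap_adj auv; rewrite E imsetU !imset_set1.
apply/setP => e; apply/imsetP/idP => [[e' /sub + ->]//|eJ].
exists (s @: e); first exact: sub.
rewrite -imset_comp -[LHS]imset_id; apply: eq_imset => v /=; by rewrite component_swap_invol.
Qed.

Lemma component_swap_moved v : component_swap J w j v != v ->
  v \in component J w :|: component J j.
Proof.
rewrite component_swapE inE; case: (swap_funP v) => [i _ _ ->//|i _ _ ->|_ _].
  by rewrite orbT.
by rewrite eqxx.
Qed.

End Valid.

(** The only way in which the swap can enlarge the intersection: an edge of k1 alone landing on an
    edge of k2 alone. *)
Definition collision (k1 k2 : graph n) w j : bool :=
  let s := component_swap (k1 :&: k2) w j in
  [exists e in edges n, [&& e \in k1, e \notin k2, s @: e \in k2 & s @: e \notin k1]].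

Definition twins J w : {set 'I_n} :=
  [set j | [&& (#|component J j| <= L)%N, component_code J w == component_code J j & j \notin component J w]].

(** A moved pair meets one of the two components, which together have at most 2L vertices. *)
Lemma card_moved_edges J w j : (#|component J w| <= L)%N -> j \in twins J w ->
  (#|[set e in edges n | component_swap J w j @: e != e]| <= 2 * L * n)%N.
Proof.
move=> wL; rewrite inE => /and3P[jL /eqP E jw].
set C := component J w :|: component J j.
apply: (@leq_trans #|[set [set x.1; x.2] | x : 'I_n * 'I_n in finset.setX C setT]|).
  apply/subset_leq_card/fintype.subsetP => e; rewrite inE edgesE => /andP[/cards2P[u [v [uv ->]]]] h.
  have [uC|uC] := boolP (u \in C); first by apply/imsetP; exists (u, v) => //; rewrite finset.in_setX uC in_setT.
  have [vC|vC] := boolP (v \in C).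
    by apply/imsetP; exists (v, u); [rewrite finset.in_setX vC in_setT|rewrite setUC].
  exfalso; move/negP: h; apply; apply/eqP; rewrite imsetU !imset_set1.
  have fixed x : x \notin C -> component_swap J w j x = x.
    by move=> xC; apply: contraNeq xC; apply: component_swap_moved.
  by rewrite !fixed.
apply: leq_trans (leq_imset_card _ _) _; rewrite cardsX cardsT card_ord leq_mul2r.
apply/orP; right; rewrite mul2n -addnn; apply: leq_trans (leq_card_setU _ _) _.
exact: leq_add.
Qed.

Section ValidPair.
Context {R : realType}.
Variables (p : {set 'I_n} -> R) (s : R).
Hypothesis p_com : forall sg : 'S_n, (forall v, com (sg v) = com v) ->
  forall e : {set 'I_n}, p (sg @: e) = p e.
Hypothesis p_mass : forall e, pair_mass s (p e) false false != 0.

(** The swap is an automorphism of the intersection and preserves communities; without collision the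
    intersection does not grow either, and the likelihood is unchanged by [pair_wt_invariant]. *)
Lemma valid_component_swap (k1 k2 : graph n) w j : k1 \subset edges n ->
  (#|component (k1 :&: k2) w| <= L)%N -> j \in twins (k1 :&: k2) w ->
  ~~ collision k1 k2 w j -> valid_swap (pair_wt p s) component_swap k1 k2 w j.
Proof.
move=> k1n wL; rewrite inE => /and3P[jL /eqP E jw] nc; set J := k1 :&: k2 in wL jL E jw.
have Jn : J \subset edges n by apply: fintype.subset_trans k1n; exact: subsetIl.
rewrite /valid_swap -/J; set sg := component_swap J w j.
have imJ : graph_image sg J = J by apply: component_swap_image.
have meet : graph_meet sg k1 k2 = J.
  apply/setP => e; rewrite /graph_meet inE; apply/andP/idP => [[/imsetP[e' e'1 Ee] e2]|eJ].
    have [e'2|e'2] := boolP (e' \in k2).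
      by rewrite Ee -imJ; apply: imset_f; rewrite inE e'1.
    have [e1|e1] := boolP (e \in k1); first by rewrite inE e1.
    exfalso; move/negP: nc; apply; apply/exists_inP; exists e'; first exact: (fintype.subsetP k1n).
    by rewrite e'1 e'2 -/J -/sg -Ee e2 e1.
  split; last by move: eJ; rewrite inE => /andP[].
  move: eJ; rewrite -imJ => /imsetP[e' e'J ->]; apply: imset_f.
  by move: e'J; rewrite inE => /andP[].
rewrite meet eqxx andbT component_swap_root // eqxx /=; apply/eqP.
apply: (pair_wt_invariant (h := fun e : {set 'I_n} => sg @: e)) => //.
- by apply: imset_inj; apply: perm_inj.
- by apply: p_com => v; apply: component_swap_com.
Qed.

End ValidPair.

(* Path counting below criticality *)
End ComponentSwap.

Section PathCounting.
Context {R : realType} {n : nat}.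
Implicit Types (X : graph n) (Z : {set 'I_n}) (u v w x : 'I_n).

(** Existence of a self-avoiding path of length k avoiding Z. Recording the visited vertices makes
    each step independent of the continuation. *)
Fixpoint reach X k Z u x : bool :=
  if k is k'.+1 then [exists v, [&& v \notin Z, v != u, adj X u v & reach X k' (u |: Z) v x]]
  else u == x.

Lemma path_reach X Z u (q : seq 'I_n) : path (adj X) u q -> uniq (u :: q) ->
  (forall v, v \in q -> v \notin Z) -> reach X (size q) Z u (last u q).
Proof.
elim: q Z u => [|v q IH] Z u //= /andP[uv pq] /and3P[uvq vq uq] hZ.
apply/existsP; exists v; move: uvq; rewrite in_cons negb_or => /andP[nuv uq'].
rewrite hZ ?mem_head // eq_sym nuv uv /=; apply: IH => //=; first by rewrite vq.
move=> x xq; rewrite !inE negb_or hZ ?in_cons ?xq ?orbT // andbT.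
by apply: contraNneq uq' => <-.
Qed.

Lemma component_reach X w x : x \in component X w -> exists2 k : 'I_n, true & reach X k set0 w x.
Proof.
rewrite inE => /connectP[q pq ->]; case/shortenP: pq => q' pq' uq' _.
have sq : (size q' < n)%N.
  have := card_uniqP uq'; rewrite /= => <-.
  by rewrite (leq_trans (max_card _)) // card_ord.
by exists (Ordinal sq) => //; apply: path_reach => // v _; rewrite inE.
Qed.

Lemma reach_depends X k Z u x : u \notin Z ->
  reach X k Z u x = reach (X :&: pairs_in (~: Z)) k Z u x.
Proof.
elim: k X Z u => //= k IH X Z u uZ; apply: eq_existsb => v.
have [vZ|//] /= := boolP (v \notin Z); have [vu|//] /= := boolP (v != u).
have -> : adj (X :&: pairs_in (~: Z)) u v = adj X u v.
  by rewrite /adj !inE subUset !sub1set !inE uZ vZ /= andbT.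
have vuZ : v \notin u |: Z by rewrite !inE negb_or vu.
rewrite (IH X) // (IH (X :&: pairs_in (~: Z))) //.
congr (_ && reach _ _ _ _ _); apply/setP => e; rewrite !inE.
have [h|_] := boolP (e \subset ~: (u |: Z)); rewrite ?andbF // !andbT.
suff -> : e \subset ~: Z by rewrite andbT.
by apply: fintype.subset_trans h _; rewrite setCS subsetUr.
Qed.

Variables (p : {set 'I_n} -> R) (f : 'I_n -> R) (theta B : R).
Hypotheses (p_prob : prob_weights p) (theta_ge0 : 0 <= theta).
Hypotheses (f_bounds : forall u, 1 <= f u <= B).
Hypotheses (f_decay : forall u, \sum_(v | v != u) p [set u; v] * f v <= theta * f u).

Let f0 u : 0 <= f u.
Proof. by case/andP: (f_bounds u) => /(le_trans ler01). Qed.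

Let p0 e : 0 <= p e. Proof. by case/andP: (p_prob e). Qed.

(** The first edge is independent of the continuation, which avoids u; summing over its endpoint
    against f gives one factor theta. *)
Lemma EE_reach k Z u : u \notin Z ->
  EE p (fun X => \sum_x f x * (reach X k Z u x)%:R) <= theta ^+ k * f u.
Proof.
elim: k Z u => [|k IH] Z u uZ.
  rewrite expr0 mul1r (eq_EE (g := fun=> f u)) ?EE_cst // => X.
  by rewrite /= (bigD1 u) //= eqxx mulr1 big1 ?addr0 // => x; rewrite eq_sym => /negbTE->; rewrite mulr0.
pose F v X : R := \sum_x f x * (reach X k (u |: Z) v x)%:R.
apply: (@le_trans _ _ (EE p (fun X => \sum_(v | (v \notin Z) && (v != u)) (adj X u v)%:R * F v X))).
  apply: EE_le => // X.
  apply: (@le_trans _ _ (\sum_x \sum_(v | (v \notin Z) && (v != u)) f x * ((adj X u v)%:R * (reach X k (u |: Z) v x)%:R))).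
    apply: ler_sum => x _; rewrite -mulr_sumr ler_wpM2l //=.
    case: existsP => [[v /and4P[vZ vu uv rv]]|_]; last by apply: sumr_ge0 => v _; rewrite mulr_ge0.
    rewrite (bigD1 v) ?vZ //= uv rv mulr1 lerDl sumr_ge0 // => v' _; by rewrite mulr_ge0.
  rewrite exchange_big /= le_eqVlt; apply/orP; left; apply/eqP; apply: eq_bigr => v _.
  by rewrite /F mulr_sumr; apply: eq_bigr => x _; rewrite mulrCA.
rewrite EE_sum; apply: (@le_trans _ _ (\sum_(v | (v \notin Z) && (v != u)) p [set u; v] * (theta ^+ k * f v))).
  apply: ler_sum => v /andP[vZ vu].
  have vuZ : v \notin u |: Z by rewrite !inE negb_or vu.
  rewrite (EE_indep p (J := [set [set u; v]])).
  - have -> : EE p (fun X => (adj X u v)%:R) = p [set u; v].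
      by rewrite -Pr_mem; apply: eq_EE => X; rewrite /adj eq_sym vu.
    by rewrite ler_wpM2l // IH.
  - by move=> X; rewrite /adj !inE eqxx andbT.
  - apply: (depends_onS (J := pairs_in (~: (u |: Z)))); last first.
      by move=> X; apply: eq_bigr => x _; rewrite reach_depends.
    apply/fintype.subsetP => e; rewrite !inE => /fintype.subsetP h; apply/eqP => E.
    by have := h u; rewrite E !inE eqxx => /(_ isT).
apply: (@le_trans _ _ (\sum_(v | v != u) p [set u; v] * (theta ^+ k * f v))).
  rewrite big_mkcond [leRHS]big_mkcond; apply: ler_sum => v _.
  case: (v != u); rewrite ?andbF //= andbT; case: ifP => // _.
  by rewrite !mulr_ge0 // exprn_ge0.
rewrite (eq_bigr (fun v => theta ^+ k * (p [set u; v] * f v))); last by move=> v _; ring.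
rewrite -mulr_sumr exprSr -mulrA ler_wpM2l ?exprn_ge0 //.
Qed.

Lemma EE_component w : theta < 1 -> EE p (fun X => #|component X w|%:R) <= B / (1 - theta).
Proof.
move=> t1; have t10 : 0 < 1 - theta by rewrite subr_gt0.
apply: (@le_trans _ _ (EE p (fun X => \sum_(k < n) \sum_x f x * (reach X k set0 w x)%:R))).
  apply: EE_le => // X; rewrite exchange_big /= -sum1_card natr_sum big_mkcond /=.
  apply: ler_sum => x _.
  have nn k : 0 <= f x * (reach X k set0 w x)%:R by rewrite mulr_ge0.
  case: ifP => [/component_reach[k _ hk]|_]; last by apply: sumr_ge0.
  rewrite (bigD1 k) //= hk mulr1 -[leLHS]addr0 lerD ?sumr_ge0 //.
  by case/andP: (f_bounds x).
rewrite EE_sum; apply: (@le_trans _ _ (\sum_(k < n) theta ^+ k * f w)).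
  by apply: ler_sum => k _; apply: EE_reach; rewrite inE.
rewrite -mulr_suml ler_pdivlMr // mulrAC.
have -> : (\sum_(k < n) theta ^+ k) * (1 - theta) = 1 - theta ^+ n.
  elim: n => [|l IH]; first by rewrite big_ord0 mul0r expr0 subrr.
  by rewrite big_ord_recr /= mulrDl IH exprS; ring.
have /andP[_ fB] := f_bounds w.
by apply: le_trans fB; rewrite ler_piMl // gerBl exprn_ge0.
Qed.

Lemma Pr_large_component (L : nat) w : theta < 1 ->
  Pr p (fun X => L < #|component X w|)%N <= B / (1 - theta) / L.+1%:R.
Proof.
move=> t1; apply: (@le_trans _ _ (EE p (fun X => #|component X w|%:R) / L.+1%:R)).
  have aL : 0 < L.+1%:R :> R by rewrite ltr0n.
  have c0 X : 0 <= #|component X w|%:R :> R by [].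
  apply: le_trans (Pr_markov p_prob c0 aL).
  by apply: Pr_le => // X; rewrite ler_nat.
by rewrite ler_wpM2r ?invr_ge0 // EE_component.
Qed.

End PathCounting.

(** * Counting vertices without enough valid swaps *)

Section CountBad.
Context {R : realType} {n m : nat}.
Variables (com : 'I_n -> 'I_m) (L : nat) (p : {set 'I_n} -> R) (s q theta B : R) (f : 'I_n -> R).
Implicit Types (J : graph n) (w j : 'I_n).
Hypotheses (p_prob : prob_weights p) (p_supp : forall e, e \notin edges n -> p e = 0).
Hypotheses (p_com : forall sg : 'S_n, (forall v, com (sg v) = com v) ->
  forall e : {set 'I_n}, p (sg @: e) = p e).
Hypotheses (p_le : forall e, p e <= q / n%:R) (n_gt0 : (0 < n)%N) (n_large : 2 * q <= n%:R).
Hypotheses (s_ge0 : 0 <= s) (s_le1 : s <= 1).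

Let n0 : 0 < n%:R :> R. Proof. by rewrite ltr0n. Qed.
Let p0 e : 0 <= p e. Proof. by case/andP: (p_prob e). Qed.
Let p_half e : p e <= 2^-1.
Proof.
apply: le_trans (p_le e) _; have := n0; have := n_large => h1 h2.
by rewrite ler_pdivrMr //; lra.
Qed.

Let mass00 e : 2^-1 <= pair_mass s (p e) false false.
Proof.
have h1 := p_half e; have h2 : 0 <= p e * (1 - s) ^+ 2 by rewrite mulr_ge0 ?sqr_ge0.
by rewrite /pair_mass; lra.
Qed.

Lemma mass00_neq0 e : pair_mass s (p e) false false != 0.
Proof. by rewrite gt_eqF // (lt_le_trans _ (mass00 e)) // invr_gt0. Qed.

Let rho : R := 2 * q / n%:R.

Let q_ge0 : 0 <= q / n%:R. Proof. exact: le_trans (p0 finset.set0) (p_le _). Qed.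

Let rho_ge0 : 0 <= rho.
Proof. by rewrite /rho -mulrA mulr_ge0. Qed.

Let mass_rho e : pair_mass s (p e) true false <= rho * pair_mass s (p e) false false.
Proof.
have h1 := mass00 e; have h2 := p_le e; have h3 := q_ge0; have h4 := p0 e.
apply: (@le_trans _ _ (p e)).
  rewrite /pair_mass ler_piMr // mulr_ile1 ?subr_ge0 //.
  by rewrite gerBl.
apply: (le_trans h2); apply: (@le_trans _ _ (rho * 2^-1)).
  by rewrite /rho; lra.
by rewrite ler_wpM2l.
Qed.

Definition code_class J w : {set 'I_n} :=
  [set j | (#|component J j| <= L)%N && (component_code com L J j == component_code com L J w)].

Definition collisions (k1 k2 : graph n) w : {set 'I_n} :=
  [set j in twins com L (k1 :&: k2) w | collision k1 k2 w j].

Lemma card_rare_codes J (Z : nat) :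
  (#|[set w | (#|component J w| <= L)%N && (#|code_class J w| < Z)%N]| <= #|@code_type m L| * Z)%N.
Proof.
set W := [set w | _]; rewrite -sum1_card (partition_big (component_code com L J) predT) //=.
rewrite -[X in (_ <= X * _)%N]/(#|(@code_type m L : finType)|) -sum_nat_const.
apply: leq_sum => k _; rewrite sum1_card.
have [w /andP[wW /eqP wk]|h] := pickP (fun w => (w \in W) && (component_code com L J w == k)).
  move: wW; rewrite inE => /andP[wL wZ]; apply: leq_trans (ltnW wZ).
  apply/subset_leq_card/fintype.subsetP => j; rewrite [in X in X -> _]unfold_in /= => /andP[jW /eqP jk].
  by rewrite inE jk wk eqxx andbT; move: jW; rewrite inE => /andP[].
by rewrite (eq_card h) card0.
Qed.

(** Of M + L + b vertices with the same code, at most L lie in the component of w and fewer than b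
    collide, which leaves M valid swaps. *)
Lemma swappable_of_class (M b : nat) (k1 k2 : graph n) w : k1 \subset edges n ->
  (#|component (k1 :&: k2) w| <= L)%N -> (M + L + b <= #|code_class (k1 :&: k2) w|)%N ->
  (#|collisions k1 k2 w| < b)%N ->
  swappable (pair_wt p s) (component_swap (n := n)) M k1 k2 w.
Proof.
move=> k1n wL hZ hb; set J := k1 :&: k2 in wL hZ *.
have tw : (M + b <= #|twins com L J w|)%N.
  have : (#|code_class J w| <= #|twins com L J w| + #|component J w|)%N.
    apply: leq_trans (leq_card_setU _ _); apply/subset_leq_card/fintype.subsetP => j.
    rewrite inE => /andP[jL /eqP jc]; rewrite in_setU; apply/orP.
    have [h|h] := boolP (j \in component J w); [by right|left].
    by rewrite inE jL jc eqxx.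
  move=> h; have := leq_trans hZ (leq_trans h (leq_add (leqnn _) wL)).
  by rewrite addnAC leq_add2r.
have : (#|twins com L J w| <= #|[set j | valid_swap (pair_wt p s) (component_swap (n := n)) k1 k2 w j]| +
    #|collisions k1 k2 w|)%N.
  apply: leq_trans (leq_card_setU _ _); apply/subset_leq_card/fintype.subsetP => j jt.
  rewrite in_setU; apply/orP; have [h|h] := boolP (collision k1 k2 w j).
    by right; rewrite inE jt.
  by left; rewrite inE; apply: (valid_component_swap p_com mass00_neq0 k1n wL jt h).
move=> h; rewrite /swappable -(leq_add2r b); apply: leq_trans tw (leq_trans h _).
by rewrite leq_add2l ltnW.
Qed.

(** There are three ways to fail: a component larger than L, a code shared by too few vertices, of
    which there are boundedly many because codes are finitely many, or at least b collisions,
    counted by Markov's inequality. *)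
Lemma card_bad_le (M b : nat) (k1 k2 : graph n) : (0 < b)%N -> k1 \subset edges n ->
  #|[set w | ~~ swappable (pair_wt p s) (component_swap (n := n)) M k1 k2 w]|%:R <=
  \sum_w ((L < #|component (k1 :&: k2) w|)%N)%:R + (#|@code_type m L| * (M + L + b))%:R +
  b%:R^-1 * \sum_(w | (#|component (k1 :&: k2) w| <= L)%N) #|collisions k1 k2 w|%:R :> R.
Proof.
move=> b0 k1n; set J := k1 :&: k2.
have bR : 0 < b%:R :> R by rewrite ltr0n.
apply: (@le_trans _ _ (\sum_w (((L < #|component J w|)%N)%:R +
   ((#|component J w| <= L)%N && (#|code_class J w| < M + L + b)%N)%:R +
   b%:R^-1 * (if (#|component J w| <= L)%N then #|collisions k1 k2 w|%:R else 0)))).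
  rewrite -sum1_card natr_sum big_mkcond; apply: ler_sum => w _; rewrite inE.
  have c0 : 0 <= b%:R^-1 * #|collisions k1 k2 w|%:R :> R by rewrite mulr_ge0 // invr_ge0 ltW.
  have [wL|wL] := leqP #|component J w| L; last first.
    by rewrite /= mulr0 !addr0; case: ifP.
  rewrite /= add0r; have [hZ|hZ] := ltnP #|code_class J w| (M + L + b).
    by case: ifP => _; rewrite ?lerDl ?addr_ge0.
  rewrite add0r; case: ifPn => // hn; have [hb|hb] := ltnP #|collisions k1 k2 w| b.
    by move/negP: hn; case; apply: swappable_of_class hb.
  by rewrite mulrC ler_pdivlMr // mul1r ler_nat.
rewrite !big_split /= -mulr_sumr -big_mkcond /= lerD2r lerD2l -natr_sum ler_nat.
apply: leq_trans (card_rare_codes J (M + L + b)).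
rewrite -sum1_card [leqRHS]big_mkcond; apply: leq_sum => w _; rewrite inE.
by case: (_ && _).
Qed.

Lemma pair_wt_supp (k1 k2 : graph n) : ~~ (k1 \subset edges n) -> pair_wt p s k1 k2 = 0.
Proof.
case/subsetPn => e ek en; rewrite /pair_wt (bigD1 e) //= ek p_supp // /pair_mass.
by case: (e \in k2); rewrite !mul0r.
Qed.

(** The swap depends only on J, so for fixed J this is a union bound over at most 2Ln moved edges,
    each colliding with relative weight rho^2. *)
Lemma collision_mass J w j : (#|component J w| <= L)%N -> j \in twins com L J w ->
  \sum_(k1 : graph n) \sum_(k2 : graph n)
    ((k1 :&: k2 == J) && collision k1 k2 w j)%:R * pair_wt p s k1 k2 <=
  (2 * L * n)%:R * rho ^+ 2 * wt (fun e => s ^+ 2 * p e) J.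
Proof.
move=> wL jt; set sg := component_swap J w j.
set E := [set e in edges n | sg @: e != e].
have W0 : 0 <= wt (fun e => s ^+ 2 * p e) J.
  rewrite -pair_wt_meet; apply: sumr_ge0 => k1 _; apply: sumr_ge0 => k2 _.
  by rewrite mulr_ge0 // pair_wt_ge0.
apply: (@le_trans _ _ (\sum_(e in E) (rho ^+ 2 * wt (fun e => s ^+ 2 * p e) J))); last first.
  rewrite sumr_const -[leLHS]mulr_natl -[leRHS]mulrA; apply: ler_wpM2r.
    by apply: mulr_ge0 => //; apply: exprn_ge0.
  rewrite ler_nat; exact: card_moved_edges wL jt.
apply: (@le_trans _ _ (\sum_(e in E) \sum_(k1 : graph n) \sum_(k2 : graph n)
   ([&& k1 :&: k2 == J, e \in k1, e \notin k2, sg @: e \in k2 & sg @: e \notin k1])%:R * pair_wt p s k1 k2)).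
  rewrite [leRHS]exchange_big /=; apply: ler_sum => k1 _.
  rewrite [leRHS]exchange_big /=; apply: ler_sum => k2 _.
  rewrite -mulr_suml ler_wpM2r ?pair_wt_ge0 //.
  have [kJ|_] := eqVneq (k1 :&: k2) J; last by rewrite sumr_ge0.
  rewrite /=; case: (boolP (collision k1 k2 w j)) => [/exists_inP[e en]|_]; last by rewrite sumr_ge0.
  rewrite kJ -/sg => /and4P[e1 e2 e3 e4].
  have eE : e \in E by rewrite inE en; apply: contraNneq e4 => ->.
  by rewrite (bigD1 e) //= e1 e2 e3 e4 /= lerDl sumr_ge0.
apply: ler_sum => e; rewrite inE => /andP[_ eE].
by apply: pair_wt_collision => //; rewrite eq_sym.
Qed.

(** With at most n twins and rho = 2q/n, the mean number of collisions of a vertex stays bounded as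
    n grows. *)
Lemma mean_collisions w :
  \sum_(k1 : graph n) \sum_(k2 : graph n) pair_wt p s k1 k2 *
    (if (#|component (k1 :&: k2) w| <= L)%N then #|collisions k1 k2 w|%:R else 0) <=
  n%:R * ((2 * L * n)%:R * rho ^+ 2).
Proof.
have sp : prob_weights (fun e => s ^+ 2 * p e).
  move=> e; have /andP[h0 h1] := p_prob e; rewrite mulr_ge0 ?exprn_ge0 //=.
  by rewrite mulr_ile1 ?exprn_ge0 ?exprn_ile1.
have W0 J : 0 <= wt (fun e => s ^+ 2 * p e) J by apply: wt_ge0.
apply: (@le_trans _ _ (\sum_(J : graph n) n%:R * ((2 * L * n)%:R * rho ^+ 2) * wt (fun e => s ^+ 2 * p e) J)); last first.
  by rewrite -mulr_sumr sum_wt mulr1.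
apply: (@le_trans _ _ (\sum_(J : graph n) \sum_(j | (#|component J w| <= L)%N && (j \in twins com L J w))
   \sum_(k1 : graph n) \sum_(k2 : graph n) ((k1 :&: k2 == J) && collision k1 k2 w j)%:R * pair_wt p s k1 k2)).
  rewrite [leRHS](_ : _ = \sum_(k1 : graph n) \sum_(k2 : graph n) \sum_(J : graph n)
     \sum_(j | (#|component J w| <= L)%N && (j \in twins com L J w))
     ((k1 :&: k2 == J) && collision k1 k2 w j)%:R * pair_wt p s k1 k2); last first.
    rewrite (eq_bigr (fun J : graph n => \sum_(k1 : graph n) \sum_(k2 : graph n)
      \sum_(j | (#|component J w| <= L)%N && (j \in twins com L J w))
       ((k1 :&: k2 == J) && collision k1 k2 w j)%:R * pair_wt p s k1 k2)); last first.
      move=> J _; rewrite exchange_big; apply: eq_bigr => k1 _ /=.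
      by rewrite exchange_big.
    rewrite exchange_big; apply: eq_bigr => k1 _ /=; by rewrite exchange_big.
  apply: ler_sum => k1 _; apply: ler_sum => k2 _.
  rewrite (bigD1 (k1 :&: k2)) //= [X in _ <= _ + X]big1 ?addr0; last first.
    by move=> J /negbTE hJ; rewrite big1 // => j _; rewrite eq_sym hJ mul0r.
  rewrite eqxx /= -mulr_suml mulrC ler_wpM2r ?pair_wt_ge0 //.
  case: ifP => _; last by rewrite sumr_ge0.
  rewrite /collisions -sum1_card natr_sum big_mkcond [leRHS]big_mkcond; apply: ler_sum => j _.
  by rewrite inE /=; case: (j \in _); case: (collision _ _ _ _).
apply: ler_sum => J _.
have [wL|wL] := boolP (#|component J w| <= L)%N; last first.
  rewrite big_pred0 //; apply: mulr_ge0 => //; apply: mulr_ge0 => //; apply: mulr_ge0 => //.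
  exact: exprn_ge0.
apply: (@le_trans _ _ (\sum_(j in twins com L J w) ((2 * L * n)%:R * rho ^+ 2 * wt (fun e => s ^+ 2 * p e) J))).
  by apply: ler_sum => j jt; apply: collision_mass.
rewrite sumr_const -[leLHS]mulr_natl -[X in _ <= X * _]/(n%:R * _) -[leRHS]mulrA; apply: ler_wpM2r.
  by apply: mulr_ge0 => //; apply: mulr_ge0 => //; apply: exprn_ge0.
by rewrite ler_nat (leq_trans (max_card _)) // card_ord.
Qed.

Hypotheses (f_bounds : forall u, 1 <= f u <= B) (theta_ge0 : 0 <= theta) (theta_lt1 : theta < 1).
Hypothesis f_decay : forall u, \sum_(v | v != u) s ^+ 2 * p [set u; v] * f v <= theta * f u.

Lemma mean_bad (M b : nat) : (0 < b)%N ->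
  \sum_(k1 : graph n) \sum_(k2 : graph n) pair_wt p s k1 k2 *
    #|[set w | ~~ swappable (pair_wt p s) (component_swap (n := n)) M k1 k2 w]|%:R <=
  n%:R * (B / (1 - theta) / L.+1%:R) + (#|@code_type m L| * (M + L + b))%:R +
  b%:R^-1 * (n%:R * (n%:R * ((2 * L * n)%:R * rho ^+ 2))).
Proof.
move=> b0.
have sp : prob_weights (fun e => s ^+ 2 * p e).
  move=> e; have /andP[h0 h1] := p_prob e; rewrite mulr_ge0 ?exprn_ge0 //=.
  by rewrite mulr_ile1 ?exprn_ge0 ?exprn_ile1.
pose A (J : graph n) : R := \sum_w ((L < #|component J w|)%N)%:R + (#|@code_type m L| * (M + L + b))%:R.
pose D (k1 k2 : graph n) w : R :=
  if (#|component (k1 :&: k2) w| <= L)%N then #|collisions k1 k2 w|%:R else 0.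
apply: (@le_trans _ _ (\sum_(k1 : graph n) \sum_(k2 : graph n)
   (pair_wt p s k1 k2 * A (k1 :&: k2) + b%:R^-1 * \sum_w pair_wt p s k1 k2 * D k1 k2 w))).
  apply: ler_sum => k1 _; apply: ler_sum => k2 _.
  have [k1n|k1n] := boolP (k1 \subset edges n); last first.
    by rewrite pair_wt_supp // !mul0r add0r big1 ?mulr0 // => w _; rewrite mul0r.
  rewrite -mulr_sumr mulrCA -mulrDr ler_wpM2l ?pair_wt_ge0 //.
  by apply: le_trans (card_bad_le M k2 b0 k1n) _; rewrite /A /D -big_mkcond.
under eq_bigr do rewrite big_split.
rewrite big_split /=; apply: lerD.
  rewrite pair_sum_meet /A EE_D EE_cst EE_sum lerD2r.
  apply: (@le_trans _ _ (\sum_(w : 'I_n) B / (1 - theta) / L.+1%:R)).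
    by apply: ler_sum => w _; apply: (Pr_large_component sp theta_ge0 f_bounds f_decay).
  by rewrite sumr_const card_ord -[leLHS]mulr_natl.
under eq_bigr do rewrite -mulr_sumr.
rewrite -mulr_sumr ler_wpM2l ?invr_ge0 //.
under eq_bigr do rewrite exchange_big.
rewrite exchange_big /=.
apply: (@le_trans _ _ (\sum_(w : 'I_n) n%:R * ((2 * L * n)%:R * rho ^+ 2))).
  by apply: ler_sum => w _; apply: mean_collisions.
by rewrite sumr_const card_ord -[leLHS]mulr_natl.
Qed.

End CountBad.

Lemma no_recovery (R : realType) (m : nat) (s q B theta eps : R) :
  0 <= s -> s <= 1 -> 0 < q -> 1 <= B -> 0 <= theta -> theta < 1 -> 0 < eps ->
  exists a0 : R, forall n (com : 'I_n -> 'I_m) (p : {set 'I_n} -> R) (f : 'I_n -> R) (hat : estimator n),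
    a0 <= n%:R -> prob_weights p -> (forall e, e \notin edges n -> p e = 0) ->
    (forall sg : 'S_n, (forall v, com (sg v) = com v) -> forall e : {set 'I_n}, p (sg @: e) = p e) ->
    (forall e, p e <= q / n%:R) -> (forall u, 1 <= f u <= B) ->
    (forall u, \sum_(v | v != u) s ^+ 2 * p [set u; v] * f v <= theta * f u) ->
    \sum_(pi : 'S_n) \sum_(k1 : graph n) \sum_(k2 : graph n) pair_wt p s k1 k2 / n`!%:R *
      ov (R := R) (hat (graph_image pi^-1%g k1) k2) pi <= eps.
Proof.
move=> s0 s1 q0 B1 t0 t1 e0.
(* M, L and b are fixed in this order, b depending on L, and n is taken large last; each of the four
   error terms is then at most eps/4. *)
pose M := Num.bound (4 / eps); pose L := Num.bound (4 * (B / (1 - theta)) / eps).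
pose b := (Num.bound (4 * (8 * L%:R * q ^+ 2) / eps)).+1.
have t10 : 0 < 1 - theta by rewrite subr_gt0.
have BT : 0 <= B / (1 - theta) by rewrite divr_ge0 ?ltW // (lt_le_trans ltr01).
have hM : 4 / eps < M%:R by rewrite archi_boundP // divr_ge0 // ltW.
have hL : 4 * (B / (1 - theta)) / eps < L%:R.
  by rewrite archi_boundP // divr_ge0 ?(ltW e0) // mulr_ge0.
have hb : 4 * (8 * L%:R * q ^+ 2) / eps < b%:R.
  apply: (@lt_trans _ _ (Num.bound (4 * (8 * L%:R * q ^+ 2) / eps))%:R); last by rewrite ltr_nat.
  by rewrite archi_boundP // divr_ge0 ?(ltW e0) // !mulr_ge0 // ltW.
have M0 : (0 < M)%N by rewrite -(ltr0n R); apply: lt_trans hM; rewrite divr_gt0.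
have MR : 0 < M%:R :> R by rewrite ltr0n.
pose Z := (#|@code_type m L| * (M + L + b))%:R : R.
exists (Num.max 1 (Num.max (2 * q) (4 * Z / eps))) => n com p f hat.
rewrite !ge_max => /and3P[n1 n2 n3] hp hs hc hq hf hd.
have n0 : 0 < n%:R :> R by lra.
have n0' : (0 < n)%N by rewrite -(ltr0n R).
have hbad := @mean_bad R n m com L p s q theta B f hp hs hc hq n0' n2 s0 s1 hf t0 t1 hd M b (ltn0Sn _).
apply: le_trans (overlap_le (mu := pair_wt p s) (component_swap (n := n)) _ hat M0 n0' (pair_wt_total p s)) _.
  by move=> k1 k2; apply: pair_wt_ge0.
apply: (@le_trans _ _ (M%:R^-1 + ((n%:R * (B / (1 - theta) / L.+1%:R) + Z +
  b%:R^-1 * (n%:R * (n%:R * ((2 * L * n)%:R * (2 * q / n%:R) ^+ 2)))) / n%:R))).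
  by rewrite lerD2l ler_wpM2r // invr_ge0 ltW.
have -> : (n%:R * (B / (1 - theta) / L.+1%:R) + Z +
  b%:R^-1 * (n%:R * (n%:R * ((2 * L * n)%:R * (2 * q / n%:R) ^+ 2)))) / n%:R =
  B / (1 - theta) / L.+1%:R + Z / n%:R + 8 * L%:R * q ^+ 2 / b%:R.
  rewrite !natrM; have bR : b%:R != 0 :> R by rewrite pnatr_eq0.
  have L1 : L.+1%:R != 0 :> R by rewrite pnatr_eq0.
  move: bR L1; set x := b%:R; set y := L.+1%:R => bR L1.
  by field; rewrite bR L1 !gt_eqF.
have e4 : 0 < eps / 4 by rewrite divr_gt0.
have g1 : M%:R^-1 <= eps / 4.
  by rewrite -[leRHS]invf_div lef_pV2 ?posrE ?divr_gt0 // ltW.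
have g2 : B / (1 - theta) / L.+1%:R <= eps / 4.
  rewrite ler_pdivrMr ?ltr0n //.
  have : 4 * (B / (1 - theta)) < L%:R * eps by rewrite -ltr_pdivrMr.
  rewrite -[L.+1%:R]natr1; lra.
have g3 : Z / n%:R <= eps / 4.
  rewrite ler_pdivrMr //; have : 4 * Z <= n%:R * eps by rewrite -ler_pdivrMr.
  lra.
have g4 : 8 * L%:R * q ^+ 2 / b%:R <= eps / 4.
  rewrite ler_pdivrMr ?ltr0n //.
  have : 4 * (8 * L%:R * q ^+ 2) < b%:R * eps by rewrite -ltr_pdivrMr.
  lra.
apply: le_trans (lerD g1 (lerD (lerD g2 g3) g4)) _; lra.
Qed.

(** * From probability spaces to finite sums *)

Section DiscreteLaw.
Local Open Scope classical_set_scope.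
Local Open Scope ring_scope.
Context {R : realType} {d : measure_display} {T : measurableType d}.
Variable P : probability T R.

Lemma discrete_rv_pair (X Y : Type) (f : T -> X) (g : T -> Y) :
  discrete_rv f -> discrete_rv g -> discrete_rv (fun w => (f w, g w)).
Proof.
move=> hf hg [x y].
rewrite (_ : _ @^-1` _ = f @^-1` [set x]%classic `&` g @^-1` [set y]%classic)%classic.
  exact: measurableI.
by apply/seteqP; split=> w /= [-> ->].
Qed.

Lemma prob_discrete (X : finType) (f : T -> X) (A : pred X) : discrete_rv f ->
  measurable [set w | A (f w)]%classic /\
  P [set w | A (f w)]%classic = (\sum_(x | A x) fine (P (f @^-1` [set x]%classic)))%:E.
Proof.
move=> hf.
have key (r : seq X) : uniq r -> measurable [set w | f w \in r]%classic /\
    P [set w | f w \in r]%classic = (\sum_(x <- r) fine (P (f @^-1` [set x]%classic)))%:E.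
  elim: r => [|x r IH] /=.
    by rewrite big_nil (_ : [set w | _]%classic = classical_sets.set0) ?measure0 //; apply/seteqP; split.
  move=> /andP[xr /IH[mr Pr]].
  have -> : [set w | f w \in x :: r]%classic = (f @^-1` [set x] `|` [set w | f w \in r])%classic.
    apply/seteqP; split=> w /=; rewrite in_cons; first by case/orP => [/eqP|]; [left|right].
    by case=> [->|->]; rewrite ?eqxx ?orbT.
  split; first exact: measurableU.
  rewrite measureU //.
    by rewrite big_cons EFinD -Pr fineK // fin_num_measure.
  apply/seteqP; split=> // w /= [-> h]; by rewrite h in xr.
have [m1 m2] := key (enum A) (enum_uniq A).
have E : [set w | A (f w)]%classic = [set w | f w \in enum A]%classic.
  by apply/seteqP; split=> w /=; rewrite mem_enum.
rewrite E; split=> //; rewrite m2 big_enum /=.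
by congr (_%:E); apply: eq_bigl => x.
Qed.

End DiscreteLaw.

Section EdgeProbabilities.
Context {R : realType} {n : nat}.
Implicit Types (g : graph n) (e : {set 'I_n}) (u v : 'I_n).

(** Turns probabilities of ordered pairs into weights on all vertex sets: only one summand can be
    nonzero, and none is when e is not an edge. *)
Definition eprob (p : 'I_n -> 'I_n -> R) e : R :=
  \sum_(u : 'I_n) \sum_(v : 'I_n | (u < v)%N) (if [set u; v] == e then p u v else 0).

Lemma eprob_supp p e : e \notin edges n -> eprob p e = 0.
Proof.
move=> en; rewrite /eprob big1 // => u _; rewrite big1 // => v uv.
case: eqP => // E; move: en; rewrite -E set2_edges negbK => /eqP uv'.
by rewrite uv' ltnn in uv.
Qed.

Lemma eprob_lt p u v : (u < v)%N -> eprob p [set u; v] = p u v.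
Proof.
move=> uv; rewrite /eprob pair_big_dep /= (bigD1 (u, v)) //= eqxx big1 ?addr0 //.
move=> [a b] /= /andP[ab /negP ne]; case: eqP => // E; exfalso; apply: ne; apply/eqP.
by apply: ordered_pair_inj => //; rewrite inE.
Qed.

Lemma eprob_sym p u v : (forall a b, p a b = p b a) -> u != v -> eprob p [set u; v] = p u v.
Proof.
move=> ps uv; case: (ltngtP u v) => h; first exact: eprob_lt.
  by rewrite setUC eprob_lt // ps.
by move: uv; rewrite -val_eqE /= h eqxx.
Qed.

Lemma indep_edges_pmf_wt p g : indep_edges_pmf p g = wt (eprob p) g.
Proof.
rewrite /indep_edges_pmf; case: (boolP (g \subset edges n)) => [gn|/subsetPn[e eg en]]; last first.
  by rewrite /wt (bigD1 e) //= eg eprob_supp // mul0r.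
rewrite /wt (bigID (fun e => e \in edges n)) /= [X in _ = _ * X]big1 ?mulr1; last first.
  move=> e en; rewrite (negbTE (contra (fintype.subsetP gn e) en)).
  by rewrite eprob_supp // subr0.
rewrite big_edges; apply: eq_bigr => u _; apply: eq_bigr => v uv.
by rewrite eprob_lt.
Qed.

Definition keep_prob (s : R) g e : R := if (e \in g) && (e \in edges n) then s else 0.

Lemma keep_wt s g (k : graph n) :
  indep_edges_pmf (fun u v => if [set u; v] \in g then s else 0) k = wt (keep_prob s g) k.
Proof.
rewrite indep_edges_pmf_wt /wt; apply: eq_bigr => e _.
have -> // : eprob (fun u v => if [set u; v] \in g then s else 0) e = keep_prob s g e.
rewrite /keep_prob; case: (boolP (e \in edges n)) => en; last by rewrite andbF eprob_supp.
rewrite andbT; move: en; rewrite edgesE => /cards2P[u [v [uv ->]]].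
by rewrite eprob_sym // => a b; rewrite setUC.
Qed.

Lemma keep_prob_weights s g : 0 <= s <= 1 -> prob_weights (keep_prob s g).
Proof. by move=> hs e; rewrite /keep_prob; case: ifP => // _; rewrite lexx ler01. Qed.

(** Summing out the mother graph factorises over edges, each giving the corresponding
    [pair_mass]. *)
Lemma pair_marginal (p : {set 'I_n} -> R) s (k1 k2 : graph n) :
  (forall e, e \notin edges n -> p e = 0) ->
  \sum_(g : graph n) wt p g * (wt (keep_prob s g) k1 * wt (keep_prob s g) k2) = pair_wt p s k1 k2.
Proof.
move=> ps; pose K b e : R := if b && (e \in edges n) then s else 0.
pose h b e : R := (if e \in k1 then K b e else 1 - K b e) * (if e \in k2 then K b e else 1 - K b e).
rewrite (eq_bigr (fun g : {set {set 'I_n}} => \prod_e (if e \in g then p e * h true e else (1 - p e) * h false e))).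
  rewrite sum_set_prod; apply: eq_bigr => e _; rewrite /h /K /pair_mass.
  case: (boolP (e \in edges n)) => en /=; last rewrite (ps _ en);
    by case: (e \in k1); case: (e \in k2); rewrite /=; ring.
move=> g _; rewrite /wt -!big_split /=; apply: eq_bigr => e _; rewrite /h /K /keep_prob.
by case: (e \in g).
Qed.

Lemma keep_wt_sub s g (k : graph n) : ~~ (k \subset g) -> wt (keep_prob s g) k = 0.
Proof.
by case/subsetPn => e ek eg; rewrite /wt (bigD1 e) //= ek /keep_prob (negbTE eg) mul0r.
Qed.

Lemma wt_supp (p : {set 'I_n} -> R) g : (forall e, e \notin edges n -> p e = 0) ->
  ~~ (g \subset edges n) -> wt p g = 0.
Proof. by move=> ps /subsetPn[e eg en]; rewrite /wt (bigD1 e) //= eg ps // mul0r. Qed.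

End EdgeProbabilities.

Section SystemLaw.
Local Open Scope classical_set_scope.
Local Open Scope ring_scope.
Context {R : realType} {n m : nat} {d : measure_display} {T : measurableType d}.
Variables (P : probability T R) (Q : 'M[R]_m) (s : R).
Variables (com : T -> {ffun 'I_n -> 'I_m}) (Gup K1 K2 : T -> graph n) (pistar : T -> 'S_n).
Hypothesis hsys : correlated_sbm_system P Q s com Gup K1 K2 pistar.
Hypothesis s01 : 0 <= s <= 1.
Implicit Types (c : {ffun 'I_n -> 'I_m}) (g : graph n).

Definition edge_law c : {set 'I_n} -> R := eprob (edge_prob Q c).

Definition joint_law c g : R := fine (P ((fun w => (com w, Gup w)) @^-1` [set (c, g)]%classic)).

Definition same_edge_law c c' : bool :=
  [forall u, forall v, (u != v) ==> (edge_prob Q c u v == edge_prob Q c' u v)].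

Lemma same_edge_lawP c c' : reflect (forall u v, u != v -> edge_prob Q c u v = edge_prob Q c' u v)
  (same_edge_law c c').
Proof.
apply: (iffP forallP) => [h u v uv|h u].
  by have /forallP/(_ v)/implyP/(_ uv)/eqP := h u.
by apply/forallP => v; apply/implyP => uv; rewrite h.
Qed.

Let hcom : discrete_rv com. Proof. by case: hsys => -[]. Qed.
Let hGup : discrete_rv Gup. Proof. by case: hsys => -[]. Qed.
Let hK1 : discrete_rv K1. Proof. by case: hsys => _ []. Qed.
Let hK2 : discrete_rv K2. Proof. by case: hsys => _ []. Qed.
Let hpi : discrete_rv pistar. Proof. by case: hsys => _ _ []. Qed.

Lemma joint_law_ge0 c g : 0 <= joint_law c g.
Proof. exact: fine_ge0. Qed.

Definition class_prob c : R := \sum_(c' | same_edge_law c' c) \sum_g joint_law c' g.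

Lemma sum_joint_law (A : pred ({ffun 'I_n -> 'I_m} * graph n)) :
  P [set w | A (com w, Gup w)]%classic = (\sum_(x | A x) joint_law x.1 x.2)%:E.
Proof.
have [_ ->] := prob_discrete P A (discrete_rv_pair hcom hGup).
by congr (_%:E); apply: eq_bigr => -[c g] _.
Qed.

Lemma joint_law_total : \sum_c \sum_g joint_law c g = 1.
Proof.
have := sum_joint_law predT; rewrite (_ : [set w | _]%classic = classical_sets.setT) ?probability_setT; last first.
  by apply/seteqP; split.
by move=> [->]; rewrite pair_bigA.
Qed.

Lemma class_joint_law c g :
  \sum_(c' | same_edge_law c' c) joint_law c' g = class_prob c * wt (edge_law c) g.
Proof.
have [[_ _ hG] _ _] := hsys; have := hG c g; rewrite indep_edges_pmf_wt.
have -> : same_edge_probs Q com c = [set w | same_edge_law (com w, Gup w).1 c && true]%classic.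
  by apply/seteqP; split=> w /=; rewrite andbT => /same_edge_lawP.
have -> : ([set w | same_edge_law (com w, Gup w).1 c && true] `&` Gup @^-1` [set g])%classic =
   [set w | same_edge_law (com w, Gup w).1 c && ((com w, Gup w).2 == g)]%classic.
  apply/seteqP; split=> w /=; rewrite andbT; first by case=> -> ->; rewrite eqxx.
  by case/andP => -> /eqP.
rewrite (sum_joint_law (fun x => same_edge_law x.1 c && (x.2 == g))) (sum_joint_law (fun x => same_edge_law x.1 c && true)).
rewrite -EFinM => -[].
rewrite -(pair_big_dep (fun c' => same_edge_law c' c) (fun _ g' => g' == g) (fun c' g' => joint_law c' g')) /=.
rewrite -(pair_big_dep (fun c' => same_edge_law c' c) (fun _ _ => true) (fun c' g' => joint_law c' g')) /=.
by move=> <-; apply: eq_bigr => c' _; rewrite big_pred1_eq.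
Qed.

(* Conditionally on the edge probabilities the graph has law edge_law; a class
   of community assignments with the same edge probabilities is good as soon
   as one of its members is. *)
Lemma conditional_bound (good : pred {ffun 'I_n -> 'I_m}) (h : graph n -> R) (eta : R) :
  (forall g, 0 <= h g <= 1) -> 0 <= eta -> (forall c, good c -> EE (edge_law c) h <= eta) ->
  \sum_c \sum_g joint_law c g * h g <= \sum_(c | ~~ good c) \sum_g joint_law c g + eta.
Proof.
move=> h01 eta0 hgood.
have h0 g : 0 <= h g by case/andP: (h01 g).
pose rp c := odflt c [pick c' | same_edge_law c' c].
have rpE c c' : rp c = rp c' <-> same_edge_law c c'.
  have refl x : same_edge_law x x by apply/same_edge_lawP.
  have pick_ex x : exists2 y, rp x = y & same_edge_law y x.
    by rewrite /rp; case: pickP => [y hy|/(_ x)]; [exists y|rewrite refl].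
  split=> [E|hcc].
    have [y Ey /same_edge_lawP hy] := pick_ex c; have [y' Ey' /same_edge_lawP hy'] := pick_ex c'.
    apply/same_edge_lawP => u v uv; rewrite -hy // -hy' //; congr (edge_prob Q _ u v).
    by rewrite -Ey -Ey'.
  have Ep : (fun x => same_edge_law x c) =1 (fun x => same_edge_law x c').
    move=> x; apply/same_edge_lawP/same_edge_lawP => hx u v uv; rewrite hx //;
    by move/same_edge_lawP: hcc => ->.
  have := pick_ex c; rewrite /rp (eq_pick Ep); case: pickP => // hn.
  by have := hn c'; rewrite refl.
have L0 c : 0 <= \sum_g joint_law c g by apply: sumr_ge0 => g _; apply: joint_law_ge0.
apply: (@le_trans _ _ (\sum_c ((~~ good c)%:R * \sum_g joint_law c g + eta * \sum_g joint_law c g))); last first.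
  rewrite big_split /= -mulr_sumr joint_law_total mulr1 lerD2r [leRHS]big_mkcond /=.
  by apply: ler_sum => c _; case: (good c); rewrite /= ?mul0r ?mul1r.
rewrite (partition_big rp predT) //= [leRHS](partition_big rp predT) //=.
apply: ler_sum => r _.
have [c0 /andP[gc0 /eqP rc0]|hno] := pickP (fun c => good c && (rp c == r)).
  have sw : (fun c => rp c == r) =1 (fun c => same_edge_law c c0).
    by move=> c; apply/eqP/idP; rewrite -rc0; apply rpE.
  rewrite (eq_bigl _ _ sw) [leRHS](eq_bigl _ _ sw) exchange_big /=.
  apply: (@le_trans _ _ (\sum_(c | same_edge_law c c0) eta * \sum_g joint_law c g)); last first.
    by apply: ler_sum => c _; rewrite lerDr mulr_ge0.
  rewrite -mulr_sumr -/(class_prob c0).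
  rewrite (eq_bigr (fun g => class_prob c0 * (wt (edge_law c0) g * h g))) => [|g _].
    rewrite -mulr_sumr mulrC ler_wpM2r; [by []|by apply: sumr_ge0|exact: hgood].
  by rewrite -mulr_suml class_joint_law mulrA.
apply: ler_sum => c rc.
have -> : good c = false by have := hno c; rewrite rc andbT.
rewrite mul1r -[leLHS]addr0 lerD ?mulr_ge0 //.
apply: ler_sum => g _; rewrite ler_piMr ?joint_law_ge0 //.
by case/andP: (h01 g).
Qed.

Lemma prob_event (A : {ffun 'I_n -> 'I_m} -> graph n -> graph n -> graph n -> 'S_n -> bool) :
  P [set w | A (com w) (Gup w) (K1 w) (K2 w) (pistar w)]%classic =
  (\sum_c \sum_g joint_law c g * \sum_k1 \sum_k2 \sum_sg
     wt (keep_prob s g) k1 * wt (keep_prob s g) k2 / n`!%:R * (A c g k1 k2 sg)%:R)%:E.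
Proof.
pose F w := (com w, Gup w, K1 w, K2 w, pistar w).
have hF : discrete_rv F by do 4!apply: discrete_rv_pair => //.
have [_] := prob_discrete P (fun y => A y.1.1.1.1 y.1.1.1.2 y.1.1.2 y.1.2 y.2) hF.
rewrite /= => ->; congr (_%:E).
have FE c g k1 k2 sg : fine (P (F @^-1` [set (c, g, k1, k2, sg)]%classic)) =
    joint_law c g * (wt (keep_prob s g) k1 * wt (keep_prob s g) k2 / n`!%:R).
  have [_ [_ _ hsub] [_ /(_ c g k1 k2 sg) /= hperm]] := hsys.
  move: hperm; rewrite hsub !keep_wt.
  have -> : (com @^-1` [set c] `&` Gup @^-1` [set g] `&` K1 @^-1` [set k1] `&` K2 @^-1` [set k2]
      `&` pistar @^-1` [set sg])%classic = (F @^-1` [set (c, g, k1, k2, sg)])%classic.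
    apply/seteqP; split=> w; rewrite /F /=; first by move=> [[[[-> ->] ->] ->] ->].
    by case=> -> -> -> -> ->.
  move=> ->.
  have -> : (com @^-1` [set c] `&` Gup @^-1` [set g])%classic =
      ((fun w => (com w, Gup w)) @^-1` [set (c, g)])%classic.
    apply/seteqP; split=> w /=; first by case=> -> ->.
    by move=> h; split; [rewrite -[c]/(c, g).1 -h|rewrite -[g]/(c, g).2 -h].
  rewrite -[P ((fun w => (com w, Gup w)) @^-1` _)]fineK ?fin_num_measure //; last first.
    exact: (discrete_rv_pair hcom hGup).
  by rewrite -!EFinM /= !mulrA.
rewrite big_mkcond /= (eq_bigr (fun y => joint_law y.1.1.1.1 y.1.1.1.2 *
   (wt (keep_prob s y.1.1.1.2) y.1.1.2 * wt (keep_prob s y.1.1.1.2) y.1.2 / n`!%:R *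
   (A y.1.1.1.1 y.1.1.1.2 y.1.1.2 y.1.2 y.2)%:R))); last first.
  move=> [[[[c g] k1] k2] sg] _ /=; rewrite FE; case: (A _ _ _ _ _); rewrite ?mulr1 ?mulr0 //.
rewrite -(pair_bigA _ (fun y sg => joint_law y.1.1.1 y.1.1.2 *
   (wt (keep_prob s y.1.1.2) y.1.2 * wt (keep_prob s y.1.1.2) y.2 / n`!%:R *
   (A y.1.1.1 y.1.1.2 y.1.2 y.2 sg)%:R))) /=.
rewrite -(pair_bigA _ (fun y k2 => \sum_(sg : 'S_n) joint_law y.1.1 y.1.2 *
   (wt (keep_prob s y.1.2) y.2 * wt (keep_prob s y.1.2) k2 / n`!%:R *
   (A y.1.1 y.1.2 y.2 k2 sg)%:R))) /=.
rewrite -(pair_bigA _ (fun y k1 => \sum_(k2 : graph n) \sum_(sg : 'S_n) joint_law y.1 y.2 *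
   (wt (keep_prob s y.2) k1 * wt (keep_prob s y.2) k2 / n`!%:R *
   (A y.1 y.2 k1 k2 sg)%:R))) /=.
rewrite -(pair_bigA _ (fun c g => \sum_(k1 : graph n) \sum_(k2 : graph n) \sum_(sg : 'S_n) joint_law c g *
   (wt (keep_prob s g) k1 * wt (keep_prob s g) k2 / n`!%:R *
   (A c g k1 k2 sg)%:R))) /=.
apply: eq_bigr => c _; apply: eq_bigr => g _; rewrite mulr_sumr; apply: eq_bigr => k1 _.
by rewrite mulr_sumr; apply: eq_bigr => k2 _; rewrite mulr_sumr.
Qed.

End SystemLaw.

(** * Limits in probability *)

Section ProbabilisticLimitLemmas.
Local Open Scope classical_set_scope.
Local Open Scope ring_scope.
Local Open Scope ereal_scope.
Context {R : realType} {d : nat -> measure_display} {T : forall n, measurableType (d n)}.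
Variable P : forall n, probability (T n) R.

Lemma limn_esup_le_eventually (u : nat -> \bar R) (a : \bar R) :
  (exists N, forall n, (N <= n)%N -> u n <= a) -> limn_esup u <= a.
Proof.
move=> [N hN]; rewrite limn_esup_lim (cvg_lim _ (cvg_esups_inf (u := u))) //.
apply: le_trans (_ : esups u N <= a).
  by apply: ereal_inf_lbound; exists N.
by apply: ge_ereal_sup => _ [n /= Nn <-]; apply: hN.
Qed.

Lemma eventually_le_limn_esup (u : nat -> \bar R) (a : \bar R) : limn_esup u < a ->
  exists N, forall n, (N <= n)%N -> u n <= a.
Proof.
move=> h; apply: contrapT => hn.
have : a <= limn_esup u; last by rewrite leNgt h.
rewrite limn_esup_lim (cvg_lim _ (cvg_esups_inf (u := u))) //.
apply: le_ereal_inf_tmp => _ [N _ <-]; rewrite leNgt; apply/negP => hlt.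
apply: hn; exists N => n Nn; apply: le_trans (ltW hlt).
by apply: ereal_sup_ubound; exists n.
Qed.

Lemma plimsup_lt (X : forall n, T n -> \bar R) (a : R) (eta : R) :
  plimsup P X < a%:E -> (0 < eta)%R ->
  exists N, forall n, (N <= n)%N -> P n [set w | a%:E <= X n w] <= eta%:E.
Proof.
move=> h e0; apply: eventually_le_limn_esup; rewrite ltNge; apply/negP => hle.
move: h; apply/negP; rewrite -leNgt; apply: ereal_sup_ubound; exists a => //=.
by apply: lt_le_trans hle; rewrite lte_fin.
Qed.

Lemma plimsup_le (X : forall n, T n -> \bar R) (a : R) :
  (forall x eta : R, (a < x)%R -> (0 < eta)%R ->
     exists N, forall n, (N <= n)%N -> P n [set w | x%:E <= X n w] <= eta%:E) ->
  plimsup P X <= a%:E.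
Proof.
move=> h; apply: ge_ereal_sup => _ [x /= hx <-]; rewrite lee_fin leNgt; apply/negP => ax.
have : limn_esup (fun n => P n [set w | x%:E <= X n w]) <= 0; last by rewrite leNgt hx.
apply/lee_addgt0Pr => e e0; rewrite add0e; apply: limn_esup_le_eventually.
exact: h.
Qed.

Lemma plimsup_ge0 (X : forall n, T n -> \bar R) :
  (exists N, forall n, (N <= n)%N -> forall w, 0 <= X n w) -> 0 <= plimsup P X.
Proof.
move=> [N hN]; apply: ereal_sup_ubound; exists 0%R => //=.
rewrite ltNge; apply/negP => hle.
have half : (0 : \bar R) < (2^-1)%:E by rewrite lte_fin invr_gt0.
have [N' hN'] := eventually_le_limn_esup (le_lt_trans hle half).
have := hN' (maxn N N') (leq_maxr _ _).
rewrite (_ : [set w | _] = classical_sets.setT); last first.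
  by apply/seteqP; split=> // w _; apply: hN; rewrite leq_maxl.
by rewrite probability_setT lee_fin; lra.
Qed.

Lemma le_plimsup (X Y : forall n, T n -> \bar R) :
  (exists N, forall n, (N <= n)%N -> forall x : R,
     P n [set w | x%:E <= X n w] <= P n [set w | x%:E <= Y n w]) ->
  plimsup P X <= plimsup P Y.
Proof.
move=> [N hN]; apply: ge_ereal_sup => _ [x /= hx <-]; apply: ereal_sup_ubound; exists x => //=.
rewrite ltNge; apply/negP => hle; move: hx; rewrite ltNge => /negP; apply.
apply/lee_addgt0Pr => eta eta0; rewrite add0e; apply: limn_esup_le_eventually.
have e0 : 0 < eta%:E by rewrite lte_fin.
have [N' hN'] := eventually_le_limn_esup (le_lt_trans hle e0).
exists (maxn N N') => n; rewrite geq_max => /andP[nN nN'].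
exact: le_trans (hN n nN x) (hN' n nN').
Qed.

End ProbabilisticLimitLemmas.

Lemma ereal_lt_EFin (R : realType) (x : \bar R) (a : R) : (x < a%:E)%E ->
  exists2 b : R, (x < b%:E)%E & b < a.
Proof.
case: x => [r||] //=; last by exists (a - 1); rewrite ?ltNyr //; lra.
by rewrite lte_fin => ra; exists ((r + a) / 2); rewrite ?lte_fin; lra.
Qed.

(** * Events on the subsampled graphs and the matching *)

Section ObservedEvents.
Local Open Scope classical_set_scope.
Local Open Scope ring_scope.
Context {R : realType} {n m : nat}.
Variable s : R.
Hypothesis s01 : 0 <= s <= 1.
Implicit Types (g k : graph n) (sg : 'S_n) (A : graph n -> graph n -> 'S_n -> bool).

(** The conditional probability of A given that the mother graph is g. *)
Definition pair_obs g A : R := \sum_(k1 : graph n) \sum_(k2 : graph n) \sum_(sg : 'S_n)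
  wt (keep_prob s g) k1 * wt (keep_prob s g) k2 / n`!%:R * (A k1 k2 sg)%:R.

Lemma pair_obs_wt_ge0 g k1 k2 : 0 <= wt (keep_prob s g) k1 * wt (keep_prob s g) k2 / n`!%:R :> R.
Proof. by rewrite !mulr_ge0 ?invr_ge0 ?ler0n // wt_ge0 //; apply: keep_prob_weights. Qed.

Lemma keep_wt_edges g k : ~~ ((k \subset edges n) && (k \subset g)) -> wt (keep_prob s g) k = 0.
Proof.
rewrite negb_and => /orP[h|]; last exact: keep_wt_sub.
by apply: (wt_supp _ h) => e en; rewrite /keep_prob (negbTE en) andbF.
Qed.

Lemma pair_obs_union g A A1 A2 :
  (forall k1 k2 sg, k1 \subset edges n -> k2 \subset edges n -> k1 \subset g -> k2 \subset g ->
     A k1 k2 sg -> A1 k1 k2 sg || A2 k1 k2 sg) ->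
  pair_obs g A <= pair_obs g A1 + pair_obs g A2.
Proof.
move=> h; rewrite /pair_obs -[leRHS]big_split /=. apply: ler_sum => k1 _; rewrite -[leRHS]big_split /=.
apply: ler_sum => k2 _; rewrite -[leRHS]big_split /=. apply: ler_sum => sg _; rewrite -mulrDr.
have [/andP[e1 g1]|h1] := boolP ((k1 \subset edges n) && (k1 \subset g)); last first.
  by rewrite (keep_wt_edges h1) !mul0r.
have [/andP[e2 g2]|h2] := boolP ((k2 \subset edges n) && (k2 \subset g)); last first.
  by rewrite (keep_wt_edges h2) mulr0 !mul0r.
apply: ler_wpM2l; first exact: pair_obs_wt_ge0.
have := h k1 k2 sg e1 e2 g1 g2; rewrite -natrD ler_nat.
by case: (A _ _ _) => // /(_ isT); case: (A1 _ _ _); case: (A2 _ _ _).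
Qed.

Lemma pair_obs_total g : pair_obs g (fun _ _ _ => true) = 1.
Proof.
have W : \sum_(k : graph n) wt (keep_prob s g) k = 1 by exact: sum_wt.
rewrite /pair_obs -[RHS]W; apply: eq_bigr => k1 _.
rewrite -[RHS]mulr1 -[X in _ * X]W mulr_sumr; apply: eq_bigr => k2 _.
by rewrite mulr1 sumr_const card_Sn -[LHS]mulr_natr divfK ?pnatr_eq0 -?lt0n ?fact_gt0.
Qed.

Lemma pair_obs01 g A : 0 <= pair_obs g A <= 1.
Proof.
apply/andP; split.
  apply: sumr_ge0 => k1 _; apply: sumr_ge0 => k2 _; apply: sumr_ge0 => sg _.
  by rewrite mulr_ge0 ?ler0n // pair_obs_wt_ge0.
rewrite -(pair_obs_total g); apply: ler_sum => k1 _; apply: ler_sum => k2 _; apply: ler_sum => sg _.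
by rewrite ler_wpM2l ?pair_obs_wt_ge0 // ler_nat leq_b1.
Qed.

Lemma EE_pair_obs (p : {set 'I_n} -> R) A : (forall e, e \notin edges n -> p e = 0) ->
  EE p (fun g => pair_obs g A) =
  \sum_(sg : 'S_n) \sum_(k1 : graph n) \sum_(k2 : graph n) pair_wt p s k1 k2 / n`!%:R * (A k1 k2 sg)%:R.
Proof.
move=> ps; rewrite /EE /pair_obs.
transitivity (\sum_(g : graph n) \sum_(k1 : graph n) \sum_(k2 : graph n) \sum_(sg : 'S_n)
    (wt p g * (wt (keep_prob s g) k1 * wt (keep_prob s g) k2)) * ((n`!%:R)^-1 * (A k1 k2 sg)%:R)).
  apply: eq_bigr => g _; rewrite mulr_sumr; apply: eq_bigr => k1 _; rewrite mulr_sumr.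
  by apply: eq_bigr => k2 _; rewrite mulr_sumr; apply: eq_bigr => sg _; rewrite !mulrA.
rewrite exchange_big [RHS]exchange_big /=; apply: eq_bigr => k1 _.
rewrite exchange_big [RHS]exchange_big /=; apply: eq_bigr => k2 _.
rewrite exchange_big /=; apply: eq_bigr => sg _.
by rewrite -mulr_suml pair_marginal // mulrA.
Qed.

Lemma EE_pair_obs_sub (p : {set 'I_n} -> R) A (D : pred (graph n)) : prob_weights p ->
  (forall e, e \notin edges n -> p e = 0) ->
  (forall g k1 k2 sg, g \subset edges n -> k1 \subset g -> k2 \subset g -> A k1 k2 sg -> D g) ->
  EE p (fun g => pair_obs g A) <= Pr p D.
Proof.
move=> pp ps h; rewrite /Pr; apply: ler_sum => g _.
have [ge|ge] := boolP (g \subset edges n); last by rewrite wt_supp // !mul0r.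
apply: ler_wpM2l; first exact: wt_ge0.
have [Dg|nD] := boolP (D g); first by case/andP: (pair_obs01 g A).
have -> : (false%:R : R) = 0 by [].
apply: (le_trans (y := pair_obs g (fun _ _ _ => false) + pair_obs g (fun _ _ _ => false))).
  by apply: pair_obs_union => k1 k2 sg _ _ g1 g2 /(h g k1 k2 sg ge g1 g2); rewrite (negbTE nD).
by rewrite /pair_obs !big1 ?addr0 // => k1 _; rewrite big1 // => k2 _; rewrite big1 // => sg _; rewrite mulr0.
Qed.

Context {d : measure_display} {T : measurableType d}.
Variables (P : probability T R) (Q : 'M[R]_m).
Variables (com : T -> {ffun 'I_n -> 'I_m}) (Gup K1 K2 : T -> graph n) (pistar : T -> 'S_n).
Hypothesis hsys : correlated_sbm_system P Q s com Gup K1 K2 pistar.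

Lemma prob_pair_obs A : P [set w | A (K1 w) (K2 w) (pistar w)]%classic =
  (\sum_c \sum_g joint_law P com Gup c g * pair_obs g A)%:E.
Proof. by rewrite (prob_event hsys (fun _ _ => A)). Qed.

(** Through the finite sums, inclusions of events need only be checked on simple graphs, since the
    others have weight 0. *)
Lemma prob_obs_union A A1 A2 :
  (forall k1 k2 sg, k1 \subset edges n -> k2 \subset edges n ->
     A k1 k2 sg -> A1 k1 k2 sg || A2 k1 k2 sg) ->
  (P [set w | A (K1 w) (K2 w) (pistar w)]%classic <=
   P [set w | A1 (K1 w) (K2 w) (pistar w)]%classic + P [set w | A2 (K1 w) (K2 w) (pistar w)]%classic)%E.
Proof.
move=> h; rewrite !prob_pair_obs -EFinD lee_fin -[leRHS]big_split /=; apply: ler_sum => c _.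
rewrite -[leRHS]big_split /=; apply: ler_sum => g _; rewrite -mulrDr ler_wpM2l ?joint_law_ge0 //.
by apply: pair_obs_union => k1 k2 sg e1 e2 _ _; apply: h.
Qed.

Lemma prob_obs_mono A A1 :
  (forall k1 k2 sg, k1 \subset edges n -> k2 \subset edges n -> A k1 k2 sg -> A1 k1 k2 sg) ->
  (P [set w | A (K1 w) (K2 w) (pistar w)]%classic <= P [set w | A1 (K1 w) (K2 w) (pistar w)]%classic)%E.
Proof.
move=> h; have P0 : P [set w | false]%classic = 0%E.
  by rewrite (_ : [set w | _]%classic = classical_sets.set0) ?measure0 //; apply/seteqP; split.
rewrite -[leRHS]adde0 -P0.
by apply: (prob_obs_union (A2 := fun _ _ _ => false)) => k1 k2 sg e1 e2 hA; rewrite h.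
Qed.

(** It suffices to bound the event under independent edges for good community assignments: bad ones
    are paid for by their probability, and [conditional_bound] does the conditioning. *)
Lemma prob_obs_le A (good : pred {ffun 'I_n -> 'I_m}) (x eta : R) : 0 <= eta ->
  (P [set w | ~~ good (com w)]%classic <= x%:E)%E ->
  (forall c, good c -> EE (edge_law Q c) (fun g => pair_obs g A) <= eta) ->
  (P [set w | A (K1 w) (K2 w) (pistar w)]%classic <= (x + eta)%:E)%E.
Proof.
move=> eta0 hx hA; rewrite prob_pair_obs lee_fin.
apply: le_trans (conditional_bound hsys (fun g => pair_obs01 g A) eta0 hA) _.
rewrite lerD2r -lee_fin; apply: le_trans hx.
rewrite (sum_joint_law hsys (fun x => ~~ good x.1)) lee_fin le_eqVlt; apply/orP; left.
apply/eqP; rewrite pair_big; apply: eq_big => -[c g] //=; exact: andbT.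
Qed.

End ObservedEvents.

(** * Edge probabilities of the block model and the Perron eigenvector *)

Section EdgeLaw.
Context {R : realType} {n m : nat}.
Variables (Q : 'M[R]_m) (q qm : R).
Hypotheses (Qsym : forall i j, Q i j = Q j i) (Qpos : forall i j, 0 < Q i j).
Hypotheses (Qub : forall i j, Q i j <= q) (Qlb : forall i j, qm <= Q i j) (qm_gt0 : 0 < qm).
Implicit Types (c : {ffun 'I_n -> 'I_m}) (e : {set 'I_n}) (u v : 'I_n).

Lemma edge_law_pair c u v : u != v -> edge_law Q c [set u; v] = Q (c u) (c v) / n%:R.
Proof. by move=> uv; rewrite /edge_law eprob_sym // => a b; rewrite /edge_prob Qsym. Qed.

Lemma edge_law_supp c e : e \notin edges n -> edge_law Q c e = 0.
Proof. exact: eprob_supp. Qed.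

Lemma edge_law_bounds c e : 0 < q -> 0 <= edge_law Q c e <= q / n%:R.
Proof.
move=> q0; have [|en] := boolP (e \in edges n); last first.
  by rewrite edge_law_supp // lexx divr_ge0 // ltW.
rewrite edgesE => /cards2P[u [v [uv ->]]]; rewrite edge_law_pair //.
by rewrite divr_ge0 ?ler_wpM2r ?invr_ge0 // ltW.
Qed.

Lemma edge_law_weights c : 0 < q -> q <= n%:R -> prob_weights (edge_law Q c).
Proof.
move=> q0 qn e; have /andP[-> h] := edge_law_bounds c e q0; apply: le_trans h _.
by rewrite ler_pdivrMr ?mul1r // (lt_le_trans q0).
Qed.

Lemma edge_law_image c (sg : 'S_n) e : (forall v, c (sg v) = c v) ->
  edge_law Q c (sg @: e) = edge_law Q c e.
Proof.
move=> h; have [|en] := boolP (e \in edges n); last first.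
  by rewrite !edge_law_supp // edgesE card_imset -?edgesE //; apply: perm_inj.
rewrite edgesE => /cards2P[u [v [uv ->]]].
by rewrite imsetU1 imset_set1 !edge_law_pair ?(inj_eq perm_inj) // !h.
Qed.

Let lam c := perron_frobenius (Q *m diag_mx (community_sizes c)).

(* The eigenvector is constant on communities, and its entries have ratio at
   most q / qm. *)
Lemma perron_function c : (0 < n)%N -> exists2 F : 'I_n -> R,
  forall u, 1 <= F u <= (q / qm) ^+ 2 &
  forall u, \sum_v Q (c u) (c v) / n%:R * F v = lam c * F u.
Proof.
move=> n0; pose u0 : 'I_n := Ordinal n0; pose i0 := c u0.
have nR : 0 < n%:R :> R by rewrite ltr0n.
have q0 : 0 < q by apply: lt_le_trans (Qub i0 i0).
have [||f f0 [_ feq fB]] := perron_vector (Q := Q) (alpha := community_sizes c) Qsym Qpos.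
- by move=> i; rewrite mxE divr_ge0.
- exists i0; rewrite mxE divr_gt0 // ltr0n card_gt0; apply/set0Pn; exists u0.
  by rewrite inE.
have B0 : 0 < q / qm by rewrite divr_gt0.
have fB' : forall i j, f i <= q / qm * f j.
  apply: fB => i j k; apply: le_trans (Qub i k) _.
  by rewrite -mulrA -[leLHS]mulr1 ler_pM2l // mulrC ler_pdivlMr ?mul1r.
exists (fun u => q / qm * f (c u) / f i0) => u.
  apply/andP; split; first by rewrite ler_pdivlMr // mul1r.
  by rewrite ler_pdivrMr // expr2 -[leRHS]mulrA ler_pM2l.
rewrite (_ : lam c * _ = q / qm / f i0 * (lam c * f (c u))); last by ring.
rewrite -(feq (c u)) mulr_sumr.
rewrite (partition_big c predT) //=; apply: eq_bigr => i _.
rewrite (eq_bigr (fun v => Q (c u) i / n%:R * (q / qm * f i / f i0))) => [|v /eqP -> //].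
rewrite sumr_const mxE -[LHS]mulr_natl.
have -> : #|[pred v | c v == i]| = #|[set v | c v == i]| by rewrite cardsE.
have := lt0r_neq0 (f0 i0); have := lt0r_neq0 nR; have := lt0r_neq0 qm_gt0; move=> h1 h2 h3.
by field; rewrite h1 h2 h3.
Qed.

Lemma perron_decay c (s : R) (F : 'I_n -> R) : (forall u, 1 <= F u) ->
  (forall u, \sum_v Q (c u) (c v) / n%:R * F v = lam c * F u) ->
  forall u, \sum_(v | v != u) s ^+ 2 * edge_law Q c [set u; v] * F v <= s ^+ 2 * lam c * F u.
Proof.
move=> F1 hF u; rewrite -mulrA -hF mulr_sumr [leRHS](bigD1 u) //=.
have F0 : 0 <= F u by apply: le_trans ler01 (F1 u).
rewrite -[leLHS]add0r lerD //.
  by rewrite mulr_ge0 ?sqr_ge0 // mulr_ge0 // divr_ge0 // ltW.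
by apply: ler_sum => v vu; rewrite edge_law_pair 1?eq_sym // !mulrA.
Qed.

(** The eigenvalue equation includes v = u, which is not an edge; removing this term costs at most
    (q/n) F u. *)
Lemma perron_growth c (s : R) (F : 'I_n -> R) : 0 <= s <= 1 -> (forall u, 1 <= F u) ->
  (forall u, \sum_v Q (c u) (c v) / n%:R * F v = lam c * F u) ->
  forall u, (s ^+ 2 * lam c - q / n%:R) * F u <=
    \sum_(v | v != u) s ^+ 2 * edge_law Q c [set u; v] * F v.
Proof.
move=> /andP[s0 s1] F1 hF u; rewrite mulrBl lerBlDr -mulrA -hF mulr_sumr [leLHS](bigD1 u) //=.
have F0 : 0 <= F u by apply: le_trans ler01 (F1 u).
rewrite addrC lerD //.
  by apply: ler_sum => v vu; rewrite edge_law_pair 1?eq_sym // !mulrA.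
rewrite mulrA ler_wpM2r // mulrA ler_wpM2r ?invr_ge0 ?ler0n //.
apply: le_trans (Qub (c u) (c u)); rewrite ler_piMl ?(ltW (Qpos _ _)) //.
exact: exprn_ile1.
Qed.

End EdgeLaw.

Lemma eventually_natr_ge (R : realType) (a : R) :
  exists N, forall n, (N <= n)%N -> a <= n%:R.
Proof.
exists (Num.bound `|a|) => n Nn; apply: le_trans (ler_norm a) _.
by apply: le_trans (ltW (archi_boundP (normr_ge0 a))) _; rewrite ler_nat.
Qed.

Lemma positive_matrix_bounds (R : realType) (m : nat) (Q : 'M[R]_m) : (forall i j, 0 < Q i j) ->
  exists q qm, [/\ 1 <= q, 0 < qm <= 1, forall i j, Q i j <= q & forall i j, qm <= Q i j].
Proof.
move=> Qpos.
have le_sum (F : 'M[R]_m) i j : (forall i j, 0 <= F i j) -> F i j <= 1 + \sum_a \sum_b F a b.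
  move=> F0; rewrite (bigD1 i) //= (bigD1 j) //=.
  have h1 : 0 <= \sum_(b | b != j) F i b by apply: sumr_ge0 => b _; apply: F0.
  have h2 : 0 <= \sum_(a | a != i) \sum_b F a b.
    by apply: sumr_ge0 => a _; apply: sumr_ge0 => b _; apply: F0.
  by lra.
have inv0 i j : 0 <= (map_mx (fun x : R => x^-1) Q) i j by rewrite mxE invr_ge0 ltW.
have S0 (F : 'M[R]_m) : (forall i j, 0 <= F i j) -> 0 <= \sum_a \sum_b F a b.
  by move=> F0; apply: sumr_ge0 => a _; apply: sumr_ge0 => b _; apply: F0.
exists (1 + \sum_a \sum_b Q a b), (1 + \sum_a \sum_b map_mx (fun x : R => x^-1) Q a b)^-1; split.
- by rewrite lerDl S0 // => i j; apply: ltW.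
- by rewrite invr_gt0 ltr_wpDr ?S0 //= invf_le1 ?ltr_wpDr ?S0 // lerDl S0.
- by move=> i j; apply: le_sum => a b; apply: ltW.
- move=> i j; rewrite -[leRHS]invrK lef_pV2 ?posrE ?invr_gt0 //; last by rewrite ltr_wpDr // S0.
  by have := le_sum (map_mx (fun x : R => x^-1) Q) i j inv0; rewrite mxE.
Qed.

(** * The subcritical case *)

Section Intractability.
Local Open Scope classical_set_scope.
Local Open Scope ring_scope.
Context {R : realType} {m : nat}.
Variables (Q : 'M[R]_m) (s : R).
Hypotheses (Qsym : forall i j, Q i j = Q j i) (Qpos : forall i j, 0 < Q i j).
Hypothesis (hs : 0 < s <= 1).
Context {d : nat -> measure_display} {T : forall n, measurableType (d n)}.
Variables (P : forall n, probability (T n) R) (com : forall n, T n -> {ffun 'I_n -> 'I_m}).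
Variables (Gup K1 K2 : forall n, T n -> graph n) (pistar : forall n, T n -> 'S_n).
Hypothesis hsys : forall n, (forall i j, Q i j <= n%:R) ->
  correlated_sbm_system (P n) Q s (@com n) (@Gup n) (@K1 n) (@K2 n) (@pistar n).

Lemma subcritical_intractable :
  (plimsup P (fun n w => (s ^+ 2 * perron_frobenius (Q *m diag_mx (community_sizes (com w))))%:E) < 1)%E ->
  forall hat : forall n, estimator n,
  plimsup P (fun n w =>
    (ov (hat n (graph_image (pistar w)^-1%g (K1 w)) (K2 w)) (pistar w))%:E) = 0%E.
Proof.
move=> hlt hat; have /andP[s0 s1] := hs.
have [theta ht /andP[t0 t1]] : exists2 theta : R,
    (plimsup P (fun n w => (s ^+ 2 * perron_frobenius (Q *m diag_mx (community_sizes (com w))))%:E) < theta%:E)%E &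
    0 < theta < 1.
  (* The maximum with 1/2 only serves to make theta positive. *)
  have [b hb b1] := ereal_lt_EFin hlt; exists (Num.max (2^-1) b).
    by apply: lt_le_trans hb _; rewrite lee_fin le_max lexx orbT.
  by clear hb hlt; rewrite lt_max gt_max b1; apply/andP; split; [apply/orP; left|apply/andP; split]; lra.
have ov0 n (a b : 'S_n) : 0 <= ov (R := R) a b by rewrite divr_ge0.
apply/eqP; rewrite eq_le; apply/andP; split; last first.
  by apply: plimsup_ge0; exists 0%N => n _ w; rewrite lee_fin.
apply: plimsup_le => x eta x0 eta0.
have eta2 : 0 < eta / 2 by lra.
have [N1 hN1] := plimsup_lt ht eta2.
have [q [qm [q1 /andP[qm0 qm1] Qub Qlb]]] := positive_matrix_bounds Qpos.
have q0 : 0 < q by apply: lt_le_trans q1.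
have B1 : 1 <= (q / qm) ^+ 2.
  by apply: exprn_ege1; rewrite ler_pdivlMr // mul1r; apply: le_trans qm1 q1.
(* By Markov's inequality, a mean overlap of at most x eta/2 makes an overlap of at least x have
   probability at most eta/2. *)
have xe0 : 0 < x * (eta / 2) by rewrite mulr_gt0.
have [a0 ha0] := no_recovery m (ltW s0) s1 q0 B1 (ltW t0) t1 xe0.
have [N hN] := eventually_natr_ge (Num.max a0 q).
exists (maxn (maxn N1 N) 1) => n; rewrite !geq_max => /andP[/andP[nN1 nN] n0].
have /andP[na0 nq] : (a0 <= n%:R) && (q <= n%:R) by rewrite -ge_max hN.
have hn : correlated_sbm_system (P n) Q s (@com n) (@Gup n) (@K1 n) (@K2 n) (@pistar n).
  by apply: hsys => i j; apply: le_trans (Qub i j) nq.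
pose A (k1 k2 : graph n) (sg : 'S_n) := (x <= ov (hat n (graph_image sg^-1%g k1) k2) sg)%R.
pose good (c : {ffun 'I_n -> 'I_m}) := s ^+ 2 * perron_frobenius (Q *m diag_mx (community_sizes c)) < theta.
have s01 : 0 <= s <= 1 by rewrite (ltW s0).
rewrite (splitr eta).
apply: le_trans (prob_obs_le s01 hn (A := A) (good := good) (x := eta / 2) (ltW eta2) _ _) => //.
  apply: le_trans (hN1 n nN1); rewrite le_eqVlt; apply/orP; left; apply/eqP; congr (P n _).
  by apply/seteqP; split=> w /=; rewrite lee_fin -leNgt.
move=> c gc; rewrite EE_pair_obs //; last exact: edge_law_supp.
have [F hF1 hF] := perron_function Qsym Qpos Qub Qlb qm0 c n0.
have F1 u : 1 <= F u by case/andP: (hF1 u).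
have pw := edge_law_weights Qsym Qpos Qub c q0 nq.
rewrite -(ler_pM2l x0); apply: le_trans (ha0 n c (edge_law Q c) F (hat n) na0 pw _ _ _ hF1 _).
- rewrite mulr_sumr; apply: ler_sum => sg _; rewrite mulr_sumr; apply: ler_sum => k1 _.
  rewrite mulr_sumr; apply: ler_sum => k2 _; rewrite mulrCA ler_wpM2l //.
    by rewrite divr_ge0 // pair_wt_ge0 // ltW.
  by rewrite /A; case: (boolP (x <= _)) => h /=; rewrite ?mulr1 ?mulr0 ?ov0.
- exact: edge_law_supp.
- by move=> sg hc e; apply: edge_law_image.
- by move=> e; have /andP[] := edge_law_bounds Qsym Qpos Qub c e q0.
- move=> u; apply: le_trans (perron_decay Qsym Qpos s F1 hF u) _.
  by rewrite ler_wpM2r ?(ltW gc) // (le_trans ler01).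
Qed.

End Intractability.

(** * The self-overlap of the union graph *)

Section SelfOverlapEvents.
Local Open Scope classical_set_scope.
Local Open Scope ring_scope.
Local Open Scope ereal_scope.
Context {R : realType}.

Lemma le_bigmaxE (I : finType) (p : pred I) (F : I -> \bar R) (x : R) :
  (x%:E <= \big[Order.max/-oo]_(i | p i) F i) = [exists i, p i && (x%:E <= F i)].
Proof.
apply/idP/existsP => [|[i /andP[pi h]]]; last first.
  by apply: le_trans h (le_bigmax_cond _ _ pi).
elim/big_rec: _ => [|i y pi IH]; first by rewrite leNgt ltNyr.
by rewrite le_max => /orP[h|/IH//]; exists i; rewrite pi.
Qed.

Lemma le_bigminE (I : finType) (p : pred I) (F : I -> R) (x : R) :
  (x%:E <= \big[Order.min/+oo]_(i | p i) (F i)%:E) = [forall (i | p i), x <= F i]%R.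
Proof.
apply/idP/forall_inP => [h i pi|h].
  by rewrite -lee_fin; apply: le_trans h (bigmin_le_cond _ _ pi).
elim/big_rec: _ => [|i y pi IH]; first by rewrite leey.
by rewrite le_min lee_fin h.
Qed.

Lemma self_overlap_atE n (eps x : R) (K : graph n) :
  (x%:E <= self_overlap_at eps K) =
  [exists sigma : 'S_n, exists A : {set 'I_n},
    [&& A \subset Der sigma, (eps * n%:R <= #|A|%:R)%R &
      [forall (v | v \in A), x <= balanced_load (R := R) (graph_meet sigma K K) v]%R]].
Proof.
rewrite /self_overlap_at le_bigmaxE; apply: eq_existsb => sigma.
rewrite le_bigmaxE; apply: eq_existsb => A.
by rewrite le_bigminE andbA.
Qed.

End SelfOverlapEvents.

Lemma self_overlap_at_subset (R : realType) n (eps : R) (x : R) (K K' : graph n) : K \subset K' ->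
  (x%:E <= self_overlap_at eps K)%E -> (x%:E <= self_overlap_at eps K')%E.
Proof.
move=> KK'; rewrite !self_overlap_atE => /existsP[sg /existsP[A /and3P[h1 h2 /forall_inP h3]]].
apply/existsP; exists sg; apply/existsP; exists A; rewrite h1 h2; apply/forall_inP => v vA.
apply: le_trans (h3 v vA) _; apply: balanced_load_mono.
by apply: setISS => //; apply: imsetS.
Qed.

Lemma self_overlap_at_antitone (R : realType) n (eps eps' : R) (x : R) (K : graph n) : eps <= eps' ->
  (x%:E <= self_overlap_at eps' K)%E -> (x%:E <= self_overlap_at eps K)%E.
Proof.
move=> ee; rewrite !self_overlap_atE => /existsP[sg /existsP[A /and3P[h1 h2 h3]]].
apply/existsP; exists sg; apply/existsP; exists A; rewrite h1 h3 andbT.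
by apply: le_trans h2; rewrite ler_wpM2r.
Qed.

Lemma self_overlap_at_ge0 (R : realType) n (eps : R) (K : graph n) : (1 < n)%N -> eps <= 1 ->
  (0 <= self_overlap_at eps K)%E.
Proof.
(* The cyclic shift moves every vertex as soon as n > 1, so the whole vertex set is an admissible
   A. *)
move=> n1 e1; rewrite self_overlap_atE; apply/existsP; exists (perm (@ordS_inj n)).
apply/existsP; exists finset.setT; apply/and3P; split.
- apply/fintype.subsetP => v _; rewrite inE permE -val_eqE /=.
  have [vn|vn] := ltnP v.+1 n; first by rewrite modn_small // neq_ltn ltnSn orbT.
  have -> : v.+1 = n by apply/eqP; rewrite eqn_leq vn andbT.
  by rewrite modnn eq_sym -lt0n; apply: leq_trans (_ : 0 < n.-1)%N _; lia.
- by rewrite cardsT card_ord ler_piMl.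
- by apply/forall_inP => v _; apply: balanced_load_ge0.
Qed.

Section SelfOverlapOfUnion.
Local Open Scope classical_set_scope.
Local Open Scope ring_scope.
Context {R : realType} {m : nat}.
Variables (Q : 'M[R]_m) (s : R).
Hypotheses (Qsym : forall i j, Q i j = Q j i) (Qpos : forall i j, 0 < Q i j).
Hypothesis (hs : 0 < s <= 1).
Context {d : nat -> measure_display} {T : forall n, measurableType (d n)}.
Variables (P : forall n, probability (T n) R) (com : forall n, T n -> {ffun 'I_n -> 'I_m}).
Variables (Gup K1 K2 : forall n, T n -> graph n) (pistar : forall n, T n -> 'S_n).
Hypothesis hsys : forall n, (forall i j, Q i j <= n%:R) ->
  correlated_sbm_system (P n) Q s (@com n) (@Gup n) (@K1 n) (@K2 n) (@pistar n).

Let U n (w : T n) : graph n := graph_join (pistar w) (graph_image (pistar w)^-1%g (K1 w)) (K2 w).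
Let psi (e : R) := plimsup P (fun n w => self_overlap_at e (U w)).

Let UE n (w : T n) : U w = K1 w :|: K2 w.
Proof. by rewrite /U /graph_join graph_imageVK. Qed.

Let s01 : 0 <= s <= 1. Proof. by case/andP: hs => /ltW -> ->. Qed.

Lemma plimsup_self_overlap_antitone (e e' : R) : e <= e' -> (psi e' <= psi e)%E.
Proof.
move=> ee; have [q [qm [q1 /andP[qm0 qm1] Qub Qlb]]] := positive_matrix_bounds Qpos.
have [N hN] := eventually_natr_ge q; apply: le_plimsup; exists N => n /hN nq x.
have hn : correlated_sbm_system (P n) Q s (@com n) (@Gup n) (@K1 n) (@K2 n) (@pistar n).
  by apply: hsys => i j; apply: le_trans (Qub i j) nq.
pose A (b : R) (k1 k2 : graph n) (_ : 'S_n) := (x%:E <= self_overlap_at b (k1 :|: k2))%E.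
have AE b : P n [set w | (x%:E <= self_overlap_at b (U w))%E]%classic =
    P n [set w | A b (K1 w) (K2 w) (pistar w)]%classic.
  by congr (P n _); apply/seteqP; split=> w /=; rewrite UE.
rewrite !AE; apply: (prob_obs_mono s01 hn) => k1 k2 sg _ _.
exact: self_overlap_at_antitone.
Qed.

Lemma plimsup_self_overlap_ge0 (e : R) : e <= 1 -> (0 <= psi e)%E.
Proof.
by move=> e1; apply: plimsup_ge0; exists 2%N => n n2 w; apply: self_overlap_at_ge0.
Qed.

(** The union lies in the mother graph and loads grow with the graph, so [dense_copy_vanishes]
    applies to the mother graph, which has independent edges, unlike an unconditioned block
    model. *)
Lemma plimsup_self_overlap_le1 (e : R) : 0 < e -> (psi e <= 1)%E.
Proof.
move=> e0; have [q [qm [q1 /andP[qm0 qm1] Qub Qlb]]] := positive_matrix_bounds Qpos.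
apply: plimsup_le => x eta x1 eta0; have x10 : 0 < x - 1 by rewrite subr_gt0.
have [a ha] := dense_copy_vanishes q1 x10 e0 eta0.
have [N hN] := eventually_natr_ge (Num.max a q); exists N => n /hN.
rewrite ge_max => /andP[na nq]; have q0 : 0 < q by apply: lt_le_trans q1.
have hn : correlated_sbm_system (P n) Q s (@com n) (@Gup n) (@K1 n) (@K2 n) (@pistar n).
  by apply: hsys => i j; apply: le_trans (Qub i j) nq.
pose A (k1 k2 : graph n) (_ : 'S_n) := (x%:E <= self_overlap_at e (k1 :|: k2))%E.
rewrite (_ : [set w | _]%classic = [set w | A (K1 w) (K2 w) (pistar w)]%classic); last first.
  by apply/seteqP; split=> w /=; rewrite UE.
rewrite -[eta]add0r.
apply: (prob_obs_le s01 hn (good := predT) (ltW eta0)) => [|c _].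
  by rewrite (_ : [set w | _]%classic = classical_sets.set0) ?measure0 //; apply/seteqP; split.
have pw := edge_law_weights Qsym Qpos Qub c q0 nq.
apply: le_trans (ha n (edge_law Q c) na pw _ _); last 2 first.
- exact: edge_law_supp.
- by move=> b; have /andP[] := edge_law_bounds Qsym Qpos Qub c b q0.
apply: EE_pair_obs_sub => // [b|g k1 k2 sg ge g1 g2 hA]; first exact: edge_law_supp.
rewrite /dense_copy ge /= addrC subrK -self_overlap_atE.
by apply: self_overlap_at_subset hA; rewrite finset.subUset g1.
Qed.

(** The quantity is nonincreasing in the size threshold, so the limit at 0+ exists and equals the
    supremum over thresholds in ]0,1[ and at 1. *)
Lemma SOV_bounds (e : R) : 0 < e <= 1 -> (psi e <= SOV P U <= 1)%E.
Proof.
have cv : psi @ (0 : R)^'+ --> ereal_sup (psi @` [set` Interval (BRight 0) (BRight 1)]).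
  apply: nonincreasing_at_right_cvge; first by rewrite bnd_simp.
  by move=> a b _ _; apply: plimsup_self_overlap_antitone.
have -> : SOV P U = ereal_sup (psi @` [set` Interval (BRight 0) (BRight 1)]).
  exact: cvg_lim cv.
move=> e01; apply/andP; split; first by apply: ereal_sup_ubound; exists e => //=; rewrite in_itv.
apply: ge_ereal_sup => _ [b /= hb <-]; apply: plimsup_self_overlap_le1.
by move: hb; rewrite in_itv /= => /andP[].
Qed.

End SelfOverlapOfUnion.

Lemma graph_image_edges n (sg : 'S_n) (K : graph n) : K \subset edges n -> graph_image sg K \subset edges n.
Proof.
move=> Ke; apply/fintype.subsetP => _ /imsetP[e eK ->].
by have := fintype.subsetP Ke e eK; rewrite !edgesE card_imset //; apply: perm_inj.
Qed.

(* A dense set of the estimator that moved many vertices relatively to sg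
   would be a large self-overlap of the union graph. *)
Lemma maximal_dense_set_overlap (R : realType) n (rho delta c : R) (hat : estimator n)
    (k1 k2 : graph n) (sg : 'S_n) :
  (0 < n)%N -> maximal_dense_set_estimator rho%:E delta hat -> rho <= 1 ->
  k1 \subset edges n -> k2 \subset edges n ->
  2 * c * n%:R <= #|[set v | 1 + delta <= balanced_load (R := R) (k1 :&: k2) v]|%:R ->
  ~~ ((rho + delta)%:E <= self_overlap_at c (k1 :|: k2))%E ->
  c <= ov (hat (graph_image sg^-1%g k1) k2) sg.
Proof.
move=> n0 hmax rho1 e1 e2 hcore hso.
have nR : 0 < n%:R :> R by rewrite ltr0n.
set G := graph_image sg^-1%g k1; set si := hat G k2.
have Ge : G \subset edges n by apply: graph_image_edges.
pose W := [set v | rho + delta <= balanced_load (R := R) (graph_meet si G k2) v].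
have hW : 2 * c * n%:R <= #|W|%:R.
  apply: le_trans hcore _; rewrite ler_nat.
  apply: leq_trans (_ : dense_count rho%:E delta G k2 sg <= _)%N.
    apply: subset_leq_card; apply/fintype.subsetP => v; rewrite !inE -EFinD lee_fin.
    by rewrite /graph_meet graph_imageVK; apply: le_trans; rewrite lerD2r.
  apply: leq_trans (hmax G k2 Ge e2 sg) _; apply: subset_leq_card; apply/fintype.subsetP => v.
  by rewrite !inE -EFinD lee_fin.
(* The factor [sg^-1] acts first. The fixed points of [tau] are the images under [sg] of the
   vertices where [si] and [sg] agree. *)
pose tau := (sg^-1 * si)%g.
have hA : #|W :&: Der tau|%:R < c * n%:R.
  rewrite ltNge; apply: contra hso => hA; rewrite self_overlap_atE.
  apply/existsP; exists tau; apply/existsP; exists (W :&: Der tau).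
  rewrite hA subsetIr; apply/forall_inP => v; rewrite inE => /andP[]; rewrite inE => hv _.
  apply: le_trans hv _; apply: balanced_load_mono; apply: setISS; last exact: finset.subsetUr.
  by rewrite /G /tau -graph_imageM; apply: imsetS; apply: finset.subsetUl.
have hfix : (#|W :\: Der tau| <= #|[set v | si v == sg v]|)%N.
  rewrite -(card_imset [set v | si v == sg v] (@perm_inj _ sg)).
  apply: subset_leq_card; apply/fintype.subsetP => v; rewrite in_setD [v \in Der _]inE negbK => /andP[/eqP hv _].
  apply/imsetP; exists (sg^-1%g v); last by rewrite permKV.
  by rewrite inE permKV -permM hv.
rewrite /ov ler_pdivlMr //; have : #|W :\: Der tau|%:R <= #|[set v | si v == sg v]|%:R :> R by rewrite ler_nat.
have := congr1 (fun k => k%:R : R) (cardsID (Der tau) W); rewrite natrD.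
move: hA hW; lra.
Qed.

Lemma EE_pair_obs_meet (R : realType) n (s : R) (p : {set 'I_n} -> R) (phi : pred (graph n)) :
  (forall e, e \notin edges n -> p e = 0) ->
  EE p (fun g => pair_obs s g (fun k1 k2 _ => phi (k1 :&: k2))) = Pr (fun e => s ^+ 2 * p e) phi.
Proof.
move=> ps; rewrite EE_pair_obs //.
rewrite (eq_bigr (fun _ : 'S_n => Pr (fun e => s ^+ 2 * p e) phi / n`!%:R)) => [|sg _].
  by rewrite sumr_const card_Sn -[LHS]mulr_natr divfK ?pnatr_eq0 -?lt0n ?fact_gt0.
rewrite /Pr -pair_sum_meet mulr_suml; apply: eq_bigr => k1 _; rewrite mulr_suml.
by apply: eq_bigr => k2 _; rewrite mulrAC.
Qed.

(** * The supercritical case *)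

Section Feasibility.
Local Open Scope classical_set_scope.
Local Open Scope ring_scope.
Context {R : realType} {m : nat}.
Variables (Q : 'M[R]_m) (s : R).
Hypotheses (Qsym : forall i j, Q i j = Q j i) (Qpos : forall i j, 0 < Q i j).
Hypothesis (hs : 0 < s <= 1).
Context {d : nat -> measure_display} {T : forall n, measurableType (d n)}.
Variables (P : forall n, probability (T n) R) (com : forall n, T n -> {ffun 'I_n -> 'I_m}).
Variables (Gup K1 K2 : forall n, T n -> graph n) (pistar : forall n, T n -> 'S_n).
Hypothesis hsys : forall n, (forall i j, Q i j <= n%:R) ->
  correlated_sbm_system (P n) Q s (@com n) (@Gup n) (@K1 n) (@K2 n) (@pistar n).

Let G n (w : T n) := graph_image (pistar w)^-1%g (K1 w).
Let U n (w : T n) := graph_join (pistar w) (G w) (K2 w).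

(** Because SOV <= 1, the level SOV + delta lies below 1 + delta, where [dense_core] supplies a
    large set; because it lies strictly above SOV, a self-overlap of linear size at this level is
    unlikely. *)
Lemma supercritical_feasible :
  (1 < pliminf P (fun n w => (s ^+ 2 * perron_frobenius (Q *m diag_mx (community_sizes (com w))))%:E))%E ->
  exists2 delta : R, 0 < delta & forall hat : forall n, estimator n,
    (forall n, maximal_dense_set_estimator (SOV P U) delta (hat n)) ->
    (0 < pliminf P (fun n w => (ov (hat n (G w) (K2 w)) (pistar w))%:E))%E.
Proof.
rewrite /pliminf lteNr => /(@ereal_lt_EFin _ _ (-1))[b hb b1].
have /andP[s0 s1] := hs; have s01 : 0 <= s <= 1 by rewrite (ltW s0).
have [q [qm [q1 /andP[qm0 qm1] Qub Qlb]]] := positive_matrix_bounds Qpos.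
have q0 : 0 < q by apply: lt_le_trans q1.
have B1 : 1 <= (q / qm) ^+ 2.
  by apply: exprn_ege1; rewrite ler_pdivlMr // mul1r; apply: le_trans qm1 q1.
have sq0 : 0 < s ^+ 2 * qm by rewrite mulr_gt0 // exprn_gt0.
(* Midpoint of 1 and the lower bound -b on s^2 lambda; the other half of the gap absorbs the loss
   q/n of [perron_growth]. *)
pose r := (1 - b) / 2; have r1 : 1 < r by rewrite /r; move: (b1); lra.
have [delta [c0 [delta0 c00 hcore]]] := dense_core q0 sq0 B1 r1.
exists delta => // hat hmax.
(* Half of the dense set may be lost to vertices moved against the true matching, and c <= 1 is
   needed for the bounds on the self-overlap. *)
pose c := Num.min c0 1 / 2.
have hc : 0 < c <= 1.
  have h1 : Num.min c0 1 <= 1 by rewrite ge_min lexx orbT.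
  have h2 : 0 < Num.min c0 1 by rewrite lt_min c00 ltr01.
  by rewrite /c; apply/andP; split; move: h1 h2; lra.
have /andP[c_gt0 c_le1] := hc.
have c2 : 2 * c <= c0 by rewrite /c mulrC divfK // ge_min lexx.
have /andP[hpsi hS1] := SOV_bounds Qsym Qpos hs hsys hc.
have hS0 := le_trans (plimsup_self_overlap_ge0 P K1 K2 pistar c_le1) hpsi.
have [rho hrho] : exists rho : R, SOV P U = rho%:E.
  by rewrite -/(U) in hS1 hS0; case: (SOV P U) hS1 hS0 => [x||] //; exists x.
have rho1 : rho <= 1 by rewrite -lee_fin -hrho.
clear hS0 hS1.
have hlt : (plimsup P (fun n w => self_overlap_at c (@U n w)) < (rho + delta)%:E)%E.
  by apply: le_lt_trans hpsi _; rewrite -/U hrho lte_fin ltrDl.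
have b1' : 0 < - b - r by rewrite /r; move: (b1); lra.
rewrite oppe_gt0; apply: (@le_lt_trans _ _ (- c)%:E); last by rewrite lte_fin oppr_lt0.
apply: plimsup_le => x eta xc eta0.
have eta2 : 0 < eta / 2 by rewrite divr_gt0.
have eta4 : 0 < eta / 2 / 2 by rewrite divr_gt0.
have [N1 hN1] := plimsup_lt hb eta4.
have [N2 hN2] := plimsup_lt hlt eta2.
have [a0 ha0] := hcore _ eta4.
have [N3 hN3] := eventually_natr_ge (Num.max a0 (Num.max q (q / (- b - r)))).
exists (maxn (maxn N1 N2) (maxn N3 1)) => n.
rewrite !geq_max => /andP[/andP[nN1 nN2] /andP[nN3 n0]].
have := hN3 n nN3; rewrite !ge_max => /and3P[na0 nq nb].
have nR : 0 < n%:R :> R by rewrite ltr0n.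
have hn : correlated_sbm_system (P n) Q s (@com n) (@Gup n) (@K1 n) (@K2 n) (@pistar n).
  by apply: hsys => i j; apply: le_trans (Qub i j) nq.
pose core (X : graph n) := (X \subset edges n) &&
  ~~ (c0 * n%:R <= #|[set v | 1 + delta <= balanced_load (R := R) X v]%SET|%:R)%R.
pose A (k1 k2 : graph n) (sg : 'S_n) := (x <= - ov (hat n (graph_image sg^-1%g k1) k2) sg)%R.
pose A1 (k1 k2 : graph n) (_ : 'S_n) := core (k1 :&: k2).
pose A2 (k1 k2 : graph n) (_ : 'S_n) := ((rho + delta)%:E <= self_overlap_at c (k1 :|: k2))%E.
rewrite (_ : [set w | _]%classic = [set w | A (K1 w) (K2 w) (pistar w)]%classic); last first.
  by apply/seteqP; split=> w /=; rewrite lee_fin.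
apply: le_trans (prob_obs_union s01 hn (A1 := A1) (A2 := A2) _) _.
  move=> k1 k2 sg e1 e2 hA; rewrite /A2; apply/orP.
  have [|hso] := boolP (_ <= self_overlap_at _ _)%E; [by right|left].
  rewrite /A1 /core (fintype.subset_trans (finset.subsetIl k1 k2) e1) /=.
  apply/negP => hcoreX; move: hA; apply/negP; rewrite -ltNge; apply: le_lt_trans xc.
  rewrite lerN2; apply: (maximal_dense_set_overlap (hat := hat n) (k1 := k1) sg n0 _ rho1 e1 e2 _ hso).
    by rewrite -hrho; apply: hmax.
  by apply: le_trans hcoreX; rewrite ler_wpM2r // ltW.
rewrite (splitr eta) EFinD; apply: leeD; last first.
  apply: le_trans (hN2 n nN2); rewrite le_eqVlt; apply/orP; left; apply/eqP; congr (P n _).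
  by apply/seteqP; split=> w /=; rewrite /A2 /U /G /graph_join graph_imageVK.
rewrite (splitr (eta / 2)).
pose good (g : {ffun 'I_n -> 'I_m}) := - b < s ^+ 2 * perron_frobenius (Q *m diag_mx (community_sizes g)).
apply: (prob_obs_le s01 hn (good := good) (ltW eta4)) => [|g hg].
  apply: le_trans (hN1 n nN1); rewrite le_eqVlt; apply/orP; left; apply/eqP; congr (P n _).
  by apply/seteqP; split=> w /=; rewrite lee_fin -leNgt lerNr.
rewrite EE_pair_obs_meet; last exact: edge_law_supp.
have [F hF1 hF] := perron_function Qsym Qpos Qub Qlb qm0 g n0.
have F1 u : 1 <= F u by case/andP: (hF1 u).
have pw := edge_law_weights Qsym Qpos Qub g q0 nq.
have s2 : 0 <= s ^+ 2 <= 1 by rewrite exprn_ge0 ?exprn_ile1 // ltW.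
have /andP[s20 s21] := s2.
apply: (ha0 n (fun e => s ^+ 2 * edge_law Q g e) F na0) => //.
- by move=> e; have /andP[p0 p1] := pw e; rewrite mulr_ge0 // mulr_ile1.
- by move=> e en; rewrite edge_law_supp // mulr0.
- move=> e; have /andP[p0 p1] := edge_law_bounds Qsym Qpos Qub g e q0.
  by apply: le_trans p1; rewrite ler_piMl.
- by move=> u v uv; rewrite edge_law_pair // -mulrA ler_wpM2l // ler_wpM2r // invr_ge0.
- move=> u; apply: le_trans (perron_growth Qsym Qpos Qub s01 F1 hF u).
  rewrite ler_wpM2r ?(le_trans ler01) //.
  have : q / n%:R <= - b - r by rewrite ler_pdivrMr // mulrC -ler_pdivrMr.
  by move: hg; rewrite /good; lra.
Qed.

End Feasibility.

Local Open Scope classical_set_scope.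
Local Open Scope ring_scope.

Theorem corollary6 (R : realType) (m : nat) (hm : (1 <= m)%N)
  (Q : 'M[R]_m) (Qsym : forall i j, Q i j = Q j i) (Qpos : forall i j, 0 < Q i j)
  (s : R) (hs : 0 < s <= 1)
  (d : nat -> measure_display) (T : forall n, measurableType (d n))
  (P : forall n, probability (T n) R)
  (com : forall n, T n -> {ffun 'I_n -> 'I_m})
  (Gup K1 K2 : forall n, T n -> graph n)
  (pistar : forall n, T n -> 'S_n)
  (hsys : forall n, (forall i j, Q i j <= n%:R) ->
     correlated_sbm_system (P n) Q s (@com n) (@Gup n) (@K1 n) (@K2 n)
       (@pistar n)) :
  let lambda := fun n (w : T n) =>
    perron_frobenius (Q *m diag_mx (community_sizes (com n w))) in
  let G := fun n (w : T n) => graph_image (pistar n w)^-1%g (K1 n w) in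
  let H := fun n (w : T n) => K2 n w in
  let U := fun n (w : T n) => graph_join (pistar n w) (G n w) (H n w) in
  ((1 < pliminf P (fun n w => (s ^+ 2 * lambda n w)%:E))%E ->
     exists2 delta : R, 0 < delta &
       forall hatpi : forall n, estimator n,
         (forall n, maximal_dense_set_estimator (SOV P U) delta (hatpi n)) ->
         (0 < pliminf P (fun n w =>
            (ov (hatpi n (G n w) (H n w)) (pistar n w))%:E))%E)
  /\
  ((plimsup P (fun n w => (s ^+ 2 * lambda n w)%:E) < 1)%E ->
     forall hatpi' : forall n, estimator n,
       plimsup P (fun n w =>
         (ov (hatpi' n (G n w) (H n w)) (pistar n w))%:E) = 0%E).
Proof.
move=> lambda G H U; split.
  exact: (supercritical_feasible Qsym Qpos hs hsys).
exact: (subcritical_intractable Qsym Qpos hs hsys).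
Qed.
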